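(* Given $n \geq 2$ and $1 \leq m \leq n-1$, the algebra $\mathcal{Z}_{n,m}$ is (isomorphic to) the Nakayama algebra $N_{n,a,s}$, where: (1) if $n-m$ is odd, then $$a=\left[\frac{2n}{n-m+1}\right] \quad\text{and}\quad s= \frac a 2 \big((a-1)n-(a+1)m+a-1\big)+1;$$ (2) if $n-m$ is even, then $$a=\left[\frac{2(n-1)}{n-m}\right]\quad\text{and}\quad s= \frac a 2 \big((a-1)n-(a+1)m+2\big).$$
   Context: $[x]$ denotes the greatest integer less than or equal to the real number $x$. All algebras are finite dimensional quiver algebras $KQ/I$ over a fixed field $K$ ($I$ an admissible ideal), connected and non-semisimple; modules are finitely generated right modules. A CNakayama algebra with $n$ simple modules is such an algebra $A$ whose quiver is the oriented cycle $0\to1\to\dots\to n-1\to 0$. Its Kupisch series is $[c_0,\dots,c_{n-1}]$ with $c_i=\dim_K e_iA$, where $e_iA$ is the uniserial indecomposable projective module with composition factors, from the top, $S_i,S_{i+1},S_{i+2},\dots$ (indices modulo $n$). The Kupisch series is defined up to cyclic shift and determines the algebra up to isomorphism. For $n\geq 2$, $a\geq 2$, $1\leq s\leq n-1$, $N_{n,a,s}$ is the CNakayama algebra with $n$ simple modules and Kupisch series $[a,\dots,a,a+1,\dots,a+1]$, where $a$ appears $s$ times (first) and $a+1$ appears $n-s$ times. A D1-CNakayama algebra is a CNakayama algebra with exactly one indecomposable injective non-projective module up to isomorphism; these are exactly the algebras $N_{n,a,s}$. For $1\leq m\leq n-1$, $\mathcal{Z}_{n,m}$ denotes the unique (up to isomorphism)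 D1-CNakayama algebra with $n$ simple modules and global dimension $n+m-1$ (such an algebra exists and is unique). *)

(* Defs.v *)
From HB Require Import structures.
From mathcomp Require Import all_boot all_order all_algebra all_field.

Set Implicit Arguments.
Unset Strict Implicit.
Unset Printing Implicit Defensive.

Import GRing.Theory.
Local Open Scope ring_scope.

(* The oriented cycle 0 -> 1 -> ... -> n-1 -> 0 has one path of each length   *)
(* out of each vertex.  An element f of the path algebra is stored as the     *)
(* family of polynomials in which the coefficient of 'X^l in f i is the       *)
(* coefficient of the path of length l starting at i; that path ends at       *)
(* iter l (@ordS n) i.  Paths are composed from left to right, so that, for   *)
(* right modules, e_i A is spanned by the paths starting at i.                *)
Record cyclePath (K : fieldType) (n : nat) : Type :=
  CyclePath { cpCoef :> {ffun 'I_n -> {poly K}} }.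

HB.instance Definition _ (K : fieldType) (n : nat) :=
  [isNew for @cpCoef K n].
HB.instance Definition _ (K : fieldType) (n : nat) :=
  [Choice of cyclePath K n by <:].

Section CyclePath.

Variables (K : fieldType) (n : nat).
Implicit Types f g h : cyclePath K n.

Lemma cpP f g : (forall i k, (f i)`_k = (g i)`_k) -> f = g.
Proof.
move=> fg; apply: val_inj; apply/ffunP => i; apply/polyP => k; exact: fg.
Qed.

Definition cpAdd f g : cyclePath K n := CyclePath (cpCoef f + cpCoef g).
Definition cpOpp f : cyclePath K n := CyclePath (- cpCoef f).
Definition cpScale (a : K) f : cyclePath K n := CyclePath (a *: cpCoef f).

Fact cpAddA : associative cpAdd.
Proof. by move=> f g h; apply: val_inj; apply: addrA. Qed.
Fact cpAddC : commutative cpAdd.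
Proof. by move=> f g; apply: val_inj; apply: addrC. Qed.
Fact cpAdd0 : left_id (CyclePath 0) cpAdd.
Proof. by move=> f; apply: val_inj; apply: add0r. Qed.
Fact cpAddN : left_inverse (CyclePath 0) cpOpp cpAdd.
Proof. by move=> f; apply: val_inj; apply: addNr. Qed.

HB.instance Definition _ := GRing.isZmodule.Build (cyclePath K n)
  cpAddA cpAddC cpAdd0 cpAddN.

Fact cpScaleA a b f : cpScale a (cpScale b f) = cpScale (a * b) f.
Proof. by apply: val_inj; apply: scalerA. Qed.
Fact cpScale1 : left_id 1 cpScale.
Proof. by move=> f; apply: val_inj; apply: scale1r. Qed.
Fact cpScaleDr : right_distributive cpScale +%R.
Proof. by move=> a f g; apply: val_inj; apply: scalerDr. Qed.
Fact cpScaleDl f : {morph cpScale^~ f : a b / a + b}.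
Proof. by move=> a b; apply: val_inj; apply: scalerDl. Qed.

HB.instance Definition _ := GRing.Zmodule_isLmodule.Build K (cyclePath K n)
  cpScaleA cpScale1 cpScaleDr cpScaleDl.

Lemma cpDE f g i : (f + g) i = f i + g i.
Proof. exact: ffunE. Qed.

Lemma cpZE (a : K) f i : (a *: f) i = a *: f i.
Proof. exact: ffunE. Qed.

Definition cpVertex (i : 'I_n) : cyclePath K n :=
  CyclePath [ffun j => (j == i)%:R].

Definition cpOne : cyclePath K n := CyclePath [ffun _ => 1].

Definition cpMul f g : cyclePath K n :=
  CyclePath [ffun i => \sum_(l < size (f i))
    (f i)`_l *: ('X^l * g (iter l (@ordS n) i))].

Lemma coef_cpMul f g (i : 'I_n) k :
  (cpMul f g i)`_k
    = \sum_(l < k.+1) (f i)`_l * (g (iter l (@ordS n) i))`_(k - l).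
Proof.
rewrite ffunE coef_sum.
under eq_bigr => l _ do rewrite coefZ coefXnM.
pose F l : K := (f i)`_l * (if (k < l)%N then 0 else
                              (g (iter l (@ordS n) i))`_(k - l)).
transitivity (\sum_(0 <= l < maxn (size (f i)) k.+1) F l).
  rewrite -(big_mkord xpredT F).
  rewrite (big_cat_nat (n := size (f i)) (p := maxn _ _)) ?leq_maxl //=.
  rewrite [X in _ = _ + X]big_nat_cond [X in _ = _ + X]big1 ?addr0 //.
  move=> l /andP[/andP[sl _] _]; by rewrite /F nth_default ?mul0r.
rewrite (big_cat_nat (n := k.+1)) ?leq_maxr //=.
rewrite [X in _ + X]big_nat_cond [X in _ + X]big1 ?addr0.
  rewrite big_mkord; apply: eq_bigr => l _.
  by rewrite /F ltnNge -ltnS ltn_ord.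
by move=> l /andP[/andP[kl _] _]; rewrite /F kl mulr0.
Qed.

Lemma cpMulA : associative cpMul.
Proof.
move=> f g h; apply: cpP => i k; rewrite !coef_cpMul.
pose F l j : K := (f i)`_l * (g (iter l (@ordS n) i))`_(j - l)
  * (h (iter j (@ordS n) i))`_(k - j).
transitivity (\sum_(l < k.+1) \sum_(j < k.+1 | (l <= j)%N) F l j).
  apply: eq_bigr => l _; rewrite coef_cpMul mulr_sumr; symmetry.
  have lk : (l <= k)%N by rewrite -ltnS.
  rewrite -(big_mkord (fun j => (l <= j)%N) (F l)).
  rewrite (big_cat_nat (n := l)) //=; last exact: ltnW.
  rewrite big_nat_cond big1 ?add0r => [|j]; last first.
    by move=> /andP[/= jl]; rewrite leqNgt jl.
  rewrite big_nat_cond (eq_bigl (fun j => (l <= j < k.+1)%N)) => [|j]; last first.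
    by rewrite /=; case: (l <= j)%N; rewrite ?andbF ?andbT.
  rewrite -big_nat -{1}[nat_of_ord l]add0n big_addn big_mkord subSn //.
  apply: eq_bigr => j _; rewrite /F addnK -iterD mulrA.
  by rewrite [in (k - (_ + _))%N]addnC subnDA.
rewrite (exchange_big_dep xpredT) //=; apply: eq_bigr => j _.
rewrite coef_cpMul mulr_suml.
rewrite -(big_mkord (fun l => (l <= j)%N) (F ^~ j)).
rewrite (big_cat_nat (n := j.+1)) //=.
rewrite [X in _ + X]big_nat_cond [X in _ + X]big1 ?addr0 => [|l]; last first.
  by move=> /andP[/andP[jl _]]; rewrite leqNgt jl.
rewrite big_nat_cond (eq_bigl (fun l => (0 <= l < j.+1)%N)) => [|l]; last first.
  by rewrite /= ltnS andbb.
by rewrite -big_nat big_mkord.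
Qed.

Lemma cpMul1f : left_id cpOne cpMul.
Proof.
move=> f; apply: cpP => i k; rewrite coef_cpMul ffunE.
rewrite big_ord_recl coef1 mul1r subn0 big1 ?addr0 // => l _.
by rewrite coef1 mul0r.
Qed.

Lemma cpMulf1 : right_id cpOne cpMul.
Proof.
move=> f; apply: cpP => i k; rewrite coef_cpMul.
rewrite big_ord_recr /= ffunE coef1 subnn mulr1 big1 ?add0r // => l _.
by rewrite ffunE coef1 subn_eq0 leqNgt ltn_ord mulr0.
Qed.

Lemma cpMulDl : left_distributive cpMul +%R.
Proof.
move=> f g h; apply: cpP => i k.
rewrite cpDE coefD !coef_cpMul -big_split; apply: eq_bigr => l _ /=.
by rewrite cpDE coefD mulrDl.
Qed.

Lemma cpMulDr : right_distributive cpMul +%R.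
Proof.
move=> f g h; apply: cpP => i k.
rewrite cpDE coefD !coef_cpMul -big_split; apply: eq_bigr => l _ /=.
by rewrite cpDE coefD mulrDr.
Qed.

HB.instance Definition _ := GRing.Zmodule_isPzRing.Build (cyclePath K n)
  cpMulA cpMul1f cpMulf1 cpMulDl cpMulDr.

(* Algebra structures require 1 != 0, which fails for n = 0; hence algebra    *)
(* morphisms out of cyclePath are unbundled as multiplicative linear maps.    *)
Lemma cpScaleAl (a : K) f g : a *: (f * g) = a *: f * g.
Proof.
apply: cpP => i k.
rewrite cpZE coefZ !coef_cpMul mulr_sumr; apply: eq_bigr => l _.
by rewrite cpZE coefZ mulrA.
Qed.

Lemma cpScaleAr (a : K) f g : a *: (f * g) = f * (a *: g).
Proof.
apply: cpP => i k.
rewrite cpZE coefZ !coef_cpMul mulr_sumr; apply: eq_bigr => l _.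
by rewrite cpZE coefZ mulrCA.
Qed.

(* The l-th power of the arrow ideal: the span of the paths of length >= l.   *)
Definition inArrowPower (l : nat) f : Prop :=
  forall i k, (k < l)%N -> (f i)`_k = 0.

End CyclePath.

Section RightModules.

Variables (K : fieldType) (A : falgType K).

Definition finitely_generated (M : lmodType A^c) : Prop :=
  exists (k : nat) (g : 'I_k -> M),
    forall x, exists a : 'I_k -> A^c, x = \sum_(i < k) a i *: g i.

(* Right A-modules are left modules over the converse ring A^c.               *)
Record fgModule : Type := FgModule {
  fgmod_sort :> lmodType A^c;
  fgmod_fg : finitely_generated fgmod_sort
}.

Definition zero_module (M : lmodType A^c) : Prop := forall x : M, x = 0.

Definition isomorphic_modules (M N : lmodType A^c) : Prop :=
  exists f : {linear M -> N}, bijective f.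

Definition surjective (T U : Type) (f : T -> U) : Prop :=
  forall y, exists x, f x = y.

Definition projective (P : fgModule) : Prop :=
  forall (U V : fgModule) (p : {linear U -> V}) (f : {linear P -> V}),
    surjective p -> exists g : {linear P -> U}, forall x, p (g x) = f x.

Definition injective_module (I : fgModule) : Prop :=
  forall (U V : fgModule) (j : {linear U -> V}) (f : {linear U -> I}),
    injective j -> exists g : {linear V -> I}, forall x, g (j x) = f x.

Definition indecomposable (M : fgModule) : Prop :=
  ~ zero_module M /\
  forall U V : fgModule, isomorphic_modules M (U * V)%type ->
    zero_module U \/ zero_module V.

Definition proj_dim_le (M : fgModule) (d : nat) : Prop :=
  exists (P : nat -> fgModule) (eps : {linear P 0%N -> M})
         (del : forall i, {linear P i.+1 -> P i}),
    [/\ (forall i, projective (P i)),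
        (forall i, (d < i)%N -> zero_module (P i)),
        surjective eps,
        (forall x, eps x = 0 <-> exists y, del 0%N y = x) &
        (forall i x, del i x = 0 <-> exists y, del i.+1 y = x)].

Definition gl_dim_le (d : nat) : Prop :=
  forall M : fgModule, proj_dim_le M d.

Definition gl_dim_eq (d : nat) : Prop :=
  gl_dim_le d /\ forall d', gl_dim_le d' -> (d <= d')%N.

Definition inj_nonproj (M : fgModule) : Prop :=
  [/\ indecomposable M, injective_module M & ~ projective M].

Definition unique_inj_nonproj : Prop :=
  exists2 M : fgModule, inj_nonproj M &
    forall M' : fgModule, inj_nonproj M' -> isomorphic_modules M' M.

End RightModules.

Section CNakayama.

Variable K : fieldType.

(* phi exhibits A as the quotient of the path algebra of the oriented cycle   *)
(* with n vertices by an admissible ideal, the kernel of phi.  Such an A is   *)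
(* automatically connected and, as the arrows survive, non-semisimple.        *)
Definition admissible_presentation (n : nat) (A : falgType K)
    (phi : {linear cyclePath K n -> A}) : Prop :=
  [/\ monoid_morphism phi,
      surjective phi,
      (forall f, phi f = 0 -> inArrowPower 2 f) &
      (exists2 l, (2 <= l)%N & forall f, inArrowPower l f -> phi f = 0)].

Definition CNakayama (n : nat) (A : falgType K) : Prop :=
  exists phi : {linear cyclePath K n -> A}, admissible_presentation phi.

(* Relabelling the vertices of the cycle shifts c cyclically.                 *)
Definition has_kupisch_series (n : nat) (c : seq nat) (A : falgType K) : Prop :=
  size c = n /\
  exists2 phi : {linear cyclePath K n -> A}, admissible_presentation phi &
    forall i : 'I_n,
      \dim (<[phi (cpVertex K i)]> * {:A})%VS = nth 0%N c i.

(* A is a copy of N_{n,a,s}.                                                  *)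
Definition is_N (n a s : nat) (A : falgType K) : Prop :=
  has_kupisch_series n (nseq s a ++ nseq (n - s) a.+1) A.

Definition D1_CNakayama (n : nat) (A : falgType K) : Prop :=
  CNakayama n A /\ unique_inj_nonproj A.

(* A is a copy of Z_{n,m}; existence and uniqueness are not built in.         *)
Definition is_Z (n m : nat) (A : falgType K) : Prop :=
  D1_CNakayama n A /\ gl_dim_eq A (n + m - 1).

Definition isomorphic_algebras (A B : falgType K) : Prop :=
  exists f : {lrmorphism A -> B}, bijective f.

End CNakayama.

(* Main.v *)
Require Import Defs.
From HB Require Import structures.
From mathcomp Require Import all_boot all_order all_algebra all_field.
From mathcomp Require Import zify ring.
From Stdlib Require Import Classical.

(* Write [f i = i + c_i], lifted to all integers.  Over a CNakayama algebra
   the intervals [[i, j)] with [i < j <= f i] are uniserial modules, [[i, f i)]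
   is projective and the syzygy of [[i, j)] is [[j, f i)].  Hence the global
   dimension depends only on the orbits of [f], and a residue missed by [f] (a
   hole) is the same thing as an injective non-projective indecomposable.  One
   hole forces the Kupisch series [a, .., a, a+1, .., a+1]; then [f] identifies
   only [-1] with [0] and misses only [b = s + a] modulo [n].

   The orbit of [b] reaches -1 or 0 after some [k - 1] steps; the [p = n - k]
   residues outside the first [k] points of the orbit form a core permuted by
   [f].  If [f] does not send every core point to the next one, two
   neighbouring core points span a module of infinite projective dimension.
   Otherwise the global dimension is [2k] when the orbit arrives at -1 and
   [2k - 1] when it arrives at 0.  The parity of [n - m] thus tells the two
   cases apart, [n] and [m] determine [p], and following the core through one
   period determines [a] and [s]. *)

Import GRing.Theory.

(** * Iterates of the end point map *)

(** The two step lengths along the core express [n] through [p], [a] and the number of short steps,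
    but leave [s] free in the range [(w - 1) a < s <= w a]. What pins [s] down is that [s - 1], when
    the orbit of the hole arrives at -1, or [s], when it arrives at 0, is itself a core point; this
    is the delicate step.

    The lower bound for the global dimension comes from [[[s, b)]]: since [f s = b + 1], its syzygy
    is the simple module at the hole.

    With [k = n - p], the equation [2k = n + m - 1] reads [2p = n - m + 1], and [2k - 1 = n + m - 1]
    reads [2p = n - m]. As [0 < w <= p], the relation between [n], [p], [a] and [w] is a division
    with remainder, so [a] is [n / p] or [(n - 1) / p] rounded down; this is the origin of the
    integer parts.

    Points are natural numbers, so arguments that would go down on the integers first shift
    everything up by a multiple of [n]. *)

Lemma modnDMr n x t : (x + t * n) %% n = x %% n.
Proof. by rewrite addnC modnMDl. Qed.

(** Over the natural numbers the multiple of [n] has to be added to the smaller side, hence two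
    cases. *)
Lemma eqm_split {n} x y : x = y %[mod n] -> exists t, x = y + t * n \/ y = x + t * n.
Proof.
move=> e; have [xy|/ltnW yx] := leqP x y.
  exists (y %/ n - x %/ n); right; have := leq_div2r n xy.
  rewrite {2}(divn_eq y n) {1}(divn_eq x n) e mulnBl.
  have: x %/ n * n <= y %/ n * n by rewrite leq_mul2r leq_div2r ?orbT.
  by lia.
exists (x %/ n - y %/ n); left.
rewrite {1}(divn_eq x n) {1}(divn_eq y n) e mulnBl.
have: y %/ n * n <= x %/ n * n by rewrite leq_mul2r leq_div2r ?orbT.
by lia.
Qed.

Section Syzygy.

Variable f : nat -> nat.

(* The [t]-th syzygy of the interval [[i, j)] is [[syz i j t, syz i j t.+1)]. *)
Fixpoint syz (i j t : nat) : nat := if t is t'.+1 then syz j (f i) t' else i.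

(** Equal ends at index [d0 + 1] mean that this syzygy is zero, so the projective dimension of the
    interval is at most [d0]. *)
Definition gdle (d : nat) : Prop :=
  forall i j, i < j <= f i ->
  exists2 d0, d0 <= d & syz i j d0.+1 = syz i j d0.+2.

(** Two syzygies apply [f] to both ends, so the even and odd terms are the [f]-orbits of [i] and of
    [j]. *)
Lemma syzSS i j t : syz i j t.+2 = f (syz i j t).
Proof.
elim: t i j => [|t IH] i j //=.
exact: (IH j (f i)).
Qed.

Lemma syz_even i j t : syz i j t.*2 = iter t f i.
Proof. by elim: t => [|t IH] //; rewrite doubleS syzSS IH. Qed.

Lemma syz_odd i j t : syz i j t.*2.+1 = iter t f j.
Proof. exact: syz_even. Qed.

Hypothesis f_mono : {homo f : x y / x <= y}.

Lemma syz_le i j t : i <= j <= f i -> syz i j t <= syz i j t.+1.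
Proof.
elim: t i j => [|t IH] i j /andP[ij ji]; first exact: ij.
by apply: IH; rewrite ji f_mono.
Qed.

End Syzygy.

(** * The end point map of [N_{n,a,s}] *)

Section D1.

Variables n a s : nat.
Hypotheses (n_gt1 : 1 < n) (a_gt1 : 1 < a) (s_gt0 : 0 < s) (s_ltn : s < n).

Definition d1f (x : nat) : nat := x + a + (s <= x %% n).
Local Notation f := d1f.
Local Notation "x =m y" := (x = y %[mod n]) (at level 70).

Lemma d1f_addMn x t : f (x + t * n) = f x + t * n.
Proof. by rewrite /d1f modnDMr; lia. Qed.

Lemma d1f_le x y : x <= y -> f x <= f y.
Proof.
rewrite leq_eqVlt => /predU1P[->//|xy].
by rewrite /d1f; lia.
Qed.

Lemma d1f_gt x : x.+1 < f x.
Proof. by rewrite /d1f; lia. Qed.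

(** [f] advances by one at each step, except that it jumps by two from [s - 1] to [s] and stalls
    from -1 to 0 modulo [n]; only the stall breaks injectivity. *)
Lemma d1f_inj x y : x < y -> f x = f y -> y = x.+1 /\ n %| y.
Proof.
rewrite /d1f => xy e.
have eyx : y = x.+1 by lia.
split=> //; move: e; rewrite {}eyx modnS.
by case: (n %| x.+1) => //; lia.
Qed.

Lemma iter_f_addMn j x t : iter j f (x + t * n) = iter j f x + t * n.
Proof. by elim: j => //= j ->; rewrite d1f_addMn. Qed.

Lemma iter_f_le j x y : x <= y -> iter j f x <= iter j f y.
Proof. by elim: j => //= j IH xy; apply/d1f_le/IH. Qed.

Lemma f_eqm x y : x =m y -> f x =m f y.
Proof.
move=> /eqm_split[t [->|->]]; rewrite d1f_addMn modnDMr //.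
Qed.

Lemma iter_f_eqm j x y : x =m y -> iter j f x =m iter j f y.
Proof. by elim: j => //= j IH /IH; apply: f_eqm. Qed.

Definition merging x := (n %| x) || (n %| x.+1).

Lemma f_eqm_inj x y : f x =m f y -> x =m y \/
  (n %| x /\ n %| y.+1) \/ (n %| x.+1 /\ n %| y).
Proof.
have main u v : f u = f v -> u =m v \/
    (n %| u /\ n %| v.+1) \/ (n %| u.+1 /\ n %| v).
  move=> e; case: (ltngtP u v) => [uv|vu|->]; last by left.
    by have [-> h] := d1f_inj _ _ uv e; right; right.
  by have [-> h] := d1f_inj _ _ vu (esym e); right; left.
have dM t x' : (n %| x' + t * n) = (n %| x') by rewrite dvdn_addl ?dvdn_mull.
move=> /eqm_split[t [e|e]].
  have /main : f x = f (y + t * n) by rewrite d1f_addMn.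
  by rewrite -addSn !dM modnDMr.
have /main : f (x + t * n) = f y by rewrite d1f_addMn.
by rewrite -addSn !dM modnDMr.
Qed.

Definition hole := s + a.

(** The hole is skipped by the jump from [f (s - 1) = hole - 1] to [f s = hole + 1]. *)
Lemma f_hole x : ~ (f x =m hole).
Proof.
rewrite /d1f /hole addnAC => /eqP; rewrite eqn_modDr => /eqP.
rewrite (modn_small s_ltn) -modnDml.
have xn : x %% n < n by rewrite ltn_mod; lia.
case: leqP => sx; last by rewrite addn0 modn_small; lia.
rewrite addn1; case: (ltngtP (x %% n).+1 n) => [h|h|->].
- by rewrite modn_small; lia.
- by lia.
- by rewrite modnn; lia.
Qed.

Definition orb j := iter j f hole.

Lemma orb_pull x j : f x =m orb j.+1 -> ~~ merging (orb j) -> x =m orb j.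
Proof.
rewrite /orb iterS => /f_eqm_inj[//|]; rewrite /merging.
by case=> -[_ ->]; rewrite ?orbT.
Qed.

(** * The core and bounds for the global dimension *)

Section Core.

Variable kappa : nat.
Hypotheses (kappa_merging : merging (orb kappa))
  (kappa_min : forall j, j < kappa -> ~~ merging (orb j)).

(* With [kappa] the first time at which the orbit of the hole is at a merging
   point, these are the points in the image of every iterate of [f]. *)
Definition core x := ~~ has (fun j => x %% n == orb j %% n) (iota 0 kappa.+1).

Lemma coreP x : reflect (forall j, j <= kappa -> ~ (x =m orb j)) (core x).
Proof.
apply: (iffP hasPn) => [h j jk e|h j].
  by have := h j; rewrite mem_iota /= add0n ltnS jk e eqxx; case/(_ isT)/negP.
by rewrite mem_iota => jk; apply/eqP/h; lia.
Qed.

Lemma ncoreP x : reflect (exists2 j, j <= kappa & x =m orb j) (~~ core x).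
Proof.
rewrite negbK; apply: (iffP hasP) => -[j].
  by rewrite mem_iota => jk /eqP e; exists j => //; lia.
by move=> jk /eqP e; exists j => //; rewrite mem_iota; lia.
Qed.

Lemma core_eqm x y : x =m y -> core x = core y.
Proof. by move=> e; rewrite /core e. Qed.

Lemma core_addMn x t : core (x + t * n) = core x.
Proof. by apply: core_eqm; rewrite modnDMr. Qed.

Lemma orb_pull_iter i x j : i <= j -> j <= kappa -> iter i f x =m orb j ->
  x =m orb (j - i).
Proof.
elim: i x j => [|i IH] x [|j] //; rewrite ?subn0 // ltnS subSS iterSr => ij jk e.
have := IH _ _ (leqW ij) jk e.
rewrite subSn // => /orb_pull; apply; apply: kappa_min; lia.
Qed.

Lemma orb_ncore j : j <= kappa -> ~~ core (orb j).
Proof. by move=> jk; apply/ncoreP; exists j. Qed.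

(** If the image were an orbit point [orb j] with [j <= kappa < i], pulling back [j] steps would
    exhibit the hole as a value of [f]. *)
Lemma iter_core i x : kappa < i -> core (iter i f x).
Proof.
move=> ki; apply/coreP => j jk.
have -> : i = (j + (i - j - 1).+1) by lia.
rewrite iterD => /orb_pull_iter -/(_ (leqnn j) jk).
rewrite subnn; exact: f_hole.
Qed.

Lemma f_core x : core x -> core (f x).
Proof.
move=> /coreP cx; apply/coreP => -[|j] jk; first exact: f_hole.
by move/orb_pull => h; apply: (cx j); [lia | apply/h/kappa_min].
Qed.

Lemma iter_f_core i x : core x -> core (iter i f x).
Proof. by elim: i => //= i IH /IH /f_core. Qed.

Lemma orb_inj i j : i <= kappa -> j <= kappa -> orb i =m orb j -> i = j.
Proof.
have main u v : u < v -> v <= kappa -> ~ (orb u =m orb v).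
  move=> uv vk; rewrite {1}/orb => e.
  have := orb_pull_iter _ _ _ (ltnW uv) vk e.
  have -> : v - u = (v - u - 1).+1 by lia.
  by rewrite /orb iterS => /esym; apply: f_hole.
move=> ik jk e; case: (ltngtP i j) => // h; first by case: (main _ _ h jk).
by case: (main _ _ h ik).
Qed.

Lemma core_count : count core (iota 0 n) + kappa.+1 = n.
Proof.
rewrite -[RHS](size_iota 0) -(count_predC core); congr (_ + _).
pose r := [seq orb j %% n | j <- iota 0 kappa.+1].
have ru : uniq r.
  rewrite map_inj_in_uniq ?iota_uniq // => i j; rewrite !mem_iota => ik jk.
  by apply: orb_inj; lia.
rewrite -size_filter -[LHS](size_iota 0 kappa.+1) -(size_map (fun j => orb j %% n)).
apply/perm_size/uniq_perm => //; first by rewrite filter_uniq ?iota_uniq.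
move=> x; rewrite mem_filter mem_iota add0n leq0n [predC _ _]/=; apply/mapP/idP.
  move=> [j]; rewrite mem_iota => jk ->.
  rewrite -(@core_eqm (orb j)) ?modn_mod // orb_ncore; last by lia.
  by rewrite ltn_mod; lia.
move=> /andP[/ncoreP[j jk e] xn]; exists j; first by rewrite mem_iota; lia.
by rewrite -e modn_small.
Qed.

(** Of the two residues that [f] identifies, one is that of [orb kappa] and so lies outside the
    core. *)
Lemma f_core_inj x y : core x -> core y -> f x = f y -> x = y.
Proof.
have main u v : u < v -> core u -> core v -> f u = f v -> False.
  move=> uv /coreP/(_ _ (leqnn _)) cu /coreP/(_ _ (leqnn _)) cv e.
  have [ev nv] := d1f_inj _ _ uv e.
  case/orP: kappa_merging => h.
    by apply: cv; rewrite (eqP nv) (eqP h).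
  apply: cu; apply/eqP; rewrite -(eqn_modDr 1) !addn1 -ev.
  by rewrite (eqP nv) (eqP h).
by move=> cx cy e; case: (ltngtP x y) => // h; case: (main _ _ h); rewrite ?e.
Qed.

Lemma iter_f_core_lt i x y : core x -> core y -> x < y -> iter i f x < iter i f y.
Proof.
move=> cx cy xy; elim: i => //= i IH.
rewrite ltn_neqAle d1f_le ?(ltnW IH) // andbT.
apply/negP => /eqP /f_core_inj e; move: IH.
by rewrite e ?iter_f_core // ltnn.
Qed.

(** A periodic point is its own image, modulo [n], under arbitrarily high powers of [f], and those
    land in the core. *)
Lemma periodic_core p x : 0 < p -> iter p f x =m x -> core x.
Proof.
move=> p0 e.
have ei : forall i, iter (i * p) f x =m x.
  by elim=> [|i IH] //; rewrite mulSn iterD -[RHS]e; apply: iter_f_eqm.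
rewrite -(core_eqm _ _ (ei kappa.+1)); apply: iter_core.
by rewrite -ltnS in p0 *; nia.
Qed.

Lemma iter_f_merge m x y : x < y -> iter m f x = iter m f y ->
  exists2 i, i < m & n %| iter i f y.
Proof.
move=> xy; elim: m => [|m IH]; first by move=> /= e; lia.
have [/eqP/IH[i im h] _|ne] := boolP (iter m f x == iter m f y).
  by exists i => //; lia.
have lt : iter m f x < iter m f y by rewrite ltn_neqAle ne iter_f_le // ltnW.
by move=> /= /(d1f_inj _ _ lt)[_ h]; exists m.
Qed.

(** The two sides are the images of [f s] and [f hole], the ends of an even syzygy of [[[s, hole)]].
    They can meet only through the stall, which requires the orbit of the hole to be at 0, and
    before time [kappa] it is at no merging point. *)
Lemma hole_merge m : m <= kappa ->
  iter m f hole.+1 = iter m f (f hole) -> m = kappa /\ n %| orb kappa.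
Proof.
move=> mk /(iter_f_merge _ _ _ (d1f_gt hole))[i im].
rewrite -iterSr -/(orb _) => h.
have hm : merging (orb i.+1) by rewrite /merging h.
have [ik|ki] := ltnP i.+1 kappa; first by case/negP: (kappa_min _ ik).
have e : i.+1 = kappa by lia.
by rewrite -e; split=> //; lia.
Qed.

(* [f] sends each core point to the next core point. *)
Definition tight := forall y z, core y -> core z -> y < z -> f y <= z.

Lemma gdle_tight d : gdle f d -> tight.
Proof.
move=> gd y z cy cz yz; rewrite leqNgt; apply/negP => zf.
(* On the core [f] is strictly increasing, so no syzygy of [[[y, z)]] vanishes. *)
have lt t : syz f y z t < syz f y z t.+1.
  rewrite -[t]odd_double_half; case: (odd t); rewrite ?add0n ?add1n.
    by rewrite -doubleS !(syz_even, syz_odd) iterSr iter_f_core_lt ?f_core.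
  by rewrite syz_even syz_odd iter_f_core_lt.
have [|d0 _ e] := gd y z; first by rewrite yz ltnW.
by have := lt d0.+1; rewrite e ltnn.
Qed.

Lemma d1f_homo : {homo f : x y / x <= y}.
Proof. exact: d1f_le. Qed.

(** After [kappa + 1] applications of [f] both ends are core points [p <= q <= f p]; tightness
    leaves only [q = p], a zero syzygy, or [q = f p], a projective one. *)
Lemma tight_gdle : tight -> gdle f kappa.+1.*2.
Proof.
move=> tg i j /andP[ij jf].
have cp := iter_core kappa.+1 i (ltnSn _).
have cq := iter_core kappa.+1 j (ltnSn _).
have pq : iter kappa.+1 f i <= iter kappa.+1 f j by apply/iter_f_le/ltnW.
have qp : iter kappa.+1 f j <= f (iter kappa.+1 f i).
  by rewrite -(iterS kappa.+1) [X in _ <= X]iterSr iter_f_le.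
move: pq; rewrite leq_eqVlt => /predU1P[e|/(tg _ _ cp cq) pq].
  exists kappa.*2.+1; first by rewrite doubleS.
  by rewrite -doubleS syz_even syz_odd.
exists kappa.+1.*2 => //; rewrite syz_odd -doubleS syz_even iterS.
by apply/eqP; rewrite eqn_leq qp pq.
Qed.

(** One step is gained over [tight_gdle]: in the case [q = f p], [f] agrees on the two ends of the
    preceding syzygy. If these differed, the right one would be a core point divisible by [n], but
    that residue belongs to [orb kappa]. So the preceding syzygy is already zero. *)
Lemma tight_gdle_right : n %| orb kappa -> tight -> gdle f kappa.*2.+1.
Proof.
move=> nk tg i j ijf; have /andP[ij jf] := ijf.
have cp := iter_core kappa.+1 i (ltnSn _).
have cq := iter_core kappa.+1 j (ltnSn _).
have pq : iter kappa.+1 f i <= iter kappa.+1 f j by apply/iter_f_le/ltnW.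
have qp : iter kappa.+1 f j <= f (iter kappa.+1 f i).
  by rewrite -(iterS kappa.+1) [X in _ <= X]iterSr iter_f_le.
move: pq; rewrite leq_eqVlt => /predU1P[e|/(tg _ _ cp cq) pq].
  by exists kappa.*2.+1; rewrite // -doubleS syz_even syz_odd.
have fe : f (iter kappa f j) = f (iter kappa.+1 f i).
  by rewrite -iterS; apply/eqP; rewrite eqn_leq qp pq.
have := syz_le f d1f_homo i j kappa.*2.+1.
rewrite (ltnW ij) jf => /(_ isT).
rewrite -doubleS syz_odd syz_even leq_eqVlt => /predU1P[e|lt].
  exists kappa.*2; first exact: leqnSn.
  by rewrite syz_odd -doubleS syz_even.
have [_ h] := d1f_inj _ _ lt fe.
case/coreP/(_ kappa (leqnn _)): cp.
by rewrite (eqP h) (eqP nk).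
Qed.

Lemma syz_eq_step i j t t' : t <= t' -> syz f i j t = syz f i j t.+1 ->
  odd t = odd t' -> syz f i j t' = syz f i j t'.+1.
Proof.
move=> tt' e o; have -> : t' = (t' - t)./2.*2 + t.
  by rewrite halfK oddB // o addbb subn0 subnK.
by elim: (_./2) => [|r IH] //; rewrite doubleS !addSn !syzSS IH.
Qed.

Lemma f_s : f s = hole.+1.
Proof. by rewrite /d1f modn_small // leqnn addn1. Qed.

(** The test module is [[[s, hole)]]. A syzygy that vanishes also vanishes two steps later, so each
    parity is refuted at the largest index in range. *)
Lemma gdle_lb d : gdle f d -> (~~ (n %| orb kappa)) + kappa.*2.+1 <= d.
Proof.
move=> gd; have [|d0 d0d e] := gd s hole.
  by rewrite f_s leqnSn /hole; lia.
rewrite leqNgt; apply/negP => dk.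
(* At this odd index the left end is [orb kappa], outside the core, and the right end has just
   entered it. *)
have oddF : syz f s hole kappa.*2.+1 = syz f s hole kappa.*2.+2 -> False.
  rewrite syz_odd -doubleS syz_even -/(orb _) => h.
  have := orb_ncore kappa (leqnn _).
  by rewrite h iter_core.
have [o|o] := boolP (odd d0.+1).
  by apply/oddF/(syz_eq_step _ _ _ _ _ e); rewrite ?o /= ?odd_double //; lia.
move: dk; case: (boolP (n %| orb kappa)) => nk dk.
  have k0 : 0 < kappa by move: o; case: d0 d0d e => [//|d0] d0d e o; lia.
  have := syz_eq_step _ _ _ kappa.*2 _ e.
  rewrite syz_even syz_odd odd_double (negPf o) => /(_ _ erefl).
  have -> : kappa = kappa.-1.+1 by lia.
  rewrite !iterSr f_s => h; have [] := hole_merge kappa.-1 _ (h _); first by lia.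
    by move: o => /=; lia.
  by lia.
have := syz_eq_step _ _ _ kappa.+1.*2 _ e.
rewrite syz_even syz_odd odd_double (negPf o) => /(_ _ erefl).
rewrite !iterSr f_s => h; have [||_] := hole_merge kappa _ (h _); first by lia.
  by move: o => /=; lia.
by apply/negP.
Qed.

Lemma orbit_bracket y z : y <= z -> exists i, iter i f y <= z < iter i.+1 f y.
Proof.
move=> yz.
have ex : exists i, z < iter i f y.
  exists z.+1; elim: z.+1 => [|i IH] //=.
  by apply: leq_ltn_trans IH _; have := d1f_gt (iter i f y); lia.
case: (ex_minnP ex) => -[|i] hi min; first by move: hi => /=; lia.
by exists i; rewrite hi andbT leqNgt; apply/negP => /min; rewrite ltnn.
Qed.

(** If [z] lay strictly between two consecutive iterates of [y], tightness would push the upper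
    iterate to at most [z]. *)
Lemma tight_orbit y z : tight -> core y -> core z -> y <= z ->
  exists i, z = iter i f y.
Proof.
move=> tg cy cz /orbit_bracket[i /andP[iz zi]]; exists i.
move: iz; rewrite leq_eqVlt => /predU1P[//|/(tg _ _ (iter_f_core i y cy) cz)].
by rewrite leqNgt zi.
Qed.

Lemma iter_f_lt y i j : i < j -> iter i f y < iter j f y.
Proof.
elim: j => // j IH; rewrite ltnS leq_eqVlt => /predU1P[->|/IH ij] /=.
  by have := d1f_gt (iter j f y); lia.
by apply: ltn_trans ij _; have := d1f_gt (iter j f y); lia.
Qed.

Lemma iter_f_lt_inv y i j : iter i f y < iter j f y -> i < j.
Proof.
move=> h; rewrite ltnNge leq_eqVlt; apply/negP => /predU1P[e|/(iter_f_lt y)].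
  by rewrite e ltnn in h.
by lia.
Qed.

Lemma core_count_window y : count core (iota y n) = count core (iota 0 n).
Proof.
elim: y => // y <-.
have e : iota y n.+1 = y :: iota y.+1 n by [].
have : count core (iota y n.+1) = core y + count core (iota y.+1 n) by rewrite e.
have -> : n.+1 = n + 1 by lia.
rewrite iotaD count_cat /= addn0 -[n in y + n]mul1n core_addMn.
by lia.
Qed.

Lemma orbit_count y p : (forall z, core z -> y <= z -> exists i, z = iter i f y) ->
  core y -> iter p f y = y + n -> p + kappa.+1 = n.
Proof.
move=> orbit cy e; rewrite -[RHS]core_count; congr (_ + _).
rewrite -(core_count_window y) -size_filter -[LHS](size_iota 0).
rewrite -(size_map (fun i => iter i f y)).
apply/perm_size/uniq_perm; rewrite ?filter_uniq ?iota_uniq //.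
  rewrite map_inj_uniq ?iota_uniq // => i j h.
  by case: (ltngtP i j) => // /(iter_f_lt y); rewrite h ltnn.
move=> x; rewrite mem_filter mem_iota; apply/mapP/idP.
  move=> [i]; rewrite mem_iota add0n leq0n => /(iter_f_lt y) ip ->.
  rewrite -e ip iter_f_core // andbT /=.
  by case: i {ip} => // i; apply/ltnW/(iter_f_lt y 0).
move=> /and3P[cx yx]; have [i ->] := orbit _ cx yx.
by rewrite -e => /iter_f_lt_inv ip; exists i; rewrite // mem_iota.
Qed.

(** [orb kappa] is the first merging point of the orbit; if it is not at 0, the removed segment
    misses 0. *)
Lemma core0 : ~~ (n %| orb kappa) -> core 0.
Proof.
move=> nk; apply/coreP => j jk; rewrite mod0n => h.
have hj : n %| orb j by rewrite /dvdn -h.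
have hm : merging (orb j) by rewrite /merging hj.
have [jk'|kj] := ltnP j kappa; first by case/negP: (kappa_min _ jk').
by case/negP: nk; have <- : j = kappa by lia.
Qed.

Lemma core_pred_n : n %| orb kappa -> core n.-1.
Proof.
move=> nk; apply/coreP => j jk /eqP h.
have hj : n %| (orb j).+1.
  move: h; rewrite eq_sym -(eqn_modDr 1) !addn1 prednK; last by lia.
  by rewrite modnn.
have hm : merging (orb j) by rewrite /merging hj orbT.
have [jk'|kj] := ltnP j kappa; first by case/negP: (kappa_min _ jk').
have e : j = kappa by lia.
have : n %| 1 by rewrite -(dvdn_addr _ nk) addn1 -e.
by rewrite dvdn1; lia.
Qed.

Lemma iter_f_linear y e c i : (forall l, l < i -> f (y + l * c) = y + l * c + c) ->
  e <= i -> iter e f y = y + e * c.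
Proof.
move=> h; elim: e => [|e IH] ei; first by rewrite addn0.
by rewrite iterS IH ?(ltnW ei) // h // mulSn; lia.
Qed.

Lemma f_small x t : x < s -> f (t * n + x) = t * n + x + a.
Proof. by move=> xs; rewrite /d1f modnMDl modn_small; lia. Qed.

Lemma f_large x t : s <= x < n -> f (t * n + x) = t * n + x + a.+1.
Proof. by move=> /andP[sx xn]; rewrite /d1f modnMDl modn_small; lia. Qed.

Lemma f_merge x : 0 < x -> n %| x -> f x.-1 = f x.
Proof.
move=> x0 /dvdnP[[|q] ex]; first by lia.
have -> : x.-1 = q * n + n.-1 by rewrite ex mulSn; lia.
have -> : x = q.+1 * n + 0 by rewrite ex addn0.
by rewrite (f_small 0) // (f_large n.-1) ?mulSn; lia.
Qed.

Lemma iter_f_comm i j x : iter i f (iter j f x) = iter j f (iter i f x).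
Proof. by rewrite -!iterD addnC. Qed.

Lemma orb_gt j : hole <= orb j.
Proof. by case: j => [|j] //; apply/ltnW/(iter_f_lt hole 0). Qed.

(* A power of [f] moves all core points in the same direction relative to a
   shift, because it commutes with the successor map of a tight core. *)
Lemma core_shift_gt j t y z : tight -> core y -> y + t * n < iter j f y ->
  core z -> y <= z -> z + t * n < iter j f z.
Proof.
move=> tg cy lt cz /(tight_orbit _ _ tg cy cz)[i ->].
by rewrite -iter_f_addMn iter_f_comm iter_f_core_lt ?core_addMn ?iter_f_core.
Qed.

Lemma core_shift_lt j t y z : tight -> core y -> iter j f y < y + t * n ->
  core z -> y <= z -> iter j f z < z + t * n.
Proof.
move=> tg cy lt cz /(tight_orbit _ _ tg cy cz)[i ->].
by rewrite -iter_f_addMn iter_f_comm iter_f_core_lt ?core_addMn ?iter_f_core.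
Qed.

Lemma core_bracket y x : tight -> core y -> y <= x -> ~~ core x ->
  exists2 z, core z & y <= z /\ z < x < f z.
Proof.
move=> tg cy yx ncx; have [i /andP[ix xi]] := orbit_bracket _ _ yx.
exists (iter i f y); first exact: iter_f_core.
split; first by case: i {ix xi} => // i; apply/ltnW/(iter_f_lt y 0).
rewrite xi andbT ltn_neqAle ix andbT; apply: contra ncx => /eqP <-.
exact: iter_f_core.
Qed.

(* Otherwise the orbit of the hole returns to just below the hole, so some power
   of [f], corrected by a shift, moves the hole one step down; this power would
   also move the core down past the hole. *)
Lemma s_pred_core : ~~ (n %| orb kappa) -> tight -> core s.-1.
Proof.
move=> nk tg; apply/coreP => j jk e.
have nk' : n %| (orb kappa).+1 by move: kappa_merging; rewrite /merging (negPf nk).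
have [jk'|kj] := ltnP j kappa; last first.
  have ej : j = kappa by lia.
  have : (s.-1).+1 =m (orb kappa).+1 by rewrite -addn1 -modnDml e ej modnDml addn1.
  by rewrite prednK // (eqP nk') modn_small //; lia.
have : hole.-1 =m orb j.+1.
  have <- : f s.-1 = hole.-1 by rewrite -[s.-1](add0n) -(mul0n n) f_small /hole; lia.
  by rewrite /orb iterS; apply: f_eqm.
move=> h1; have [t ht] : exists t, orb j.+1 = hole.-1 + t * n.
  have [t [et|et]] := eqm_split _ _ h1; last by exists t.
  have := leq_trans (orb_gt j.+1) (leq_addr (t * n) _).
  by rewrite -et /hole; clear -s_gt0; lia.
set o := orb kappa in nk nk'.
have go : iter j.+1 f o <= o + t * n.
  rewrite /o /orb iter_f_comm -/(orb j.+1) ht iter_f_addMn leq_add2r.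
  exact/iter_f_le/leq_pred.
have c1 : core o.+1 by rewrite -(core_eqm 0) ?core0 // mod0n (eqP nk').
have go1 : iter j.+1 f o.+1 = iter j.+1 f o.
  by rewrite !iterSr -(f_merge o.+1).
have lt1 : iter j.+1 f o.+1 < o.+1 + t * n by rewrite go1; lia.
(* Shifting the hole by [o + 1] turns puts it above [o + 1], so that core points bracket it. *)
have cB : ~~ core (hole + o.+1 * n) by rewrite core_addMn; apply: (orb_ncore 0).
have leB : o.+1 <= hole + o.+1 * n by apply/leq_trans/leq_addl/leq_pmulr/ltnW.
have [z cz [oz /andP[zB Bz]]] := core_bracket _ _ tg c1 leB cB.
have cfz := f_core _ cz.
have := core_shift_lt _ _ _ _ tg c1 lt1 cfz.
move=> /(_ (leq_trans oz (ltnW (ltnW (d1f_gt z))))) => h2.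
have := iter_f_le j.+1 _ _ (ltnW Bz).
rewrite iter_f_addMn -/(orb _) ht => h3.
(* By tightness an image below [f z + t * n] is at most the preceding core point [z + t * n]. *)
have h4 : iter j.+1 f (f z) <= z + t * n.
  rewrite leqNgt; apply/negP => h.
  have := tg _ _ _ _ h; rewrite core_addMn iter_f_core // d1f_addMn => /(_ cz isT).
  by move: h2; clear; lia.
(* The image of the hole, one step down, squeezes [z] to [hole - 1], which modulo [n] is [orb j.+1]
   and so outside the core. *)
have ez : z = hole.-1 + o.+1 * n.
  have aux X Y T : hole.-1 + T + Y <= X -> X <= z + T -> z < hole + Y ->
      z = hole.-1 + Y by clear; lia.
  exact: aux h3 h4 zB.
move: cz; rewrite ez core_addMn => /coreP/(_ j.+1 jk'); apply.
by rewrite ht modnDMr.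
Qed.

(** Mirror image of [s_pred_core]: if [s] were on the orbit, some power of [f] would move the hole
    one step up relative to a shift, and carry the core past the hole. *)
Lemma s_core : n %| orb kappa -> tight -> core s.
Proof.
move=> nk tg; apply/coreP => j jk e.
have [jk'|kj] := ltnP j kappa; last first.
  have ej : j = kappa by lia.
  by move: e; rewrite ej (eqP nk) modn_small //; lia.
have h1 : hole.+1 =m orb j.+1 by rewrite -f_s /orb iterS; apply: f_eqm.
have [t ht] : exists t, orb j.+1 = hole.+1 + t * n.
  have [t [et|et]] := eqm_split _ _ h1; last by exists t.
  exists 0; have h : hole < orb j.+1 := iter_f_lt hole 0 j.+1 isT.
  by move: et h; clear; case: t => [|t]; rewrite ?addn0 ?mulSn; lia.
set o := orb kappa in nk.
have go : o + t * n <= iter j.+1 f o.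
  rewrite /o /orb iter_f_comm -/(orb j.+1) ht iter_f_addMn leq_add2r.
  exact/iter_f_le/leqnSn.
have o0 : 0 < o by have := orb_gt kappa; rewrite -/o /hole; lia.
have c1 : core o.-1.
  have /dvdnP[[|q] eq] := nk; first by lia.
  have -> : o.-1 = n.-1 + q * n by rewrite eq mulSn; move: (q * n); clear -n_gt1; lia.
  by rewrite core_addMn; apply: core_pred_n.
have go1 : iter j.+1 f o.-1 = iter j.+1 f o.
  by rewrite !iterSr f_merge.
have lt1 : o.-1 + t * n < iter j.+1 f o.-1.
  by rewrite go1 (leq_trans _ go) // ltn_add2r prednK.
have cB : ~~ core (hole + o * n) by rewrite core_addMn; apply: (orb_ncore 0).
have leB : o.-1 <= hole + o * n.
  by apply/(leq_trans (leq_pred _))/leq_trans/leq_addl/leq_pmulr/ltnW.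
have [z cz [oz /andP[zB Bz]]] := core_bracket _ _ tg c1 leB cB.
have cfz := f_core _ cz.
have h2 := core_shift_gt _ _ _ _ tg c1 lt1 cz oz.
have := iter_f_le j.+1 _ _ (ltnW zB).
rewrite iter_f_addMn -/(orb _) ht => h3.
have := tg _ _ _ _ h2; rewrite core_addMn iter_f_core // d1f_addMn.
move=> /(_ cz isT) h4.
have ez : f z = hole.+1 + o * n.
  have aux X Y T : X <= hole.+1 + T + Y -> f z + T <= X -> hole + Y < f z ->
      f z = hole.+1 + Y by clear; lia.
  exact: aux h3 h4 Bz.
move: cfz; rewrite ez core_addMn => /coreP/(_ j.+1 jk'); apply.
by rewrite ht modnDMr.
Qed.

(* Per period there are [p] core points.  In the first form [w] of them satisfy
   [f y = y + a]; in the second the core contains [-1] instead of [0] and only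
   [w - 1] of them do.  The others satisfy [f y = y + a + 1]. *)
Definition left_form p w := [/\ 0 < w <= p, s = w.-1 * a + 1 & n + w = p * a.+1].
Definition right_form p w := [/\ 0 < w <= p, s = w * a & n + w = p * a.+1 + 1].

(** * Parameters read off from a tight core *)

(** [w] is the number of multiples of [a] below [s], that is, of points [0, a, 2a, ...] that still
    make a step of length [a]. *)
Lemma least_multiple : exists2 w, 0 < w & s <= w * a /\ forall i, i < w -> i * a < s.
Proof.
have ex : exists w, s <= w * a by exists s; rewrite leq_pmulr // ltnW.
case: (ex_minnP ex) => w sw min; exists w; first by case: w sw {min} => //; lia.
by split=> // i iw; rewrite ltnNge; apply/negP => /min; rewrite leqNgt iw.
Qed.

Lemma orbit_period y : tight -> core y -> exists2 p, iter p f y = y + n & p + kappa.+1 = n.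
Proof.
move=> tg cy; have cyn : core (y + n) by rewrite -[n in y + n]mul1n core_addMn.
have [p ep] := tight_orbit _ _ tg cy cyn (leq_addr n y).
exists p => //; apply: (orbit_count y) => // z.
exact: tight_orbit.
Qed.

(** From 0 the core advances by [a] while below [s], then by [a + 1] until it reaches [n]. Since
    [s - 1] is in the core, it is the last point with a step of length [a]. *)
Lemma left_classify : ~~ (n %| orb kappa) -> tight ->
  exists p w, p + kappa.+1 = n /\ left_form p w.
Proof.
move=> nk tg; have c0 := core0 nk.
have [p ep pk] := orbit_period 0 tg c0; rewrite add0n in ep.
have [w w0 [sw wmin]] := least_multiple.
have low i : i <= w -> iter i f 0 = i * a.
  move=> iw; rewrite (iter_f_linear _ _ a w) ?add0n // => l lw.
  by have := f_small _ 0 (wmin _ lw); rewrite !mul0n !add0n.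
have wp : w <= p.
  rewrite leqNgt; apply/negP => pw; have := wmin _ pw.
  by rewrite -low ?ep ?(ltnW pw) //; lia.
have high i : i <= p - w -> iter i f (w * a) = w * a + i * a.+1.
  elim: i => [|i IH] ip; first by rewrite addn0.
  rewrite iterS IH ?(ltnW ip) //.
  have lt : w * a + i * a.+1 < n.
    by rewrite -IH ?(ltnW ip) // -low // -iterD -ep; apply: iter_f_lt; lia.
  have := f_large (w * a + i * a.+1) 0; rewrite !mul0n !add0n => ->.
    by rewrite mulSn; lia.
  by rewrite lt (leq_trans sw) ?leq_addr.
have en : n = w * a + (p - w) * a.+1.
  by rewrite -ep -high // -low // -iterD subnK.
have cs := s_pred_core nk tg.
have [i ei] := tight_orbit _ _ tg c0 cs (leq0n _).
have iw : i < w by apply: (iter_f_lt_inv 0); rewrite -ei low //; lia.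
have iw' : w.-1 <= i.
  rewrite -ltnS; apply: (iter_f_lt_inv 0); rewrite iterS -ei low; last lia.
  have /wmin : w.-1 < w by lia.
  by have := f_small s.-1 0; rewrite mul0n !add0n => ->; lia.
exists p, w; split=> //; split; first by rewrite w0.
  have <- : i = w.-1 by lia.
  by rewrite -low ?(ltnW iw) // -ei; lia.
have -> : p = (p - w) + w by rewrite subnK.
by rewrite en mulnDl mulnS; lia.
Qed.

(** The core starts at [n - 1], which [f] sends to the same point as [n]; from then on it runs
    through the points [n + i a], and [n + s] is the first of these to make a step of length
    [a + 1]. *)
Lemma right_classify : n %| orb kappa -> tight ->
  exists p w, p + kappa.+1 = n /\ right_form p w.
Proof.
move=> nk tg; have c0 := core_pred_n nk.
have [p ep pk] := orbit_period n.-1 tg c0.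
have [w w0 [sw wmin]] := least_multiple.
have f1 : f n.-1 = n + a.
  rewrite f_merge //; last lia.
  by have := f_small 0 1 s_gt0; rewrite mul1n addn0.
have low i : i <= w -> iter i f n = n + i * a.
  move=> iw; rewrite (iter_f_linear _ _ a w) // => l lw.
  by have := f_small _ 1 (wmin _ lw); rewrite !mul1n.
have fn : f n.-1 = f n by rewrite f_merge //; lia.
have low1 i : 0 < i -> i <= w -> iter i f n.-1 = n + i * a.
  by case: i => // i _ iw; rewrite iterSr fn -iterSr low.
have wp : w <= p.
  rewrite leqNgt; apply/negP => pw; have := wmin _ pw.
  have p0 : 0 < p by case: (p) ep => //=; lia.
  by have := low1 _ p0 (ltnW pw); lia.
have high i : i <= p - w -> iter i f (n + w * a) = n + (w * a + i * a.+1).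
  elim: i => [|i IH] ip; first by rewrite addn0.
  rewrite iterS IH ?(ltnW ip) //.
  have lt : n + (w * a + i * a.+1) < n + n.-1.
    by rewrite -IH ?(ltnW ip) // -low1 // -iterD [n + _]addnC -ep; apply: iter_f_lt; lia.
  have := f_large (w * a + i * a.+1) 1; rewrite !mul1n => ->.
    by rewrite mulSn; lia.
  by rewrite (leq_trans sw) ?leq_addr //=; lia.
have en : n.-1 = w * a + (p - w) * a.+1.
  by have := high _ (leqnn _); rewrite -low1 // -iterD subnK // ep; lia.
have cs : core (s + 1 * n) by rewrite core_addMn; apply: s_core.
have [|i ei] := tight_orbit _ _ tg c0 cs; first by lia.
have i0 : 0 < i by case: (i) ei => //=; lia.
have iw : i <= w.
  rewrite -ltnS; apply: (iter_f_lt_inv n.-1); rewrite -ei iterS low1 //.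
  by have := d1f_gt (n + w * a); lia.
have iw' : w <= i.
  by rewrite leqNgt; apply/negP => /wmin; have := low1 _ i0 iw; lia.
exists p, w; split=> //; split; first by rewrite w0.
  have <- : i = w by lia.
  by have := low1 _ i0 iw; lia.
have -> : p = (p - w) + w by rewrite subnK.
by rewrite mulnDl mulnS; lia.
Qed.

(** * Tightness for given parameters *)

(** A power of [f] carries the gap between any two consecutive points of the orbit of [y] into a
    shift of the first gap, so only that gap has to be free of core points. *)
Lemma window_tight y p : core y -> 0 < p -> iter p f y = y + n ->
  (forall z, y < z < f y -> ~~ core z) -> tight.
Proof.
move=> cy p0 ep win.
have eMp M : iter (M * p) f y = y + M * n.
  elim: M => [|M IH]; first by rewrite addn0.
  by rewrite mulSnr iterD ep -{1}[n]mul1n iter_f_addMn IH mul1n mulSnr; lia.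
have orbit z : core z -> y <= z -> exists i, z = iter i f y.
  move=> cz yz; have [i /andP[iz zi]] := orbit_bracket _ _ yz.
  exists i; apply/eqP; rewrite eq_sym eqn_leq iz leqNgt /=; apply/negP => lt.
  (* After the first [i] steps, [m] more complete [i] full turns: [iter m f] sends [iter i f y] to
     [y + i * n]. *)
  pose m := i * p - i.
  have mi : m + i = i * p by rewrite subnK // leq_pmulr.
  have lo : y + i * n < iter m f z.
    by rewrite -eMp -mi iterD iter_f_core_lt ?iter_f_core.
  have hi : iter m f z < f y + i * n.
    by rewrite -d1f_addMn -eMp -mi -iterS -addnS iterD iter_f_core_lt ?iter_f_core.
  have := win (iter m f z - i * n).
  rewrite -(core_addMn _ i) subnK ?iter_f_core //; first by move/(_ _)/negP; apply; lia.
  by apply: leq_trans (ltnW lo); apply: leq_addl.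
move=> u v cu cv uv; rewrite -(leq_add2r (y * n)) -d1f_addMn.
have le x : y <= x + y * n by apply/leq_trans/leq_addl/leq_pmulr/ltnW.
have [||i ei] := orbit (u + y * n); rewrite ?core_addMn //.
have [||j ej] := orbit (v + y * n); rewrite ?core_addMn //.
rewrite ei ej -iterS.
have : i < j by apply: (iter_f_lt_inv y); rewrite -ei -ej ltn_add2r.
by rewrite leq_eqVlt => /predU1P[->//|/(iter_f_lt y)/ltnW].
Qed.

(** The orbit of 0 closes up after [p] steps. A point inside the gap between 0 and [a] makes one
    short step fewer, so each turn raises it by one; a core point there would climb to [a - 1]. *)
Lemma left_tight p w : left_form p w ->
  [/\ ~~ (n %| orb kappa), tight & p + kappa.+1 = n].
Proof.
move=> [/andP[w0 wp] es en].
have sw : s <= w * a by rewrite es -{2}(prednK w0) mulSn; lia.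
have high e i : e < a -> s <= w.-1 * a + e -> i <= p.+1 - w ->
    iter i f (w.-1 * a + e) = w.-1 * a + e + i * a.+1.
  move=> ea se ip; rewrite (iter_f_linear _ _ a.+1 (p.+1 - w)) // => l lp.
  have := f_large (w.-1 * a + e + l * a.+1) 0; rewrite !mul0n !add0n => -> //.
  apply/andP; split; first by lia.
  have : l.+1 * a.+1 <= (p.+1 - w) * a.+1 by rewrite leq_mul2r; lia.
  have := en; have -> : p = (p.+1 - w) + w.-1 by lia.
  by rewrite mulnDl mulSn mulnS; lia.
have low e i : e < a -> (0 < e -> i <= w.-1) -> i <= w -> iter i f e = e + i * a.
  move=> ea ei iw; rewrite (iter_f_linear _ _ a i) // => l lw.
  have := f_small (e + l * a) 0; rewrite !mul0n !add0n => -> //.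
  have : l <= w.-1 by lia.
  case: (posnP e) => [->|/ei li] _; rewrite es.
    have : l * a <= w.-1 * a by rewrite leq_mul2r; lia.
    by lia.
  have : l.+1 * a <= w.-1 * a by rewrite leq_mul2r; lia.
  by rewrite mulSn; lia.
have split_p : p = (p.+1 - w) + w.-1 by lia.
have e0 : iter p f 0 = n.
  have -> : p = (p - w) + w by lia.
  rewrite iterD [iter w f 0]low // ?add0n; last lia.
  rewrite (iter_f_linear _ _ a.+1 (p - w)) // => [|l lp].
    have : p = (p - w) + w by lia.
    by move: en => /[swap] {1}->; rewrite mulnDl mulnS; lia.
  have := f_large (w * a + l * a.+1) 0; rewrite !mul0n !add0n => -> //.
  apply/andP; split; first by lia.
  have : l.+1 * a.+1 <= (p - w) * a.+1 by rewrite leq_mul2r; lia.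
  move: en; have {1}-> : p = (p - w) + w by lia.
  by rewrite mulnDl mulSn mulnS; lia.
have ee e : 0 < e < a -> iter p f e = n + e.+1.
  move=> /andP[e0' ea]; rewrite split_p iterD [iter w.-1 f e]low //; try lia.
  rewrite addnC high //; last by rewrite es; lia.
  by move: en; rewrite {1}split_p mulnDl mulnS; lia.
have c0 : core 0.
  by apply: (periodic_core p); [lia | rewrite e0 modnn mod0n].
have nk : ~~ (n %| orb kappa).
  apply/negP => nk; have /coreP/(_ kappa (leqnn _)) := c0.
  by rewrite mod0n (eqP nk).
suff tg : tight.
  split=> //; apply: (orbit_count 0) => // z; exact: tight_orbit.
have f0 : f 0 = a by have := f_small 0 0 s_gt0; rewrite mul0n !addn0.
apply: (window_tight 0 p) => //; first by lia.
move=> z; rewrite f0 => /andP[z0 za].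
have [d ed] : exists d, z + d.+1 = a by exists (a - z.+1); lia.
(* Induction from the top of the gap: [a - 1] would have the same image after one turn as the core
   point [a = f 0]. *)
elim: d z z0 {za} ed => [|d IH] z z0 ed; apply/negP => cz.
  have ca : core a by rewrite -f0 f_core.
  have za : z < a by lia.
  have := iter_f_core_lt p _ _ cz ca za.
  rewrite ee ?z0 // -{1}f0 -iterSr iterS e0.
  have := f_small 0 1 s_gt0; rewrite mul1n addn0 => ->; lia.
have := iter_f_core p _ cz; rewrite ee; last by lia.
by rewrite addnC -{1}[n]mul1n core_addMn; apply/negP/IH; lia.
Qed.

(** Here each turn lowers the points [n + e], [e < a], by one; a core point among them would descend
    to [n], which [f] identifies with the core point [n - 1]. *)
Lemma right_tight p w : right_form p w ->
  [/\ n %| orb kappa, tight & p + kappa.+1 = n].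
Proof.
move=> [/andP[w0 wp] es en].
have split_p : p = (p - w) + w by lia.
have round e : e < a -> iter p f (n + e) = n + e + n.-1.
  move=> ea; rewrite {1}split_p iterD.
  rewrite [iter w f _](iter_f_linear _ _ a w) // => [|l lw]; last first.
    have := f_small (e + l * a) 1; rewrite mul1n addnA => -> //.
    have : l.+1 * a <= w * a by rewrite leq_mul2r; lia.
    by rewrite mulSn es; lia.
  rewrite (iter_f_linear _ _ a.+1 (p - w)) // => [|l lp].
    by move: en; rewrite {1}split_p mulnDl mulnS; lia.
  have := f_large (e + w * a + l * a.+1) 1; rewrite mul1n !addnA => -> //.
  apply/andP; split; first by rewrite es; lia.
  have : l.+1 * a.+1 <= (p - w) * a.+1 by rewrite leq_mul2r; lia.
  by move: en; rewrite {1}split_p mulnDl mulSn mulnS; lia.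
have fn : f n.-1 = f n by rewrite f_merge //; lia.
have f1 : f n = n + a.
  by have := f_small 0 1 s_gt0; rewrite mul1n addn0.
have e0 : iter p f n.-1 = n.-1 + n.
  have p0 : 0 < p by lia.
  rewrite -(prednK p0) iterSr fn -iterSr prednK //.
  by have := round 0; rewrite addn0 addnC; apply; lia.
have c0 : core n.-1.
  by apply: (periodic_core p); [lia | rewrite e0 modnDr].
have nk : n %| orb kappa.
  move: kappa_merging => /orP[//|nk]; have /coreP/(_ kappa (leqnn _)) := c0.
  case; apply/eqP; rewrite -(eqn_modDr 1) !addn1 prednK ?(eqP nk) ?modnn //; lia.
suff tg : tight.
  split=> //; apply: (orbit_count n.-1) => // z; exact: tight_orbit.
apply: (window_tight n.-1 p) => //; first by lia.
move=> z; rewrite fn f1 => /andP[nz zn].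
have [e ee] : exists e, z = n + e by exists (z - n); lia.
elim: e z nz zn ee => [|e IH] z nz zn ez; apply/negP => cz; subst z.
  by move: cz; rewrite addn0 => cz; have := f_core_inj _ _ c0 cz fn; lia.
have := iter_f_core p _ cz; rewrite round; last by lia.
have -> : n + e.+1 + n.-1 = n + e + 1 * n by lia.
by rewrite core_addMn; apply/negP/IH; lia.
Qed.

End Core.

(** Until a merging point is met, orbit points are distinct modulo [n], which is impossible for
    [n + 1] of them. *)
Lemma kappa_exists : exists kappa,
  merging (orb kappa) /\ forall j, j < kappa -> ~~ merging (orb j).
Proof.
have [j hj] : exists j, merging (orb j).
  have [/existsP[j hj]|/existsPn h] := boolP [exists j : 'I_n.+1, merging (orb j)].
    by exists j.
  have n0 : 0 < n by lia.
  have inj : injective (fun j : 'I_n.+1 => Ordinal (ltn_pmod (orb j) n0)).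
    move=> i j /(congr1 val) /= e; apply/val_inj.
    have : forall u v : nat, u <= v -> v <= n -> orb u =m orb v -> u = v.
      elim=> [|u IH] [|v] //.
        by move=> _ _ /esym; rewrite /orb iterS => /f_hole.
      rewrite ltnS => uv vn; rewrite {1}/orb iterS => /orb_pull e'.
      congr _.+1; apply: IH => //; first by lia.
      by apply: e'; have := h (Ordinal (leqW vn)).
    move=> main; have jn := ltn_ord j; have in' := ltn_ord i.
    by case: (leqP i j) => [|/ltnW] ij; [|symmetry]; apply: main => //; lia.
  by have := leq_card _ inj; rewrite !card_ord ltnn.
have exm : exists i, merging (orb i) by exists j.
exists (ex_minn exm); case: ex_minnP => i hi min; split=> // l li.
by apply/negP => /min; rewrite leqNgt li.
Qed.

Definition gdeq (g : nat -> nat) d := gdle g d /\ forall d', gdle g d' -> d <= d'.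

Lemma d1_classify d : gdeq f d -> exists p w,
  (left_form p w /\ d + p.*2 = n.*2) \/ (right_form p w /\ (d + p.*2).+1 = n.*2).
Proof.
move=> [gd dmin]; have [kappa [km kmin]] := kappa_exists.
have tg := gdle_tight _ km kmin _ gd.
have lb := gdle_lb _ km kmin _ gd.
move: lb; have [nk|nk] := boolP (n %| orb kappa) => lb.
  have [p [w [pk form]]] := right_classify _ km kmin nk tg.
  exists p, w; right; split=> //.
  have := dmin _ (tight_gdle_right _ km kmin nk tg).
  by move: lb; rewrite /= add0n; lia.
have [p [w [pk form]]] := left_classify _ km kmin nk tg.
exists p, w; left; split=> //.
have := dmin _ (tight_gdle _ km kmin tg).
by move: lb; rewrite /= add1n; lia.
Qed.

Lemma left_gdeq p w d : left_form p w -> d + p.*2 = n.*2 -> gdeq f d.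
Proof.
move=> form ed; have [kappa [km kmin]] := kappa_exists.
have [nk tg pk] := left_tight _ km kmin _ _ form.
have -> : d = kappa.+1.*2 by lia.
split; first exact: tight_gdle km kmin tg.
by move=> d' /(gdle_lb _ km kmin); rewrite nk /= add1n; lia.
Qed.

Lemma right_gdeq p w d : right_form p w -> (d + p.*2).+1 = n.*2 -> gdeq f d.
Proof.
move=> form ed; have [kappa [km kmin]] := kappa_exists.
have [nk tg pk] := right_tight _ km kmin _ _ form.
have -> : d = kappa.*2.+1 by lia.
split; first exact: tight_gdle_right km kmin nk tg.
by move=> d' /(gdle_lb _ km kmin); rewrite nk /= add0n.
Qed.

End D1.

Lemma step_mono (c : nat -> nat) : (forall i, c i <= (c i.+1).+1) ->
  {homo (fun i => i + c i) : x y / x <= y}.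
Proof.
move=> c_step; apply: homo_leq => [//|x y z|x] /=; first exact: leq_trans.
by have := c_step x; lia.
Qed.

(** * Kupisch series with exactly one hole *)

Section OneHole.

Variables (n : nat) (c : nat -> nat) (b : nat).
Hypotheses (n_gt1 : 1 < n) (c_per : forall i, c (i + n) = c i)
  (c_step : forall i, c i <= (c i.+1).+1).
Local Notation f := (fun i => i + c i).
Hypotheses (f_gt : forall i, i < f i)
  (b_hole : forall i, ~ (f i = b %[mod n]))
  (only_b : forall y, (forall i, ~ (f i = y %[mod n])) -> y = b %[mod n]).

Lemma cyc_addMn i t : c (i + t * n) = c i.
Proof. by elim: t => [|t IH]; rewrite ?addn0 // mulSnr addnA c_per. Qed.

Let cyc_mono := step_mono c c_step.

(** An attained residue is attained at every lift from [f 0] on: by monotonicity, a lift calling for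
    a negative argument is at most [f 0], hence equal to it. *)
Lemma cyc_surj y : f 0 <= y -> ~ (y = b %[mod n]) -> exists x, f x = y.
Proof.
move=> fy yb.
have [j ej] : exists j : 'I_n, f j = y %[mod n].
  case: (pickP (fun j : 'I_n => f j == y %[mod n])) => [j /eqP e|h]; first by exists j.
  case: yb; apply: only_b => i e; have n0 : 0 < n by lia.
  have := h (Ordinal (ltn_pmod i n0)); rewrite /= => /eqP; apply.
  by rewrite -e [in RHS](divn_eq i n) [in RHS](addnC (_ * n)) cyc_addMn addnAC modnDMr.
have [t [et|et]] := eqm_split _ _ ej; last first.
  by exists (j + t * n); rewrite cyc_addMn addnAC et.
have [tj|jt] := leqP (t * n) j.
  exists (j - t * n); have := cyc_addMn (j - t * n) t; rewrite subnK // => <-.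
  by move: et; lia.
exists 0; apply/eqP; rewrite eqn_leq fy /=.
have := cyc_mono _ _ (ltnW jt); rewrite et.
by have := cyc_addMn 0 t; rewrite add0n => /= ->; lia.
Qed.

(* Around the hole [f] jumps by two; up to the next copy of the hole it is onto,
   so it grows by one at each step, except for a single stall. *)
Lemma one_hole_shape : exists r a s, [/\ 0 < s < n &
  forall i, c (r + i) = a + (s <= i %% n)].
Proof.
have n0 : 0 < n by lia.
(* A lift of the hole lying above [f 0], where [cyc_surj] applies. *)
pose B := b + f 0 * n.+1 * n.
have Bb : B = b %[mod n] by rewrite /B modnDMr.
have f0B : f 0 < B.
  have h := f_gt 0; rewrite /B.
  apply: (@leq_trans (f 0 * n.+1)); first by rewrite mulnS; nia.
  by apply: leq_trans (leq_addl _ _); rewrite leq_pmulr.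
have hB i : f i <> B by move=> e; apply: (b_hole i); rewrite e.
have ex : exists i, B < f i by exists B.
have [i0 [lo hi]] : exists i0, f i0 < B /\ B < f i0.+1.
  case: (ex_minnP ex) => -[|i] hi min; first by move: hi f0B; lia.
  exists i; split=> //; rewrite ltn_neqAle; apply/andP; split; first exact/eqP/hB.
  by rewrite leqNgt; apply/negP => /min; rewrite ltnn.
have near d : 0 < d < n -> ~ (B + d = b %[mod n]).
  move=> dn e; have : (B + d) %% n == (B + 0) %% n by rewrite addn0 e Bb.
  by rewrite eqn_modDl mod0n modn_small; lia.
have fi0 : f i0 = B.-1.
  have [||x ex'] := cyc_surj B.-1; first by lia.
    move=> e; apply: (near n.-1); first by lia.
    have -> : B + n.-1 = B.-1 + 1 * n by lia.
    by rewrite modnDMr.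
  apply/eqP; rewrite eqn_leq; apply/andP; split; first by lia.
  rewrite -ex'; apply: cyc_mono; rewrite leqNgt; apply/negP => /cyc_mono.
  by move=> /= h; lia.
have fi1 : f i0.+1 = B.+1.
  have [||x ex'] := cyc_surj B.+1; first by lia.
    by rewrite -addn1; apply: near; lia.
  apply/eqP; rewrite eqn_leq; apply/andP; split; last by lia.
  rewrite -ex'; apply: cyc_mono; rewrite leqNgt; apply/negP; rewrite ltnS => /cyc_mono.
  by move=> /= h; lia.
pose g t := f (i0.+1 + t).
have gS t : g t <= g t.+1 by apply: cyc_mono; rewrite leq_add2l.
have glast : g n.-1 = B + n.-1.
  have := c_per i0; rewrite /g; have -> : i0.+1 + n.-1 = i0 + n by lia.
  by move=> /= ->; move: fi0 => /=; lia.
have g0 : g 0 = B.+1 by rewrite /g addn0.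
have gmono u v : u <= v -> g u <= g v by move=> uv; apply: cyc_mono; rewrite leq_add2l.
have gstep t : t < n.-1 -> g t.+1 <= (g t).+1.
  move=> tn; rewrite leqNgt; apply/negP => lt.
  have h1 : B < g t by have := gmono 0 t isT; lia.
  have h2 : g t.+1 <= B + n.-1 by rewrite -glast gmono.
  have [||x ex'] := cyc_surj (g t).+1; first by lia.
    have -> : (g t).+1 = B + ((g t).+1 - B) by lia.
    by apply: near; lia.
  have [h|/cyc_mono h] := leqP x (i0.+1 + t).
    by have := cyc_mono _ _ h; move: ex'; rewrite /g /=; lia.
  by move: h ex' lt; rewrite /g -addnS /=; lia.
(* The least such [q] is the stall, where [g] first falls behind growth by one. *)
have exq : exists q, g q != B.+1 + q by exists n.-1; rewrite glast; lia.
case: (ex_minnP exq) => q hq qmin.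
have qn : q <= n.-1 by apply: qmin; rewrite glast; lia.
have gq t : t < q -> g t = B.+1 + t.
  by move=> tq; apply/eqP; apply: contraTT tq => /qmin; rewrite -leqNgt.
have q0 : 0 < q by case: (q) hq => //; rewrite g0 addn0 eqxx.
have up d : q + d <= n.-1 -> g (q + d) <= B + (q + d).
  elim: d => [|d IH] dn.
    have := gq q.-1 ltac:(lia); have := gstep q.-1 ltac:(lia); rewrite addn0 prednK //.
    by move/eqP: hq; lia.
  have := gstep (q + d) ltac:(lia); have := IH ltac:(lia); rewrite addnS; lia.
have down d : d <= n.-1 -> B + (n.-1 - d) <= g (n.-1 - d).
  elim: d => [|d IH] dn; first by rewrite subn0 glast.
  have := gstep (n.-1 - d.+1) ltac:(lia).
  have -> : (n.-1 - d.+1).+1 = n.-1 - d by lia.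
  by have := IH ltac:(lia); lia.
have gq' t : q <= t <= n.-1 -> g t = B + t.
  move=> /andP[qt tn]; apply/eqP; rewrite eqn_leq.
  have := up (t - q); rewrite subnKC // => -> //=.
  by have := down (n.-1 - t) (leq_subr _ _); rewrite subKn.
(* Counted from the stall, the [n - q] entries before the next jump equal [B - i0.+1]; the remaining
   [q] entries are larger by one. *)
exists (i0.+1 + q), (B - i0.+1), (n - q); split; first by lia.
move=> i; have jn : i %% n < n by rewrite ltn_mod.
have -> : c (i0.+1 + q + i) = c (i0.+1 + q + i %% n).
  by rewrite {1}(divn_eq i n) (addnC (_ * n)) addnA cyc_addMn.
have i0B : i0.+1 <= B by have := f_gt i0; lia.
move: (i %% n) jn => j jn; case: leqP => qj.
  have := gq (q + j - n) ltac:(lia); rewrite /g.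
  have -> : c (i0.+1 + q + j) = c (i0.+1 + (q + j - n)).
    by rewrite -(c_per (i0.+1 + (q + j - n))); congr c; lia.
  by lia.
by have := gq' (q + j) ltac:(lia); rewrite /g addnA; lia.
Qed.

End OneHole.

Set Implicit Arguments.
Unset Strict Implicit.
Unset Printing Implicit Defensive.

Local Open Scope ring_scope.

(** * Linear and homological algebra *)

Definition mk_linear (R : pzRingType) (U V : lmodType R) (f : U -> V)
    (lin_f : linear f) : {linear U -> V} :=
  HB.pack f (GRing.isLinear.Build R U V *:%R f lin_f).

Lemma mk_linearE (R : pzRingType) (U V : lmodType R) (f : U -> V) (h : linear f) :
  mk_linear h =1 f.
Proof. by []. Qed.

Section Kernel.
Variables (R : pzRingType) (U V : lmodType R) (p : {linear U -> V}).

Definition kerpred : {pred U} := [pred x | p x == 0].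

Fact kerpred_submod : submod_closed kerpred.
Proof.
split=> [|a x y]; rewrite !inE ?linear0 // => /eqP hx /eqP hy.
by rewrite linearP hx hy scaler0 addr0.
Qed.

HB.instance Definition _ := GRing.isSubmodClosed.Build R U kerpred kerpred_submod.

Definition ker := {x : U | x \in kerpred}.
HB.instance Definition _ := SubType.on ker.
HB.instance Definition _ := [Choice of ker by <:].
HB.instance Definition _ := [SubChoice_isSubLmodule of ker by <:].

End Kernel.

Lemma lift_inj (R : pzRingType) (X Y Z : lmodType R) (g : {linear X -> Y})
    (i : {linear Z -> Y}) : injective i -> (forall x, exists z, i z = g x) ->
  exists g' : {linear X -> Z}, forall x, i (g' x) = g x.
Proof.
move=> inj ex; have ex' x : exists z, i z == g x by have [z <-] := ex x; exists z.
pose g' x := xchoose (ex' x).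
have ig' x : i (g' x) = g x by apply/eqP/(xchooseP (ex' x)).
have lin : linear g' by move=> a x y; apply: inj; rewrite linearP !ig' linearP.
by exists (mk_linear lin).
Qed.

Lemma linear_inverse (R : pzRingType) (X Y : lmodType R) (f : {linear X -> Y}) :
  injective f -> surjective f -> exists g : {linear Y -> X}, cancel f g /\ cancel g f.
Proof.
move=> inj sur; have [|g gf] := lift_inj (g := idfun : {linear Y -> Y}) inj.
  exact: sur.
by exists g; split=> // x; apply: inj; rewrite gf.
Qed.

Section FiniteDim.
Variable K : fieldType.

(** [S] is a mere proposition, so no basis can be computed; classically a free family is enlarged by
    vectors outside its span, which stops after at most [d] steps. *)
Lemma subspace_basis d (S : 'rV[K]_d -> Prop) : S 0 ->
  (forall a u v, S u -> S v -> S (a *: u + v)) ->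
  exists e (B : 'M[K]_(e, d)), row_free B /\ forall w, S w <-> (w <= B)%MS.
Proof.
move=> S0 SP.
have Ssub e (B : 'M[K]_(e, d)) w : (forall i, S (row i B)) -> (w <= B)%MS -> S w.
  move=> SB /submxP[D ->]; rewrite mulmx_sum_row.
  elim/big_rec: _ => // i x _ Sx; exact: SP.
have step e (B : 'M[K]_(e, d)) : row_free B -> (forall i, S (row i B)) ->
    (forall w, S w <-> (w <= B)%MS) \/
    exists B' : 'M[K]_(1 + e, d), row_free B' /\ forall i, S (row i B').
  move=> fB SB; case: (classic (forall w, S w -> (w <= B)%MS)) => [all_le|].
    by left=> w; split; [apply: all_le | apply: Ssub].
  move=> H; have [w Hw] := not_all_ex_not _ _ H.
  have [Sw /negP wB] := imply_to_and _ _ Hw; right.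
  exists (col_mx w B); split.
    rewrite /row_free eqn_leq rank_leq_row -addsmxE /=.
    rewrite -[X in (X < _)%N](eqP fB).
    by apply: rank_ltmx; rewrite /ltmx addsmxSr addsmx_sub negb_and wB.
  move=> i; case: (split_ordP i) => j ->; last by rewrite rowKd.
  by rewrite rowKu ord1 row_id.
suff main k e (B : 'M[K]_(e, d)) : (d - e <= k)%N -> row_free B ->
    (forall i, S (row i B)) ->
    exists e' (B' : 'M[K]_(e', d)), row_free B' /\ forall w, S w <-> (w <= B')%MS.
  apply: (main d 0%N (0 : 'M_(0, d))); rewrite ?leq_subr //.
    by rewrite /row_free mxrank0.
  by case.
elim: k e B => [|k IH] e B de fB SB; case: (step e B fB SB) => [all_le|[B' [fB' SB']]].
- by exists e, B.
- have: (1 + e <= d)%N by rewrite -(eqP fB') rank_leq_col.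
  by lia.
- by exists e, B.
- have ed : (1 + e <= d)%N by rewrite -(eqP fB') rank_leq_col.
  by apply: (IH _ B') => //; lia.
Qed.

End FiniteDim.

(** * Finitely generated modules as finite dimensional spaces *)

Section Restriction.
Variables (K : fieldType) (A : falgType K).

(* A right [A]-module as a vector space over [K]. *)
Definition restr (M : lmodType A^c) : Type := M.
HB.instance Definition _ (M : lmodType A^c) := GRing.Zmodule.on (restr M).

Section Scale.
Variable M : lmodType A^c.

Definition restr_scale (k : K) (x : restr M) : restr M := (k%:A : A^c) *: (x : M).

Fact restr_scaleA k l x : restr_scale k (restr_scale l x) = restr_scale (k * l) x.
Proof.
rewrite /restr_scale scalerA; congr (_ *: _).
have -> : (k%:A : A^c) * l%:A = ((l%:A : A) * k%:A : A) by [].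
by rewrite -scalerAl mul1r scalerA mulrC.
Qed.
Fact restr_scale1 : left_id 1 restr_scale.
Proof. by move=> x; rewrite /restr_scale scale1r scale1r. Qed.
Fact restr_scaleDr : right_distributive restr_scale +%R.
Proof. by move=> k x y; rewrite /restr_scale -scalerDr. Qed.
Fact restr_scaleDl x : {morph restr_scale^~ x : k l / k + l}.
Proof. by move=> k l; rewrite /restr_scale -scalerDl -scalerDl. Qed.

HB.instance Definition _ := GRing.Zmodule_isLmodule.Build K (restr M)
  restr_scaleA restr_scale1 restr_scaleDr restr_scaleDl.
End Scale.

Lemma restrZE (M : lmodType A^c) (k : K) (x : restr M) :
  k *: x = (k%:A : A^c) *: (x : M) :> M.
Proof. by []. Qed.

Lemma restr_linear (M N : lmodType A^c) (f : {linear M -> N}) :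
  linear (f : restr M -> restr N).
Proof. by move=> k x y; exact: (linearP f (k%:A : A^c) x y). Qed.

Lemma act_linear (M : lmodType A^c) (a : A) :
  linear ((fun x => (a : A^c) *: (x : M)) : restr M -> restr M).
Proof.
move=> k x y; rewrite scalerDr; congr (_ + _).
change ((a : A^c) *: ((k%:A : A^c) *: (x : M)) = (k%:A : A^c) *: ((a : A^c) *: (x : M))).
rewrite !scalerA; congr (_ *: _).
have -> : (a : A^c) * k%:A = ((k%:A : A) * a : A) by [].
have -> : (k%:A : A^c) * a = ((a : A) * k%:A : A) by [].
by rewrite mulr_algl mulr_algr.
Qed.

Lemma act_algZ (M : lmodType A^c) (k : K) (a : A) (x : M) :
  (k *: a : A^c) *: x = k *: ((a : A^c) *: x : restr M).
Proof.
rewrite restrZE scalerA; congr (_ *: _).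
by have -> : (k%:A : A^c) * a = ((a : A) * k%:A : A) by []; rewrite mulr_algr.
Qed.

Lemma fg_of_span (M : lmodType A^c) d (h : {linear 'rV[K]_d -> restr M}) :
  surjective h -> finitely_generated M.
Proof.
move=> sur; exists d, (fun i => h (delta_mx 0 i)) => x.
have [v <-] := sur x; exists (fun i => (v 0 i)%:A).
rewrite {1}(row_sum_delta v) linear_sum; apply: eq_bigr => i _.
by rewrite linearZ.
Qed.

Lemma span_of_fg (M : lmodType A^c) : finitely_generated M ->
  exists d (h : {linear 'rV[K]_d -> restr M}), surjective h.
Proof.
move=> [k [g gen]].
pose N := \dim {:A}; pose b := vbasis {:A}.
pose F (u : 'rV[K]_(k * N)) : restr M :=
  \sum_(i < k) \sum_(j < N)
    vec_mx u i j *: (((tnth b j : A) : A^c) *: g i : restr M).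
have linF : linear F.
  move=> c u v; rewrite /F scaler_sumr -big_split; apply: eq_bigr => i _.
  rewrite scaler_sumr -big_split; apply: eq_bigr => j _ /=.
  by rewrite linearP !mxE scalerDl scalerA.
exists (k * N)%N, (mk_linear linF) => x; have [a ->] := gen x.
exists (mxvec (\matrix_(i, j) coord b j (a i : A))); rewrite mk_linearE /F.
apply: eq_bigr => i _; rewrite mxvecK.
have e : a i = (\sum_(j < N) coord b j (a i : A) *: tnth b j : A).
  rewrite {1}(coord_vbasis (memvf (a i : A))); apply: eq_bigr => j _.
  by rewrite (tnth_nth 0).
rewrite (etrans (congr1 (fun y : A^c => y *: g i) e) (scaler_suml _ _ _ _)); apply: eq_bigr => j _.
by rewrite mxE -act_algZ.
Qed.

Lemma fg_coord (M : lmodType A^c) : finitely_generated M ->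
  exists d (h : {linear 'rV[K]_d -> restr M}), bijective h.
Proof.
move=> /span_of_fg[d [h sur]].
have kerP a u v : h u = 0 -> h v = 0 -> h (a *: u + v) = 0.
  by move=> hu hv; rewrite linearP hu hv scaler0 addr0.
have [e [B [fB kerB]]] := subspace_basis (linear0 h) kerP.
(* On a complement of its kernel [h] is injective and still onto. *)
pose C := row_base (B^C)%MS.
have Cfree : row_free C by apply: row_base_free.
have linC : linear (fun u : 'rV_(\rank (B^C)%MS) => h (u *m C)).
  by move=> a u v; rewrite mulmxDl -scalemxAl linearP.
exists _, (mk_linear linC); suff: injective (mk_linear linC) /\ surjective (mk_linear linC).
  by case=> i s; have [g [gK Kg]] := linear_inverse i s; exists g.
split=> [u v|x].
  change (h (u *m C) = h (v *m C) -> u = v) => e_uv.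
  have : ((u - v) *m C <= B)%MS by apply/kerB; rewrite mulmxBl linearB e_uv subrr.
  have sC : ((u - v) *m C <= B^C)%MS.
    by apply: (submx_trans (submxMl _ _)); rewrite eq_row_base.
  move=> sB; have : ((u - v) *m C <= B :&: B^C)%MS by rewrite sub_capmx sB.
  rewrite capmx_compl submx0 => /eqP/(congr1 (mulmx^~ (pinvmx C))).
  by rewrite mul0mx -mulmxA mulmxVp // mulmx1 => /subr0_eq.
have [w <-] := sur x.
have : (w <= B + B^C)%MS by rewrite (submx_trans (submx1 _)) // submx_full ?addsmx_compl_full.
case/sub_addsmxP=> -[u1 u2] /= ->.
have /submxP[D eD] : (u2 *m (B^C)%MS <= C)%MS by rewrite eq_row_base submxMl.
exists D; change (h (D *m C) = h (u1 *m B + u2 *m (B^C)%MS)).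
rewrite -eD linearD /=.
by have /kerB -> := submxMl u1 B; rewrite add0r.
Qed.

(** Seen over [K], a submodule is a subspace of a finite dimensional space; this makes kernels
    available as [fgModule]s. *)
Lemma fg_inj (U V : lmodType A^c) (j : {linear V -> U}) : injective j ->
  finitely_generated U -> finitely_generated V.
Proof.
move=> inj /fg_coord[d [h [h' hK Kh]]].
have [e [B [fB SB]]] : exists e (B : 'M[K]_(e, d)), row_free B /\
    forall w, (exists v, j v = h w) <-> (w <= B)%MS.
  apply: subspace_basis; first by exists 0; rewrite !linear0.
  move=> a u v [u' eu] [v' ev]; exists ((a%:A : A^c) *: u' + v').
  by rewrite !linearP eu ev.
have linB : linear (fun u : 'rV_e => h (u *m B) : restr U).
  by move=> a u v; rewrite mulmxDl -scalemxAl linearP.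
have [||g gP] := lift_inj (g := mk_linear linB) (i := mk_linear (restr_linear j)).
- exact: inj.
- by move=> u; have /SB[v ev] := submxMl u B; exists v.
apply: (@fg_of_span V e g) => v.
have /SB/submxP[D eD] : exists v', j v' = h (h' (j v)) by exists v; rewrite Kh.
exists D; apply: inj; rewrite [LHS]gP.
by change (h (D *m B) = j v); rewrite -eD Kh.
Qed.

End Restriction.

(** * Syzygies and projective dimension *)

Section Homological.
Variables (K : fieldType) (A : falgType K).
Implicit Types M N P Q U V X : fgModule A.

Lemma fg_prod (U V : lmodType A^c) :
  finitely_generated U -> finitely_generated V -> finitely_generated (U * V)%type.
Proof.
move=> [k [g gU]] [l [h hV]].
exists (k + l)%N, (fun i => match split i with inl a => (g a, 0) | inr b => (0, h b) end).
move=> [x y]; have [a ->] := gU x; have [b ->] := hV y.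
exists (fun i => match split i with inl i => a i | inr i => b i end).
rewrite big_split_ord /=.
have sl i : split (lshift l i) = inl i by apply: (unsplitK (inl i)).
have sr i : split (rshift k i) = inr i by apply: (unsplitK (inr i)).
have fst_sum r (F : 'I_r -> U * V) : (\sum_i F i).1 = \sum_i (F i).1.
  by elim/big_rec2: _ => // i u v _ <-.
have snd_sum r (F : 'I_r -> U * V) : (\sum_i F i).2 = \sum_i (F i).2.
  by elim/big_rec2: _ => // i u v _ <-.
apply: injective_projections; rewrite /= ?fst_sum ?snd_sum.
  rewrite [X in _ = _ + X]big1 => [|i _]; last by rewrite sr /= scaler0.
  by rewrite addr0; apply: eq_bigr => i _; rewrite sl.
rewrite [X in _ = X + _]big1 => [|i _]; last by rewrite sl /= scaler0.
by rewrite add0r; apply: eq_bigr => i _; rewrite sr.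
Qed.

Definition prod_mod U V : fgModule A := FgModule (fg_prod (fgmod_fg U) (fgmod_fg V)).

Definition ker_mod U V (p : {linear U -> V}) : fgModule A :=
  FgModule (fg_inj (j := (val : ker p -> U)) val_inj (fgmod_fg U)).

Definition ses N P M := exists (i : {linear N -> P}) (p : {linear P -> M}),
  [/\ injective i, surjective p & forall x, p x = 0 <-> exists y, i y = x].

Definition isom (M N : lmodType A^c) := exists (f : {linear M -> N}) (g : {linear N -> M}),
  cancel f g /\ cancel g f.

Lemma isomorphicP (M N : lmodType A^c) : isomorphic_modules M N <-> isom M N.
Proof.
split=> [[f [g fK gK]]|[f [g [fK gK]]]]; last by exists f; exists g.
have [||h [hK Kh]] := @linear_inverse _ _ _ f; first exact: can_inj fK.
  by move=> y; exists (g y).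
by exists f, h.
Qed.

Lemma ker_ses U V (p : {linear U -> V}) : surjective p -> ses (ker_mod p) U V.
Proof.
move=> sur; exists (val : ker p -> U), p; split=> //; first exact: val_inj.
move=> x; split=> [e|[y <-]]; last by apply/eqP; exact: (valP y).
have h : x \in kerpred p by rewrite inE e.
by exists (exist _ x h).
Qed.

Lemma projective_retract M P (s : {linear M -> P}) (r : {linear P -> M}) :
  cancel s r -> projective P -> projective M.
Proof.
move=> srK pP U V p f sur; have [g gP] := pP U V p (f \o r) sur.
by exists (g \o s) => x /=; rewrite gP /= srK.
Qed.

Lemma isom_projective P Q : isom P Q -> projective P -> projective Q.
Proof. by case=> f [g [fK gK]]; apply: (projective_retract gK). Qed.

Definition inl_mod (U V : lmodType A^c) (x : U) : (U * V)%type := (x, 0).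
Definition inr_mod (U V : lmodType A^c) (y : V) : (U * V)%type := (0, y).
Fact inl_mod_linear (U V : lmodType A^c) : linear (@inl_mod U V).
Proof. by move=> a x y; rewrite /inl_mod; congr pair; rewrite /= scaler0 addr0. Qed.
Fact inr_mod_linear (U V : lmodType A^c) : linear (@inr_mod U V).
Proof. by move=> a x y; rewrite /inr_mod; congr pair; rewrite /= scaler0 addr0. Qed.

Fact fst_linear (U V : lmodType A^c) : linear (@fst U V). Proof. by []. Qed.
Fact snd_linear (U V : lmodType A^c) : linear (@snd U V). Proof. by []. Qed.
Definition fst_mod U V : {linear (U * V)%type -> U} := mk_linear (@fst_linear U V).
Definition snd_mod U V : {linear (U * V)%type -> V} := mk_linear (@snd_linear U V).

Fact pair_linear (X U V : lmodType A^c) (f : {linear X -> U}) (g : {linear X -> V}) :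
  linear (fun x => (f x, g x) : U * V).
Proof. by move=> a x y; rewrite !linearP. Qed.
Definition pair_mod (X U V : lmodType A^c) (f : {linear X -> U}) (g : {linear X -> V})
  : {linear X -> (U * V)%type} := mk_linear (pair_linear f g).

Lemma projective_prod P Q : projective P -> projective Q -> projective (prod_mod P Q).
Proof.
move=> pP pQ U V p f sur.
have [g gP] := pP U V p (f \o mk_linear (@inl_mod_linear P Q)) sur.
have [h hP] := pQ U V p (f \o mk_linear (@inr_mod_linear P Q)) sur.
have lin : linear (fun x : P * Q => g x.1 + h x.2).
  by move=> a x y; rewrite !linearP scalerDr addrACA.
exists (mk_linear lin) => -[x y]; change (p (g x + h y) = f (x, y)).
rewrite linearD gP hP -[RHS](congr1 f (_ : inl_mod _ x + inr_mod _ y = (x, y))) ?linearD //.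
by rewrite /inl_mod /inr_mod; congr pair; rewrite /= ?addr0 ?add0r.
Qed.

Lemma prod_projectivel P Q : projective (prod_mod P Q) -> projective P.
Proof.
exact: (@projective_retract P (prod_mod P Q)
  (mk_linear (@inl_mod_linear P Q)) (fst_mod P Q)).
Qed.

Fact fg0 : finitely_generated (A:=A) ('rV[A^c]_0).
Proof. by exists 0%N, (fun _ => 0) => x; exists (fun _ => 0); rewrite big_ord0 thinmx0. Qed.
Definition zero_mod : fgModule A := FgModule fg0.

Lemma zero_projective M : zero_module M -> projective M.
Proof.
move=> z U V p f _; exists \0 => x.
by rewrite (z x) !linear0.
Qed.

(** With lifts [g], [g'] of each cover through the other, [(x, y)] goes to [i x + g' y] in [P]
    together with the defect [y - g (i x + g' y)], which lies in the kernel [N']; the inverse is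
    built in the same way. *)
Lemma schanuel N P N' P' M : projective P -> projective P' ->
  ses N P M -> ses N' P' M -> isom (prod_mod N P') (prod_mod N' P).
Proof.
move=> pP pP' [i [p [ii sp ep]]] [i' [p' [ii' sp' ep']]].
have [g gP] := pP P' M p' p sp'; have [g' gP'] := pP' P M p p' sp.
pose h : {linear (N * P')%type -> P} := (i \o fst_mod N P') \+ (g' \o snd_mod N P').
pose h' : {linear (N' * P)%type -> P'} := (i' \o fst_mod N' P) \+ (g \o snd_mod N' P).
have [|t tP] := lift_inj (g := snd_mod N P' \- (g \o h)) ii'.
  move=> [x y]; apply/ep' => /=; rewrite linearB gP linearD gP'.
  by have /ep -> : exists z, i z = i x by [exists x]; rewrite add0r subrr.
have [|t' tP'] := lift_inj (g := snd_mod N' P \- (g' \o h')) ii.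
  move=> [x y]; apply/ep => /=; rewrite linearB gP' linearD gP.
  by have /ep' -> : exists z, i' z = i' x by [exists x]; rewrite add0r subrr.
exists (pair_mod t h), (pair_mod t' h').
have hE u : h' (pair_mod t h u) = u.2.
  by change (i' (t u) + g (h u) = u.2); rewrite tP /= subrK.
have hE' u : h (pair_mod t' h' u) = u.2.
  by change (i (t' u) + g' (h' u) = u.2); rewrite tP' /= subrK.
split=> u; apply: injective_projections; try exact: hE; try exact: hE'.
  apply: ii; rewrite [LHS]tP'.
  change (h u - g' (h' (pair_mod t h u)) = i u.1).
  by rewrite hE /= addrK.
apply: ii'; rewrite [LHS]tP.
change (h' u - g (h (pair_mod t' h' u)) = i' u.1).
by rewrite hE' /= addrK.
Qed.

(* Syzygies are determined by the module only up to this relation. *)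
Definition stab X Y := exists P Q, [/\ projective P, projective Q &
  isom (prod_mod X P) (prod_mod Y Q)].

Lemma stab_projective X Y : stab X Y -> projective X -> projective Y.
Proof.
move=> [P [Q [pP pQ iso]]] pX; apply: prod_projectivel.
exact: isom_projective iso (projective_prod pX pP).
Qed.

Lemma ses_prod N P M Q : ses N P M -> ses N (prod_mod P Q) (prod_mod M Q).
Proof.
move=> [i [p [ii sp ep]]].
exists (mk_linear (@inl_mod_linear P Q) \o i),
  (pair_mod (p \o fst_mod P Q) (snd_mod P Q)); split.
- by move=> x y [/ii].
- by move=> [x y]; have [z <-] := sp x; exists (z, y).
- move=> [x y]; split=> [[/ep[z <-] y0]|[z ez]].
    by exists z; rewrite -[y]/(snd_mod P Q (x, y)) [snd_mod _ _ _]y0.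
  have [<- <-] : (i z, 0) = (x, y) := ez.
  by apply: injective_projections => //=; apply/ep; exists z.
Qed.

Lemma ses_isom N P M M' : isom M M' -> ses N P M -> ses N P M'.
Proof.
move=> [f [g [fK gK]]] [i [p [ii sp ep]]]; exists i, (f \o p); split=> //.
  by move=> y; have [x ex] := sp (g y); exists x; rewrite /= ex gK.
move=> x /=; rewrite -ep; split=> [e|->]; last exact: linear0.
by apply: (can_inj fK); rewrite e linear0.
Qed.

Lemma isom_sym (U V : lmodType A^c) : isom U V -> isom V U.
Proof. by move=> [f [g [fK gK]]]; exists g, f. Qed.

Lemma stab_syz X Y N P N' P' : stab X Y -> projective P -> projective P' ->
  ses N P X -> ses N' P' Y -> stab N N'.
Proof.
move=> [Q [Q' [pQ pQ' iso]]] pP pP' /(ses_prod Q)/(ses_isom iso) s1 /(ses_prod Q') s2.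
exists (prod_mod P' Q'), (prod_mod P Q); split; try exact: projective_prod.
by apply: schanuel s1 s2; apply: projective_prod.
Qed.

Lemma isom_refl (U : lmodType A^c) : isom U U.
Proof. by exists idfun, idfun. Qed.

Lemma stab_refl X : stab X X.
Proof.
have pz : projective zero_mod by apply: zero_projective => x; apply: thinmx0.
by exists zero_mod, zero_mod; split=> //; apply: isom_refl.
Qed.

(** Projective dimension by peeling off one syzygy at a time, better suited to induction than a
    whole resolution; [pdle_proj_dim_le] and [proj_dim_le_pdle] give the equivalence with
    [proj_dim_le]. *)
Inductive pdle : nat -> fgModule A -> Prop :=
| pdle_projective d M : projective M -> pdle d M
| pdle_ses d N P M : projective P -> ses N P M -> pdle d N -> pdle d.+1 M.

Lemma projective_zero_ses M : ses zero_mod M M.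
Proof.
exists \0, idfun; split=> //; first by move=> x y _; rewrite [x]thinmx0 [y]thinmx0.
  by move=> y; exists y.
by move=> x; split=> [e|[y <-]] //; exists 0; apply: etrans (esym e).
Qed.

Lemma pdle0P M : pdle 0 M -> projective M.
Proof. by move=> h; inversion h. Qed.

Lemma pdleSP d M : pdle d.+1 M -> exists N P, [/\ projective P, ses N P M & pdle d N].
Proof.
move=> h; inversion h as [d' M' pM|d' N P M' pP s hN]; last by exists N, P.
exists zero_mod, M; split=> //; first exact: projective_zero_ses.
by apply: pdle_projective; apply: zero_projective => x; apply: thinmx0.
Qed.

Lemma pdle_syz d X Y N P : stab X Y -> pdle d.+1 X -> projective P -> ses N P Y ->
  exists2 X', stab X' N & pdle d X'.
Proof.
move=> st /pdleSP[N' [P' [pP' s' hN']]] pP s; exists N' => //.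
exact: stab_syz st pP' pP s' s.
Qed.

Lemma ses_projective N P M : projective N -> projective M -> ses N P M -> projective P.
Proof.
move=> pN pM [i [p [ii sp ep]]]; have [g gP] := pM P M p idfun sp.
pose f : {linear (N * M)%type -> P} := (i \o fst_mod N M) \+ (g \o snd_mod N M).
have pi x : p (i x) = 0 by apply/ep; exists x.
have [||h [fK hK]] := @linear_inverse _ _ _ f.
- apply: raddf_inj => -[x y]; change (i x + g y = 0 -> (x, y) = 0) => e.
  have y0 : y = 0 by have := congr1 p e; rewrite linearD pi add0r gP linear0.
  move: e; rewrite y0 linear0 addr0 -(linear0 i) => /ii -> //.
- move=> x; have [|y ey] := (ep (x - g (p x))).1; first by rewrite linearB gP subrr.
  by exists (y, p x); change (i y + g (p x) = x); rewrite ey subrK.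
apply: (isom_projective (P := prod_mod N M)); last exact: projective_prod.
by exists f, h.
Qed.

Lemma horseshoe d N X M : ses N X M -> pdle d N -> pdle d M -> pdle d X.
Proof.
elim: d N X M => [|d IH] N X M s.
  move=> /pdle0P pN /pdle0P pM; apply: pdle_projective.
  exact: ses_projective pN pM s.
move=> /pdleSP[N1 [P1 [pP1 s1 h1]]] /pdleSP[N2 [P2 [pP2 s2 h2]]].
have [i [p [ii sp ep]]] := s.
have [i1 [q1 [ii1 sq1 eq1']]] := s1; have [i2 [q2 [ii2 sq2 eq2']]] := s2.
have [h hP] := pP2 X M p q2 sp.
(* A cover of [X] whose kernel is an extension of [N2] by [N1], so that the induction hypothesis
   applies to it. *)
pose e : {linear (P1 * P2)%type -> X} :=
  (i \o q1 \o fst_mod P1 P2) \+ (h \o snd_mod P1 P2).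
have eE a b : e (a, b) = i (q1 a) + h b by [].
have pi x : p (i x) = 0 by apply/ep; exists x.
have se : surjective e.
  move=> x; have [b eb] := sq2 (p x).
  have [|n en] := (ep (x - h b)).1; first by rewrite linearB hP eb subrr.
  by have [a ea] := sq1 n; exists (a, b); rewrite eE ea en subrK.
have kerE (z : ker e) : i (q1 (val z).1) + h (val z).2 = 0.
  by have := valP z; rewrite inE => /eqP; rewrite -eE -surjective_pairing.
have mkker a b : i (q1 a) + h b = 0 -> exists z : ker e, val z = (a, b).
  move=> eab; have hz : (a, b) \in kerpred e by rewrite inE eE eab.
  by exists (exist _ (a, b) hz).
have q20 (z : ker e) : q2 (val z).2 = 0.
  by have := congr1 p (kerE z); rewrite linearD pi add0r hP linear0.
have [|j jP] := lift_inj (g := mk_linear (@inl_mod_linear P1 P2) \o i1)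
    (i := (val : ker e -> (P1 * P2)%type)) val_inj.
  move=> n; apply: mkker; have -> : q1 (i1 n) = 0 by apply/eq1'; exists n.
  by rewrite !linear0 addr0.
have [|r rP] := lift_inj (g := snd_mod P1 P2 \o (val : ker e -> (P1 * P2)%type)) ii2.
  by move=> z; apply/eq2'/q20.
apply: (pdle_ses (projective_prod pP1 pP2) (@ker_ses (prod_mod P1 P2) X e se)).
apply: IH h1 h2; exists j, r; split.
- move=> x y exy; apply: ii1; have := jP x; rewrite exy jP /=.
  by case.
- move=> n; have q0 : q2 (i2 n) = 0 by apply/eq2'; exists n.
  have [|m em] := (ep (h (i2 n))).1; first by rewrite hP.
  have [a ea] := sq1 m.
  have [|z ez] := mkker (- a) (i2 n); first by rewrite !linearN ea em addNr.
  by exists z; apply: ii2; rewrite rP /= ez.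
move=> z; split=> [rz|[n <-]].
  have z2 : (val z).2 = 0 by have := rP z; rewrite rz linear0.
  have := kerE z; rewrite z2 linear0 addr0 -(linear0 i) => /ii/eq1'[n en].
  exists n; apply: val_inj; apply: (etrans (jP n)); change ((i1 n, 0) = val z).
  by rewrite en -z2 -surjective_pairing.
by apply: ii2; rewrite rP linear0; exact: (congr1 snd (jP n)).
Qed.

Lemma pdle_proj_dim_le d M : pdle d M -> proj_dim_le M d.
Proof.
elim=> {d M} [d M pM|d N P0 M pP0 [i [p [ii sp ep]]] _ [P [eps [del [pP zP seps exeps exdel]]]]].
  pose P k := if k is 0 then M else zero_mod.
  exists P, (idfun : {linear M -> M}), (fun k => \0 : {linear P k.+1 -> P k}).
  have z0 : zero_module zero_mod by move=> x; apply: thinmx0.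
  split.
  - by case=> // k; apply: zero_projective.
  - by case.
  - by move=> x; exists x.
  - by move=> x; split=> [e|[y <-]] //; exists 0; apply: etrans (esym e).
  - by move=> k x; split=> // _; exists 0; rewrite linear0; apply/esym/z0.
pose Q k := if k is k'.+1 then P k' else P0.
pose dQ k : {linear Q k.+1 -> Q k} :=
  match k return {linear Q k.+1 -> Q k} with 0 => i \o eps | k'.+1 => del k' end.
exists Q, p, dQ; split=> //.
- by case.
- by case=> // k; apply: zP.
- move=> x; rewrite ep; split=> [[y <-]|[y <-]]; last by exists (eps y).
  by have [z <-] := seps y; exists z.
- case=> [|k] x; last exact: exdel.
  rewrite -exeps; split=> [e|e].
    by apply: ii; rewrite linear0; exact: e.
  by change (i (eps x) = 0); rewrite e linear0.
Qed.

Lemma proj_dim_le_pdle d M : proj_dim_le M d -> pdle d M.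
Proof.
elim: d M => [|d IH] M [P [eps [del [pP zP seps exeps exdel]]]].
  apply: pdle_projective; have [||g [fK gK]] := @linear_inverse _ _ _ eps => //.
    by apply: raddf_inj => x /exeps[y <-]; rewrite (zP 1%N isT y) linear0.
  by apply: isom_projective (pP 0%N); exists eps, g.
have [|e eP] := lift_inj (g := del 0%N) (i := (val : ker eps -> P 0%N)) val_inj.
  move=> x; have h : del 0%N x \in kerpred eps by rewrite inE; apply/eqP/exeps; exists x.
  by exists (exist _ (del 0%N x) h).
apply: (pdle_ses (pP 0%N) (ker_ses seps)); apply: IH.
exists (fun k => P k.+1), e, (fun k => del k.+1); split=> //.
- by move=> k dk; apply: zP.
- move=> z; have /exeps[y ey] : eps (val z) = 0 by apply/eqP; exact: (valP z).
  by exists y; apply: val_inj; apply: etrans (eP y) ey.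
- move=> x; rewrite -exdel -eP; split=> [->|e0]; first exact: linear0.
  by apply: val_inj; apply: etrans e0 _; rewrite linear0.
Qed.

End Homological.

(** * Presentations by the oriented cycle *)

Section Paths.
Variables (K : fieldType) (n : nat).
Local Notation cp := (cyclePath K n.+1).
Local Notation vx := (@inZp n).

Definition path_of (i l : nat) : cp :=
  CyclePath [ffun j => if j == vx i then 'X^l else 0].

Definition arrows : cp := CyclePath [ffun _ => 'X].

Lemma path_ofE i l j k : (path_of i l j)`_k = ((j == vx i) && (k == l))%:R.
Proof. by rewrite ffunE; case: eqP => _; rewrite ?coefXn ?coef0. Qed.

Lemma iter_ordS l i : iter l (@ordS n.+1) (vx i) = vx (i + l).
Proof.
elim: l => [|l IH]; first by rewrite addn0.
by rewrite iterS IH; apply: val_inj; rewrite /= -addn1 modnDml addn1 addnS.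
Qed.

Lemma vx_val (j : 'I_n.+1) : vx j = j.
Proof. exact: valZpK. Qed.

Lemma iter_ordS_ord l (j : 'I_n.+1) : iter l (@ordS n.+1) j = vx (j + l).
Proof. by rewrite -{1}(vx_val j) iter_ordS. Qed.

Lemma path_mul_coef i l (g : cp) j k : ((path_of i l * g) j)`_k =
  if (j == vx i) && (l <= k)%N then (g (vx (i + l)))`_(k - l) else 0.
Proof.
rewrite coef_cpMul; case: (leqP l k) => lk; last first.
  rewrite andbF big1 // => r _; rewrite path_ofE.
  have /negPf -> : (r : nat) != l by have := ltn_ord r; lia.
  by rewrite andbF mul0r.
rewrite andbT (bigD1 (Ordinal (lk : (l < k.+1)%N))) //= path_ofE eqxx andbT.
rewrite big1 ?addr0 => [|r rl].
  by case: eqP => [->|_]; rewrite ?mul0r // mul1r iter_ordS.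
rewrite path_ofE; have /negPf -> : (r : nat) != l.
  by apply: contra rl => /eqP e; apply/eqP/val_inj.
by rewrite andbF mul0r.
Qed.

Lemma path_mul i l m : path_of i l * path_of (i + l) m = path_of i (l + m).
Proof.
apply: cpP => j k; rewrite path_mul_coef !path_ofE eqxx /=.
case: (j == vx i) => //=; case: leqP => lk; first by congr (nat_of_bool _)%:R; lia.
by have /negPf -> : k != (l + m)%N by lia.
Qed.

Lemma path_arrows i l : path_of i l * arrows = path_of i l.+1.
Proof.
apply: cpP => j k; rewrite path_mul_coef path_ofE ffunE coefX.
case: (j == vx i) => //=; case: leqP => lk; first by congr (nat_of_bool _)%:R; lia.
by have /negPf -> : k != l.+1 by lia.
Qed.

Lemma path0 i : path_of i 0 = cpVertex K (vx i).
Proof. by apply: cpP => j k; rewrite !ffunE; case: eqP => _; rewrite ?expr0. Qed.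

Lemma path_modn i l : path_of (i + n.+1) l = path_of i l.
Proof.
apply: cpP => j k; rewrite !path_ofE.
by have -> : vx (i + n.+1) = vx i by apply: val_inj; rewrite /= modnDr.
Qed.

Lemma cp_sumE (I : Type) (r : seq I) (P : pred I) (F : I -> cp) j :
  (\sum_(x <- r | P x) F x) j = \sum_(x <- r | P x) F x j.
Proof.
by apply: (big_morph (fun f : cp => f j)) => [f g|]; [apply: cpDE | rewrite ffunE].
Qed.

Lemma path_expansion (f : cp) N : (forall v, size (f v) <= N)%N ->
  f = \sum_(v < n.+1) \sum_(l < N) (f v)`_l *: path_of v l.
Proof.
move=> sf; apply: cpP => j k; rewrite cp_sumE coef_sum (bigD1 j) //= [X in _ = _ + X]big1 ?addr0.
  rewrite cp_sumE coef_sum.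
  under eq_bigr => l _ do rewrite cpZE coefZ path_ofE vx_val eqxx /=.
  have [kN|Nk] := ltnP k N.
    rewrite (bigD1 (Ordinal kN)) //= eqxx mulr1 big1 ?addr0 // => l lk.
    by case: eqP => [e|]; rewrite ?mulr0 //; case/eqP: lk; apply: val_inj.
  rewrite nth_default ?(leq_trans (sf j)) // big1 // => l _.
  by case: eqP => [e|]; rewrite ?mulr0 //; have := ltn_ord l; lia.
move=> v vj; rewrite cp_sumE coef_sum big1 // => l _.
by rewrite cpZE coefZ path_ofE vx_val eq_sym (negPf vj) mulr0.
Qed.

Lemma path_expansion_ex (f : cp) : exists N,
  f = \sum_(v < n.+1) \sum_(l < N) (f v)`_l *: path_of v l.
Proof.
exists (\max_(v < n.+1) size (f v)); apply: path_expansion => v.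
exact: (leq_bigmax v).
Qed.

End Paths.

Section Presentation.
Variables (K : fieldType) (n : nat) (A : falgType K)
  (phi : {linear cyclePath K n.+1 -> A}) (adm : admissible_presentation phi).
Local Notation cp := (cyclePath K n.+1).
Local Notation vx := (@inZp n).
Local Notation path := (@path_of K n).

Lemma phiM f g : phi (f * g) = phi f * phi g.
Proof. by case: adm => -[_ h] _ _ _; apply: h. Qed.

Lemma phi1 : phi 1 = 1.
Proof. by case: adm => -[h _] _ _ _; apply: h. Qed.

Lemma phi_surj a : exists f, phi f == a.
Proof. by case: adm => _ h _ _; have [f <-] := h a; exists f. Qed.

Definition lift_phi (a : A) : cp := xchoose (phi_surj a).

Lemma lift_phiK : cancel lift_phi phi.
Proof. by move=> a; apply/eqP/(xchooseP (phi_surj a)). Qed.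

Lemma phi_path_ex i : exists l, phi (path i l) == 0.
Proof.
case: adm => _ _ _ [l _ h]; exists l; apply/eqP/h => j k kl.
by rewrite path_ofE ltn_eqF // andbF.
Qed.

(** The first length at which the path from [i] becomes zero; [dim_vertex] identifies it with the
    entry of the Kupisch series. *)
Definition klen (i : nat) : nat := ex_minn (phi_path_ex i).

Lemma phi_path i l : (phi (path i l) == 0) = (klen i <= l)%N.
Proof.
rewrite /klen; case: ex_minnP => m /eqP hm min; apply/idP/idP; first exact: min.
by move=> ml; rewrite -(subnKC ml) -path_mul phiM hm mul0r.
Qed.

Lemma klen_per i : klen (i + n.+1) = klen i.
Proof.
have h l : (klen (i + n.+1) <= l)%N = (klen i <= l)%N by rewrite -!phi_path path_modn.
by apply/eqP; rewrite eqn_leq h leqnn -h leqnn.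
Qed.

Lemma klen_modn i : klen (i %% n.+1)%N = klen i.
Proof. by rewrite [in RHS](divn_eq i n.+1) addnC (cyc_addMn _ _ klen_per). Qed.

Lemma klen_ge2 i : (1 < klen i)%N.
Proof.
rewrite ltnNge -phi_path; apply/negP => /eqP.
case: adm => _ _ h _ => /h/(_ (vx i) 1%N isT).
by rewrite path_ofE !eqxx => /eqP; rewrite oner_eq0.
Qed.

Lemma klen_step i : (klen i <= (klen i.+1).+1)%N.
Proof.
rewrite -phi_path; have -> : path i (klen i.+1).+1 = path i 1 * path (i + 1) (klen i.+1).
  by rewrite path_mul.
rewrite phiM addn1; have /eqP -> : phi (path i.+1 (klen i.+1)) == 0 by rewrite phi_path.
by rewrite mulr0.
Qed.

Lemma klen_mono : {homo (fun i => i + klen i)%N : i j / (i <= j)%N}.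
Proof. exact: step_mono klen_step. Qed.

(** The kernel of [phi] is spanned by paths, so [klen] determines it. If some coefficient at a
    surviving path is nonzero, take the shortest such path from [i] and multiply up to the longest
    surviving length: every other term dies. *)
Lemma phi_eq0 f : phi f = 0 <-> forall i l, (l < klen i)%N -> (f (vx i))`_l = 0.
Proof.
have main (g : cp) : (forall i l, (l < klen i)%N -> (g (vx i))`_l = 0) -> phi g = 0.
  move=> h; have [N ->] := path_expansion_ex g.
  rewrite linear_sum big1 // => v _; rewrite linear_sum big1 // => l _.
  rewrite linearZ /=; have [lk|kl] := ltnP l (klen v).
    by have := h v l lk; rewrite vx_val => ->; rewrite scale0r.
  by move: kl; rewrite -phi_path => /eqP /= ->; rewrite scaler0.
split=> [f0 i l|]; last exact: main.
elim/ltn_ind: l => l IH lk; apply/eqP/negPn/negP => fl.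
pose m := (klen i - 1 - l)%N.
have lm : (l + m = (klen i).-1)%N by rewrite /m; lia.
pose g := path i 0 * (f * path (i + l) m) - (f (vx i))`_l *: path i (klen i).-1.
have g0 : phi g = 0.
  apply: main => j k kj; rewrite cpDE coefD.
  have -> : ((- ((f (vx i))`_l *: path i (klen i).-1) : cp) (vx j))`_k =
      - ((f (vx i))`_l * ((vx j == vx i) && (k == (klen i).-1))%:R).
    by rewrite -scaleNr cpZE coefZ path_ofE mulNr.
  rewrite path_mul_coef leq0n andbT addn0 subn0.
  case: eqP => [e|_]; last by rewrite mulr0 subr0.
  have ji : klen j = klen i.
    by rewrite -(klen_modn j) -(klen_modn i); congr klen; exact: (congr1 val e).
  rewrite ji in kj; rewrite coef_cpMul.
  have [->|kl] := eqVneq k (klen i).-1.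
    have lk' : (l < (klen i).-1.+1)%N by lia.
    have hm : ((klen i).-1 - l = m)%N by lia.
    rewrite (bigD1 (Ordinal lk')) // iter_ordS path_ofE hm !eqxx andTb !mulr1.
    rewrite big1 => [|r rl]; first by rewrite [X in X - _]addr0 subrr.
    rewrite path_ofE; case: eqP => [_|]; rewrite ?mulr0 //=.
    case: eqP => [rm|]; rewrite ?mulr0 //; case/eqP: rl; apply: val_inj => /=.
    by have := ltn_ord r; lia.
  rewrite mulr0 subr0 big1 // => r _; rewrite iter_ordS path_ofE.
  case: (ltnP r l) => rl; first by rewrite IH ?mul0r //; lia.
  by case: (k - r =P m)%N => [e'|_]; rewrite ?andbF ?mulr0 //; have := ltn_ord r; lia.
move: g0; rewrite linearB linearZ /= phiM phiM f0 mul0r mulr0 sub0r => /eqP.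
rewrite oppr_eq0 scaler_eq0 (negPf fl) phi_path /=.
by have := klen_ge2 i; lia.
Qed.

End Presentation.

Section Isomorphism.
Variables (K : fieldType) (n : nat).
Local Notation cp := (cyclePath K n.+1).
Local Notation vx := (@inZp n).

Lemma vx_eqm i j : i = j %[mod n.+1] -> vx i = vx j.
Proof. by move=> e; apply: val_inj. Qed.

Definition rot_cp (r : nat) (f : cp) : cp := CyclePath [ffun j : 'I_n.+1 => f (vx (j + r))].

Lemma rot_cpE r f j : rot_cp r f j = f (vx (j + r)).
Proof. by rewrite ffunE. Qed.

Fact rot_cp_linear r : linear (rot_cp r).
Proof.
by move=> a f g; apply: cpP => j k; rewrite !(cpDE, cpZE, rot_cpE).
Qed.

Lemma rot_cp_vx r f i : rot_cp r f (vx i) = f (vx (i + r)).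
Proof. by rewrite rot_cpE; congr (f _); apply: vx_eqm; rewrite /= modnDml. Qed.

Lemma rot_cpM r f g : rot_cp r (f * g) = rot_cp r f * rot_cp r g.
Proof.
apply: cpP => j k; rewrite rot_cpE !coef_cpMul; apply: eq_bigr => l _.
by rewrite rot_cpE iter_ordS iter_ordS_ord rot_cp_vx addnAC.
Qed.

Lemma rot_cp1 r : rot_cp r 1 = 1.
Proof. by apply: cpP => j k; rewrite rot_cpE !ffunE. Qed.

(** [r + r * n] is a multiple of the number [n.+1] of vertices. *)
Lemma rot_cpK r : cancel (rot_cp (r * n)) (rot_cp r).
Proof.
move=> f; apply: cpP => j k; rewrite rot_cpE rot_cp_vx -{2}(vx_val j); congr ((f _)`_k).
by apply: vx_eqm; rewrite -addnA -mulnS addnC modnMDl.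
Qed.

Lemma rot_path r i l : rot_cp r (path_of K n (i + r) l) = path_of K n i l.
Proof.
apply: cpP => j k; rewrite rot_cpE !path_ofE; congr (nat_of_bool (_ && _))%:R.
by rewrite -{2}(vx_val j) -!val_eqE /= eqn_modDr.
Qed.

Lemma rotate_presentation (A : falgType K) (phi : {linear cp -> A})
    (adm : admissible_presentation phi) r :
  exists (psi : {linear cp -> A}) (adm' : admissible_presentation psi),
    forall i, klen adm' (i + r) = klen adm i.
Proof.
have adm' : admissible_presentation (phi \o mk_linear (rot_cp_linear r)).
  have [_ sur ker2 [l l2 kerl]] := adm; split.
  - split=> [|f g]; first by rewrite -(phi1 adm) /= -[in RHS](rot_cp1 r).
    by rewrite -(phiM adm) /= -rot_cpM.
  - move=> a; have [f <-] := sur a; exists (rot_cp (r * n) f).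
    by rewrite -[in RHS](rot_cpK r f).
  - move=> f /ker2 h j k k2; have := h (vx (j + r * n)) k k2.
    change ((rot_cp r f (vx (j + r * n)))`_k = 0 -> (f j)`_k = 0).
    rewrite rot_cp_vx -addnA -mulnSr; have -> // : vx (j + r * n.+1) = j.
    by rewrite -[RHS]vx_val; apply: vx_eqm; rewrite addnC modnMDl.
  - exists l => // f h; apply: kerl => j k kl.
    by change ((rot_cp r f j)`_k = 0); rewrite rot_cpE; apply: h.
exists _, adm' => i.
have h l : (klen adm' (i + r) <= l)%N = (klen adm i <= l)%N.
  by rewrite -!phi_path -[in RHS](rot_path r).
by apply/eqP; rewrite eqn_leq h leqnn -h leqnn.
Qed.

(** Equal [klen] gives equal kernels by [phi_eq0], so that [phi f] can be sent to [psi f]. *)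
Lemma presentation_iso (A B : falgType K) (phi : {linear cp -> A})
    (psi : {linear cp -> B}) (admA : admissible_presentation phi)
    (admB : admissible_presentation psi) :
  (forall i, klen admA i = klen admB i) -> isomorphic_algebras A B.
Proof.
move=> eqk.
have ker f : phi f = 0 <-> psi f = 0.
  by split=> /phi_eq0 h; apply/phi_eq0 => i l; [rewrite -eqk | rewrite eqk]; apply: h.
have eqA f g : phi f = phi g -> psi f = psi g.
  by move=> e; apply/subr0_eq; rewrite -linearB; apply/ker; rewrite linearB e subrr.
have eqB f g : psi f = psi g -> phi f = phi g.
  by move=> e; apply/subr0_eq; rewrite -linearB; apply/ker; rewrite linearB e subrr.
pose F a := psi (lift_phi admA a).
have linF : linear F.
  move=> k a b; rewrite /F -linearP; apply: eqA.
  by rewrite linearP !(lift_phiK admA).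
have monF : monoid_morphism F.
  split=> [|a b]; first by rewrite /F -(phi1 admB); apply: eqA; rewrite lift_phiK (phi1 admA).
  by rewrite /F -(phiM admB); apply: eqA; rewrite (phiM admA) !lift_phiK.
pose Fm : {lrmorphism A -> B} := HB.pack F
  (GRing.isLinear.Build K A B *:%R F linF) (GRing.isMonoidMorphism.Build A B F monF).
exists Fm; exists (fun b => phi (lift_phi admB b)) => x.
  change (phi (lift_phi admB (psi (lift_phi admA x))) = x).
  by rewrite -[RHS](lift_phiK admA); apply: eqB; rewrite lift_phiK.
change (psi (lift_phi admA (phi (lift_phi admB x))) = x).
by rewrite -[RHS](lift_phiK admB); apply: eqA; rewrite lift_phiK.
Qed.

End Isomorphism.

(** * Interval modules *)

Section Operators.
Variables (K : fieldType) (n : nat) (A : falgType K)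
  (phi : {linear cyclePath K n.+1 -> A}) (adm : admissible_presentation phi).
Local Notation cp := (cyclePath K n.+1).
Local Notation vx := (@inZp n).
Local Notation path := (@path_of K n).
Local Notation klen := (klen adm).

Section Module.
Variable M : lmodType A^c.
Implicit Types x y : M.

Definition opE (i : nat) x : M := (phi (path i 0) : A^c) *: x.
Definition opT x : M := (phi (arrows K n) : A^c) *: x.

Lemma act_phiM f g x : (phi (f * g) : A^c) *: x = (phi g : A^c) *: ((phi f : A^c) *: x).
Proof. by rewrite (phiM adm) scalerA. Qed.

Lemma act_path i l x : (phi (path i l) : A^c) *: x = iter l opT (opE i x).
Proof.
elim: l => [|l IH] //.
by rewrite -path_arrows act_phiM IH.
Qed.

Lemma arrows_vertex i : arrows K n * path i.+1 0 = path i 0 * arrows K n.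
Proof.
rewrite path_arrows; apply: cpP => j k; rewrite path_ofE coef_cpMul.
under eq_bigr => l _ do rewrite ffunE coefX path_ofE iter_ordS_ord.
have e : (vx (j + 1) == vx i.+1) = (j == vx i).
  by rewrite -{2}(vx_val j) -!val_eqE /= -[in RHS](eqn_modDr 1) !addn1.
case: k => [|k].
  by rewrite big_ord_recl big_ord0 mul0r addr0 andbF.
rewrite big_ord_recl mul0r add0r big_ord_recl /= mul1r /bump /= e.
rewrite big1 ?addr0 ?subSS ?subn0 => [|l _]; last by rewrite mul0r.
by case: k => //=; rewrite ?eqxx.
Qed.

Lemma opTE i x : opT (opE i x) = opE i.+1 (opT x).
Proof. by rewrite /opT /opE -!act_phiM arrows_vertex. Qed.

Lemma iter_opTE l i x : iter l opT (opE i x) = opE (i + l) (iter l opT x).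
Proof.
elim: l => [|l IH]; first by rewrite addn0.
by rewrite iterS IH opTE addnS.
Qed.

Lemma opEE i j x : opE i (opE j x) = if vx i == vx j then opE i x else 0.
Proof.
rewrite /opE -act_phiM; have -> : path j 0 * path i 0 = if vx i == vx j then path i 0 else 0.
  apply: cpP => v k; rewrite path_mul_coef addn0 subn0 leq0n andbT path_ofE.
  have [e|ne] := eqVneq (vx i) (vx j).
    by rewrite path_ofE -e; case: (v == vx i).
  by rewrite ffunE coef0; case: (_ == _).
by case: eqP => _ //; rewrite linear0 scale0r.
Qed.

Lemma opEid i x : opE i (opE i x) = opE i x.
Proof. by rewrite opEE eqxx. Qed.

Lemma sum_opE x : \sum_(v < n.+1) opE v x = x.
Proof.
rewrite -scaler_suml -linear_sum /= -[RHS]scale1r; congr (_ *: _).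
rewrite -[RHS]/(1 : A) -(phi1 adm); congr (phi _); apply: cpP => j k.
rewrite cp_sumE coef_sum (bigD1 j) //= path_ofE vx_val eqxx ffunE coef1.
by rewrite big1 ?addr0 // => v vj; rewrite path_ofE vx_val eq_sym (negPf vj).
Qed.

Lemma iter_opT_eq0 i l x : (klen i <= l)%N -> iter l opT (opE i x) = 0.
Proof. by rewrite -act_path -(phi_path adm) => /eqP ->; rewrite scale0r. Qed.

Lemma opT_linear : linear (opT : restr M -> restr M).
Proof. exact: act_linear. Qed.

Lemma opE_linear i : linear (opE i : restr M -> restr M).
Proof. exact: act_linear. Qed.

Lemma iter_opT_linear l : linear (iter l opT : restr M -> restr M).
Proof.
elim: l => [|l IH] a x y //; by rewrite !iterS IH opT_linear.
Qed.

Lemma opT_nilpotent : exists l, forall x, iter l opT x = 0.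
Proof.
set l := (\max_(v < n.+1) klen v)%N; exists l => x; rewrite -[x]sum_opE.
rewrite -[LHS]/(mk_linear (iter_opT_linear l) _) linear_sum big1 // => v _.
by apply: iter_opT_eq0; apply: (leq_bigmax v).
Qed.

End Module.

Arguments opT {M} x.

Lemma linear_opT (M N : lmodType A^c) (h : {linear M -> N}) x : h (opT x) = opT (h x).
Proof. exact: linearZ. Qed.

Lemma linear_opE (M N : lmodType A^c) (h : {linear M -> N}) i x : h (opE i x) = opE i (h x).
Proof. exact: linearZ. Qed.

Lemma linear_iter_opT (M N : lmodType A^c) (h : {linear M -> N}) l x :
  h (iter l (@opT M) x) = iter l (@opT N) (h x).
Proof. by elim: l => //= l IH; rewrite linear_opT IH. Qed.

(** The vertices and the sum of the arrows generate the algebra, so only their actions have to be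
    checked. *)
Lemma module_linear (M N : lmodType A^c) (h : M -> N) :
  linear (h : restr M -> restr N) -> (forall x, h (opT x) = opT (h x)) ->
  (forall i x, h (opE i x) = opE i (h x)) -> linear h.
Proof.
move=> lin hT hE.
have hTi l x : h (iter l (@opT M) x) = iter l (@opT N) (h x).
  by elim: l => //= l IH; rewrite hT IH.
pose hl := mk_linear lin.
have hZ (a : A) x : h ((a : A^c) *: x) = (a : A^c) *: h x.
  rewrite -(lift_phiK adm a); have [N1 e1] := path_expansion_ex (lift_phi adm a).
  rewrite e1 !linear_sum !scaler_suml.
  rewrite -[LHS]/(hl _) linear_sum; apply: eq_bigr => v _.
  rewrite !linear_sum !scaler_suml -[LHS]/(hl _) linear_sum; apply: eq_bigr => l _.
  rewrite !linearZ /= !act_algZ !act_path -[LHS]/(hl _) linearZ; congr (_ *: _).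
  by rewrite -[LHS]/(h _) hTi hE.
move=> a x y; rewrite -hZ.
by have := linearD hl ((a : A^c) *: x) y.
Qed.

(* A path [f] acts on row vectors on the right: the [t]-th basis vector sits at
   the vertex [i + t]. *)
Definition rep (i L : nat) (f : cp) : 'M[K]_L :=
  \matrix_(t, u) (if (t <= u)%N then (f (vx (i + t)))`_(u - t) else 0).

Lemma rep_linear i L : linear (rep i L).
Proof.
move=> a f g; apply/matrixP => t u; rewrite !mxE.
by case: ifP => _; rewrite ?mulr0 ?addr0 // cpDE coefD cpZE coefZ.
Qed.

Lemma rep_mul i L f g : rep i L (f * g) = rep i L f *m rep i L g.
Proof.
apply/matrixP => t u; rewrite !mxE.
pose F s : K := (if (t <= s)%N then (f (vx (i + t)))`_(s - t) else 0) *
  (if (s <= u)%N then (g (vx (i + s)))`_(u - s) else 0).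
rewrite [RHS](eq_bigr (fun s : 'I_L => F s)) => [|s _]; last by rewrite !mxE.
rewrite -(big_mkord xpredT F).
case: (leqP t u) => tu; last first.
  rewrite big1 // => s _; rewrite /F; case: leqP => ts; last by rewrite mul0r.
  by rewrite leqNgt (leq_trans tu ts) mulr0.
rewrite (big_cat_nat (n := t)) //=; last exact: ltnW.
rewrite big_nat_cond big1 ?add0r => [|s /andP[/andP[_ st] _]]; last first.
  by rewrite /F leqNgt st mul0r.
rewrite (big_cat_nat (n := u.+1)) //=; last exact: leqW.
rewrite [X in _ = _ + X]big_nat_cond [X in _ = _ + X]big1 ?addr0 => [|s]; last first.
  by move=> /andP[/andP[us _] _]; rewrite /F [(s <= u)%N]leqNgt us mulr0.
have -> : \sum_(t <= s < u.+1) F s = \sum_(0 <= s < u.+1 - t) F (s + t)%N.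
  by rewrite -{1}[nat_of_ord t]add0n big_addn.
rewrite subSn // big_mkord coef_cpMul.
apply: eq_bigr => l _; rewrite /F leq_addl addnK iter_ordS.
have ltu : (l + t <= u)%N by have := ltn_ord l; lia.
by rewrite ltu; congr (_ * (g (vx _))`_ _); lia.
Qed.

Lemma rep1 i L : rep i L 1 = 1%:M.
Proof.
apply/matrixP => t u; rewrite !mxE ffunE coef1 -val_eqE.
case: leqP => tu; first by congr (1 *+ nat_of_bool _); rewrite /=; lia.
by have /negPf -> : val t != val u by rewrite /=; lia.
Qed.

Lemma rep_eq0 i L f : (L <= klen i)%N -> phi f = 0 -> rep i L f = 0.
Proof.
move=> Li /(phi_eq0 adm) f0; apply/matrixP => t u; rewrite !mxE.
case: leqP => // tu; apply: f0.
have := klen_mono adm (leq_addr t i); have := ltn_ord u; rewrite /=; lia.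
Qed.

Lemma rep_lift i L a f : (L <= klen i)%N -> phi f = a -> rep i L (lift_phi adm a) = rep i L f.
Proof.
move=> Li fa; pose r := mk_linear (@rep_linear i L).
apply/subr0_eq; rewrite -[LHS]/(r _ - r _) -linearB; apply: rep_eq0 => //.
by rewrite linearB lift_phiK fa subrr.
Qed.

Section Interval.
Variables (i L : nat) (Li : (L <= klen i)%N).

(* The vacuous [let] makes the type remember the bound on [L], without which
   [rep] does not factor through [A]. *)
Definition intv : Type := let _ := Li in 'rV[K]_L.
HB.instance Definition _ := GRing.Zmodule.copy intv 'rV[K]_L.

Definition intv_scale (a : A^c) (v : intv) : intv := (v : 'rV_L) *m rep i L (lift_phi adm a).

Fact intv_scaleA a b v : intv_scale a (intv_scale b v) = intv_scale (a * b) v.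
Proof.
rewrite /intv_scale -mulmxA -rep_mul; congr (_ *m _); apply/esym/rep_lift => //.
by rewrite (phiM adm) !lift_phiK.
Qed.
Fact intv_scale1 : left_id 1 intv_scale.
Proof.
by move=> v; rewrite /intv_scale (rep_lift Li (phi1 adm)) rep1 mulmx1.
Qed.
Fact intv_scaleDr : right_distributive intv_scale +%R.
Proof. by move=> a u v; exact: mulmxDl. Qed.
Fact intv_scaleDl v : {morph intv_scale^~ v : a b / a + b}.
Proof.
move=> a b; rewrite /intv_scale.
have <- : rep i L (lift_phi adm a + lift_phi adm b) = rep i L (lift_phi adm (a + b)).
  by apply/esym/rep_lift => //; rewrite linearD !lift_phiK.
rewrite -mulmxDr; congr (_ *m _).
exact: (linearD (mk_linear (@rep_linear i L))).
Qed.

HB.instance Definition _ := GRing.Zmodule_isLmodule.Build A^c intv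
  intv_scaleA intv_scale1 intv_scaleDr intv_scaleDl.

Lemma intv_act f (v : intv) :
  ((phi f : A^c) *: v : intv) = (v : 'rV_L) *m rep i L f :> 'rV_L.
Proof. by congr (_ *m _); apply: rep_lift. Qed.

Lemma intvZE k (v : intv) : (k *: (v : restr intv) : restr intv) = k *: (v : 'rV_L) :> 'rV_L.
Proof.
rewrite restrZE; have -> : (k%:A : A^c) = phi (k *: (1 : cp)) by rewrite linearZ /= (phi1 adm).
rewrite intv_act; have -> : rep i L (k *: (1 : cp)) = k%:M.
  have -> : rep i L (k *: (1 : cp)) = k *: rep i L 1.
    by apply/matrixP => t u; rewrite !mxE; case: ifP => _; rewrite ?mulr0 // cpZE coefZ.
  by rewrite rep1 scalemx1.
by rewrite mul_mx_scalar.
Qed.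

Fact intv_fg : finitely_generated (A:=A) intv.
Proof.
have lin : linear (fun v : 'rV[K]_L => v : restr intv).
  by move=> k u v; rewrite intvZE.
by apply: (fg_of_span (h := mk_linear lin)) => v; exists v.
Qed.

Definition intv_mod : fgModule A := FgModule intv_fg.

Definition co (v : intv) (t : nat) : K :=
  if insub t is Some s then (v : 'rV_L) 0 s else 0.

Definition mkintv (F : nat -> K) : intv := \row_(t < L) F t.

Lemma co_ord v (t : 'I_L) : co v t = (v : 'rV_L) 0 t.
Proof. by rewrite /co valK. Qed.

Lemma co_mk F t : co (mkintv F) t = if (t < L)%N then F t else 0.
Proof. by rewrite /co; case: insubP => [s -> <-|/negPf -> //]; rewrite mxE. Qed.

Lemma co_out v t : (L <= t)%N -> co v t = 0.
Proof. by move=> Lt; rewrite /co insubF // ltnNge Lt. Qed.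

Lemma co_inj u v : (forall t, (t < L)%N -> co u t = co v t) -> u = v.
Proof.
by move=> e; apply/matrixP => r t; rewrite ord1 -!co_ord e.
Qed.

Lemma coD u v t : co (u + v) t = co u t + co v t.
Proof. by rewrite /co; case: insubP => [s _ _|_]; rewrite ?mxE ?addr0. Qed.

Lemma co0 t : co 0 t = 0.
Proof. by rewrite /co; case: insubP => [s _ _|_]; rewrite ?mxE. Qed.

Lemma coZ k v t : co (k *: (v : restr intv)) t = k * co v t.
Proof. by rewrite /co; case: insubP => [s _ _|_]; rewrite ?intvZE ?mxE ?mulr0. Qed.

Lemma co_opE j v t : co (opE j v) t = if vx j == vx (i + t) then co v t else 0.
Proof.
have [tL|Lt] := ltnP t L; last by rewrite !co_out //; case: ifP.
rewrite -[t]/(nat_of_ord (Ordinal tL)) !co_ord /opE intv_act mxE (bigD1 (Ordinal tL)) //= big1.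
  by rewrite mxE leqnn subnn path_ofE eqxx andbT eq_sym; case: eqP; rewrite ?mulr1 ?mulr0 addr0.
move=> s st; rewrite mxE; case: leqP => lst; rewrite ?mulr0 // path_ofE.
case: (t - s =P 0)%N => [e|]; last by rewrite andbF mulr0.
by case/eqP: st; apply: val_inj => /=; rewrite /= in lst; lia.
Qed.

Lemma co_opT v t : co (opT v) t = if (0 < t < L)%N then co v t.-1 else 0.
Proof.
have [tL|Lt] := ltnP t L; last by rewrite co_out // andbF.
rewrite andbT (_ : co (opT v) t = (opT v : 'rV_L) 0 (Ordinal tL)); last first.
  by rewrite -co_ord.
rewrite /opT intv_act mxE.
case: t tL => [|t] tL /=.
  rewrite big1 // => s _; rewrite mxE /=; case: leqP => lst; rewrite ?mulr0 //.
  by rewrite sub0n ffunE coefX mulr0.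
have tL' : (t < L)%N by apply: ltnW.
rewrite (bigD1 (Ordinal tL')) //= big1 ?addr0.
  by rewrite mxE /= leqnSn subSnn ffunE coefX mulr1 -co_ord.
move=> s st; rewrite mxE /=; case: leqP => lst; rewrite ?mulr0 // ffunE coefX.
case: (t.+1 - s =P 1)%N => [e|]; last by rewrite mulr0.
by case/eqP: st; apply: val_inj => /=; lia.
Qed.

Lemma co_iter_opT l v t : co (iter l opT v) t = if (l <= t < L)%N then co v (t - l) else 0.
Proof.
elim: l t => [|l IH] t.
  by rewrite subn0 /=; case: ltnP => // /co_out.
rewrite iterS co_opT; case: t => [|t] //=; rewrite IH ltnS subSS.
by case: (ltnP t.+1 L) => tL; rewrite ?(ltnW tL) ?andbT ?andbF.
Qed.

Definition intv_gen : intv := mkintv (fun t => (t == 0%N)%:R).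

Lemma intv_expand (v : intv) :
  v = \sum_(t < L) co v t *: (iter t (@opT intv) intv_gen : restr intv).
Proof.
have co_sum (F : 'I_L -> restr intv) t : co (\sum_(s < L) F s) t = \sum_(s < L) co (F s) t.
  by apply: (big_morph (fun u => co u t)) => [u w|]; [apply: coD | apply: co0].
apply: co_inj => t tL; have L0 : (0 < L)%N by apply: leq_ltn_trans tL.
rewrite co_sum (bigD1 (Ordinal tL)) //= coZ co_iter_opT.
rewrite leqnn tL /= co_mk subnn L0 mulr1 big1 ?addr0 //.
move=> s st; rewrite coZ co_iter_opT tL andbT co_mk.
case: (leqP s t) => lst; rewrite ?mulr0 //.
case: (t - s =P 0)%N => [e|]; last by case: ifP; rewrite mulr0.
by case/eqP: st; apply: val_inj => /=; lia.
Qed.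

Lemma opE_gen : opE i intv_gen = intv_gen.
Proof.
apply: co_inj => t tL; rewrite co_opE !co_mk tL.
by case: t tL => [|t] tL; rewrite ?addn0 ?eqxx //=; case: ifP.
Qed.

Lemma iter_opT_intv (v : intv) : iter L opT v = 0.
Proof. by apply: co_inj => t tL; rewrite co_iter_opT co0 leqNgt tL. Qed.

(** Universal property: the interval is generated by one element at vertex [i], whose only relation
    is that [L] arrows kill it. *)
Lemma hom_from_intv (M : lmodType A^c) (x : M) : opE i x = x -> iter L opT x = 0 ->
  exists h : {linear intv -> M}, forall v,
    h v = \sum_(t < L) co v t *: (iter t opT x : restr M).
Proof.
move=> Ex Tx.
pose h (v : intv) : M := \sum_(t < L) co v t *: (iter t opT x : restr M).
have lin : linear (h : restr intv -> restr M).
  move=> a u v; rewrite /h scaler_sumr -big_split; apply: eq_bigr => t _ /=.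
  by rewrite coD coZ scalerDl scalerA.
suff lin' : linear h by exists (mk_linear lin').
apply: module_linear => // [v|j v].
  rewrite /h -[RHS]/(mk_linear (@opT_linear M) _) linear_sum.
  pose F t : restr M := co (opT v) t *: (iter t opT x : restr M).
  pose G t : restr M := co v t *: (iter t.+1 opT x : restr M).
  transitivity (\sum_(0 <= t < L) F t); first by rewrite big_mkord.
  transitivity (\sum_(0 <= t < L) G t); last first.
    by rewrite big_mkord; apply: eq_bigr => t _; rewrite linearZ.
  have F0 : F 0%N = 0 by rewrite /F co_opT scale0r.
  have FS t : (t.+1 < L)%N -> F t.+1 = G t by move=> tL; rewrite /F /G co_opT tL.
  case: (L) Tx FS => [|L'] Tx FS; first by rewrite !big_geq.
  rewrite big_nat_recl // F0 add0r big_nat_recr //= {2}/G Tx scaler0 addr0.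
  by apply: eq_big_nat => t /andP[_ tL]; apply: FS.
rewrite /h -[RHS]/(mk_linear (@opE_linear M j) _) linear_sum; apply: eq_bigr => t _.
rewrite linearZ co_opE.
change ((if vx j == vx (i + t) then co v t else 0) *: (iter t opT x : restr M)
  = co v t *: (opE j (iter t opT x) : restr M)).
have -> : iter t opT x = opE (i + t) (iter t opT x) by rewrite -iter_opTE Ex.
by rewrite opEE; case: eqP => [e|_]; rewrite ?scale0r ?scaler0 // /opE /path_of e.
Qed.

Lemma hom_intvE (M : lmodType A^c) (h : {linear intv -> M}) v :
  h v = \sum_(t < L) co v t *: (iter t opT (h intv_gen) : restr M).
Proof.
rewrite [in LHS](intv_expand v) -[LHS]/(mk_linear (restr_linear h) _) linear_sum.
apply: eq_bigr => t _; rewrite linearZ; congr (_ *: _).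
exact: linear_iter_opT.
Qed.

End Interval.

Lemma intv_projective i L (Li : (L <= klen i)%N) : L = klen i -> projective (intv_mod Li).
Proof.
move=> eL U V p f sur.
have [u0 eu0] := sur (f (intv_gen Li)); pose u := opE i u0.
have pu : p u = f (intv_gen Li) by rewrite /u linear_opE eu0 -linear_opE opE_gen.
have [||h hE] := @hom_from_intv i L Li U u; first exact: opEid.
  by apply: iter_opT_eq0; rewrite eL.
exists h => v; rewrite hE [RHS]hom_intvE -[LHS]/(mk_linear (restr_linear p) _) linear_sum.
apply: eq_bigr => t _; rewrite linearZ; congr (_ *: _).
by apply: etrans (linear_iter_opT _ _ _) _; rewrite pu.
Qed.

(** Places the interval starting at [i + d] inside the one starting at [i]. If [d + m] were less
    than [L], [opT] would kill the last basis vector of the source but not its image. *)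
Lemma shift_linear i L d m (Li : (L <= klen i)%N) (Lm : (m <= klen (i + d))%N) :
  (L <= d + m)%N ->
  linear (fun v : intv Lm => mkintv Li (fun t => if (d <= t)%N then co v (t - d) else 0)).
Proof.
move=> Ldm; apply: module_linear => [a u v|v|j v]; apply: co_inj => t tL.
- by rewrite coD coZ !co_mk tL; case: ifP => _; rewrite ?coD ?coZ ?mulr0 ?addr0.
- rewrite co_opT !co_mk tL co_opT andbT.
  case: t tL => [|t] tL; first by rewrite sub0n; case: ifP.
  rewrite /= (ltnW tL); case: (leqP d t) => dt.
    rewrite (leqW dt); have -> : (0 < t.+1 - d < m)%N by lia.
    by congr co; lia.
  by case: ifP => // dt'; have -> : (t.+1 - d = 0)%N by lia.
- rewrite co_opE !co_mk tL; case: (leqP d t) => dt; last by case: ifP.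
  by rewrite co_opE -addnA subnKC.
Qed.

Lemma restrict_linear i L M (LM : (L <= M)%N) (Li : (L <= klen i)%N) (Mi : (M <= klen i)%N) :
  linear (fun v : intv Mi => mkintv Li (co v)).
Proof.
apply: module_linear => [a u v|v|j v]; apply: co_inj => t tL.
- by rewrite coD coZ !co_mk tL coD coZ.
- rewrite co_opT !co_mk tL co_opT (leq_trans tL LM) !andbT.
  by case: t tL => [|t] tL //=; rewrite (ltnW tL).
- by rewrite co_opE !co_mk tL co_opE.
Qed.

Lemma intv_ses i L (Li : (L <= klen i)%N) (Pi : (klen i <= klen i)%N)
    (Oi : (klen i - L <= klen (i + L))%N) :
  ses (intv_mod Oi) (intv_mod Pi) (intv_mod Li).
Proof.
have le : (klen i <= L + (klen i - L))%N by rewrite subnKC.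
exists (mk_linear (@shift_linear _ _ _ _ Pi Oi le)), (mk_linear (@restrict_linear _ _ _ Li Li Pi)).
split.
- move=> u v e; apply: co_inj => t tL.
  have := congr1 (fun w => co w (L + t)) e; rewrite !co_mk leq_addr addKn.
  by have -> : (L + t < klen i)%N by lia.
- move=> v; exists (mkintv Pi (co v)); apply: co_inj => t tL.
  by rewrite !co_mk tL (leq_trans tL).
move=> v; split=> [e|[u <-]].
  exists (mkintv Oi (fun t => co v (L + t))); apply: co_inj => t tk.
  rewrite !co_mk tk; case: (leqP L t) => Lt; last first.
    by have := congr1 (fun w => co w t) e; rewrite co_mk Lt co0.
  by rewrite subnKC // ltn_sub2r //; apply: leq_ltn_trans tk.
apply: co_inj => t tL; rewrite co0 !co_mk tL (leq_trans tL) //.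
by rewrite leqNgt tL.
Qed.

Lemma klen_syz i L : (L <= klen i)%N -> (klen i - L <= klen (i + L))%N.
Proof. by have := klen_mono adm (leq_addr L i); rewrite /=; lia. Qed.

(** A splitting of the cover would yield a vector with first coordinate 1 killed by [L < klen i]
    arrows, while in the cover such a vector survives them. *)
Lemma intv_projectiveP i L (Li : (L <= klen i)%N) :
  (0 < L)%N -> projective (intv_mod Li) -> L = klen i.
Proof.
move=> L0 pr; apply/eqP; rewrite eqn_leq Li leqNgt; apply/negP => Lk.
have Pi : (klen i <= klen i)%N by [].
pose q : {linear intv_mod Pi -> intv_mod Li} := mk_linear (@restrict_linear _ _ _ Li Li Pi).
have sq : surjective q.
  move=> v; exists (mkintv Pi (co v)); apply: co_inj => t tL.
  by rewrite !co_mk tL (leq_trans tL).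
have [g gP] := pr _ _ q idfun sq.
have w0 : co (g (intv_gen Li)) 0 = 1.
  have := congr1 (fun w => co w 0) (gP (intv_gen Li)).
  by rewrite !co_mk L0.
have : co (iter L opT (g (intv_gen Li))) L = 0.
  by rewrite -linear_iter_opT iter_opT_intv linear0 co0.
by rewrite co_iter_opT leqnn Lk subnn w0 => /eqP; rewrite oner_eq0.
Qed.

Definition syz_end (i : nat) : nat := (i + klen i)%N.

Lemma intv_pdle d i L (Li : (L <= klen i)%N) :
  (exists2 d0, (d0 <= d)%N & syz syz_end i (i + L) d0.+1 = syz syz_end i (i + L) d0.+2) ->
  pdle d (intv_mod Li).
Proof.
elim: d i L Li => [|d IH] i L Li [d0 d0d e].
  move: d0d e; rewrite leqn0 => /eqP -> /= e; apply/pdle_projective/intv_projective.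
  by move: e; rewrite /syz_end; lia.
case: d0 d0d e => [|d0] d0d e.
  apply/pdle_projective/intv_projective.
  by move: e; rewrite /= /syz_end; lia.
have Oi := klen_syz Li; have Pi : (klen i <= klen i)%N by [].
apply: (pdle_ses (@intv_projective _ _ Pi erefl) (@intv_ses _ _ Li Pi Oi)); apply: IH.
exists d0 => //; have -> : (i + L + (klen i - L) = syz_end i)%N by rewrite /syz_end; lia.
exact: e.
Qed.

(** Syzygies in an arbitrary resolution agree with intervals only up to projective summands, so the
    induction is over all [X] related to the interval by [stab]. *)
Lemma stab_intv_pdle d X i L (Li : (L <= klen i)%N) : (0 < L)%N ->
  stab X (intv_mod Li) -> pdle d X ->
  exists2 d0, (d0 <= d)%N & syz syz_end i (i + L) d0.+1 = syz syz_end i (i + L) d0.+2.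
Proof.
elim: d X i L Li => [|d IH] X i L Li L0 st hX.
  exists 0%N => //=; have := intv_projectiveP L0 (stab_projective st (pdle0P hX)).
  by rewrite /syz_end => ->.
have Oi := klen_syz Li; have Pi : (klen i <= klen i)%N by [].
have [X' st' hX'] := pdle_syz st hX (@intv_projective _ _ Pi erefl) (@intv_ses _ _ Li Pi Oi).
have eO : (i + L + (klen i - L) = syz_end i)%N by rewrite /syz_end; lia.
have [LK|kL] := ltnP L (klen i); last first.
  by exists 0%N => //=; rewrite /syz_end; lia.
have [|d0 d0d e] := IH _ _ _ _ _ st' hX'; first by rewrite subn_gt0.
by exists d0.+1 => //; move: e; rewrite eO.
Qed.

Lemma gl_dim_le_gdle d : gl_dim_le A d -> gdle syz_end d.
Proof.
move=> gd i j /andP[ij ji].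
have Li : (j - i <= klen i)%N by move: ji; rewrite /syz_end; lia.
have L0 : (0 < j - i)%N by rewrite subn_gt0.
have [d0 d0d] := stab_intv_pdle L0 (stab_refl (intv_mod Li)) (proj_dim_le_pdle (gd _)).
by rewrite subnKC; [exists d0 | apply: ltnW].
Qed.

Lemma coord_inverse (M : fgModule A) : exists d (h : {linear 'rV[K]_d -> restr M})
  (h' : {linear restr M -> 'rV[K]_d}), cancel h h' /\ cancel h' h.
Proof.
have [d [h [g hg gh]]] := fg_coord (fgmod_fg M); exists d, h.
have [||h' [hh' h'h]] := @linear_inverse _ _ _ h; first exact: can_inj hg.
  by move=> x; exists (g x).
by exists h'.
Qed.

Section InjCoord.
Variables (U V : fgModule A) (j : {linear U -> V}) (d e : nat)
  (hU : {linear 'rV[K]_d -> restr U}) (hU' : {linear restr U -> 'rV[K]_d})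
  (hV : {linear 'rV[K]_e -> restr V}) (hV' : {linear restr V -> 'rV[K]_e})
  (UK : cancel hU hU') (KU : cancel hU' hU) (VK : cancel hV hV') (KV : cancel hV' hV)
  (j_inj : injective j).

Definition inj_mx : 'M[K]_(d, e) :=
  lin1_mx (hV' \o mk_linear (restr_linear j) \o hU).

Lemma inj_mxE u : u *m inj_mx = hV' (j (hU u)).
Proof. exact: mul_rV_lin1. Qed.

Lemma inj_mx_free : row_free inj_mx.
Proof.
apply: inj_row_free => u; rewrite inj_mxE => h; apply: (can_inj UK); rewrite linear0; apply: j_inj.
by apply: (can_inj KV); rewrite h !linear0.
Qed.

Lemma proper_dim : ~ surjective j -> (d < e)%N.
Proof.
move=> ns; have de : (d <= e)%N by rewrite -{1}(eqP inj_mx_free) rank_leq_col.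
rewrite ltn_neqAle de andbT; apply/negP => /eqP ede; apply: ns => y.
have full : row_full inj_mx by rewrite /row_full (eqP inj_mx_free) ede.
have /submxP[D eD] : (hV' y <= inj_mx)%MS by apply: submx_full.
by exists (hU D); apply: (can_inj KV); rewrite -inj_mxE -eD.
Qed.

Lemma functional_extension (lam : {linear restr U -> K^o}) :
  exists lam' : {linear restr V -> K^o}, forall u, lam' (j u) = lam u.
Proof.
have /row_freeP[B JB] := inj_mx_free.
exists (lam \o hU \o mulmxr B \o hV') => u /=.
have -> : hV' (j u) = hU' u *m inj_mx by rewrite inj_mxE KU.
by rewrite -mulmxA JB mulmx1 KU.
Qed.

End InjCoord.

Lemma opE_vx (M : lmodType A^c) i j (x : M) : vx i = vx j -> opE i x = opE j x.
Proof. by rewrite /opE /path_of => ->. Qed.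

(** [opT] is nilpotent, so it is not onto a nonzero module; a nonzero column of the cokernel matrix
    is a functional vanishing on its image. *)
Lemma top_functional (M : fgModule A) : ~ zero_module M ->
  exists (lam : {linear restr M -> K^o}) x, lam x != 0 /\ forall y, lam (opT y) = 0.
Proof.
move=> nz; have [d [h [h' [hK Kh]]]] := coord_inverse M.
pose tau := lin1_mx (h' \o mk_linear (@opT_linear M) \o h).
have tauE u : u *m tau = h' (opT (h u)) by apply: mul_rV_lin1.
have nfull : ~~ row_full tau.
  apply/negP => full; apply: nz.
  have sT y : exists x, opT x = y :> M.
    have /submxP[D eD] : (h' y <= tau)%MS by apply: submx_full.
    by exists (h D); apply: (can_inj Kh); rewrite -tauE -eD.
  have sTl l : forall y : M, exists x : M, iter l opT x = y.
    elim: l => [|l IH] y; first by exists y.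
    by have [x ex] := sT y; have [z ez] := IH x; exists z; rewrite iterS ez.
  have [l nil] := opT_nilpotent M; move=> y.
  by have [x <-] := sTl l y.
have [r [c rc]] : exists r c, cokermx tau r c != 0.
  have : cokermx tau != 0.
    by rewrite -mxrank_eq0 mxrank_coker subn_eq0 -ltnNge ltn_neqAle rank_leq_col nfull.
  move=> /eqP ne; apply: NNPP => h0; apply: ne; apply/matrixP => r c; rewrite [RHS]mxE.
  by apply/eqP/negPn/negP => e; apply: h0; exists r, c.
have lin : linear (fun x : restr M => (h' x *m cokermx tau) 0 c : K^o).
  by move=> k x y; rewrite linearP mulmxDl -scalemxAl [LHS]mxE [X in X + _ = _]mxE.
exists (mk_linear lin), (h (delta_mx 0 r)); split.
  by change ((h' (h (delta_mx 0 r)) *m cokermx tau) 0 c != 0); rewrite hK -rowE mxE.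
move=> y; change ((h' (opT y) *m cokermx tau) 0 c = 0).
by rewrite -{1}(Kh y) -tauE -mulmxA mulmx_coker mulmx0 mxE.
Qed.

Lemma klen_ge1 i : (1 <= klen i)%N.
Proof. exact: ltnW (klen_ge2 adm i). Qed.

Lemma simple_quotient (M : fgModule A) : ~ zero_module M ->
  exists i (f : {linear M -> intv_mod (klen_ge1 i)}), surjective f.
Proof.
move=> /top_functional[lam [x [lx lT]]].
have [v lv] : exists v, lam (opE v x) != 0.
  apply: NNPP => h0; case/eqP: lx; rewrite -(sum_opE x).
  rewrite -[LHS]/(lam _) linear_sum big1 // => v _.
  by apply/eqP/negPn/negP => e; apply: h0; exists v.
pose f (y : M) : intv (klen_ge1 v) := mkintv _ (fun _ => lam (opE v y)).
have lamE : linear (fun y : restr M => lam (opE v y)).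
  by move=> k y z; rewrite -[opE v _]/(mk_linear (@opE_linear M v) _) !linearP.
have lin : linear f.
  apply: module_linear => [a u w|w|j w]; apply: co_inj => t tL.
  - by rewrite coD coZ !co_mk tL; exact: (linearP (mk_linear lamE)).
  - rewrite co_opT co_mk tL; have -> : (0 < t)%N = false by lia.
    by rewrite (@opE_vx _ v (v + n).+1) -?opTE ?lT //; apply: val_inj; rewrite /= -addnS modnDr.
  - rewrite co_opE !co_mk tL opEE eq_sym; have -> : t = 0%N by lia.
    by rewrite addn0; case: eqP => // _; rewrite linear0.
exists v, (mk_linear lin) => w.
exists (((co w 0 / lam (opE v x))%:A : A^c) *: x); apply: co_inj => t tL.
change (co (f (((co w 0 / lam (opE v x))%:A : A^c) *: x)) t = co w t).
rewrite co_mk tL; have -> : t = 0%N by lia.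
have := linearZ_LR (mk_linear lamE) (co w 0 / lam (opE v x)) x.
by move=> e; apply: etrans e _; rewrite /= -[RHS]mulr1 -(mulVf lv) mulrA.
Qed.

(** Only simple modules, the intervals of length one, are tested: the kernel of a simple quotient
    has smaller dimension, and the horseshoe lemma puts the two together. *)
Lemma gdle_gl_dim_le d : gdle syz_end d -> gl_dim_le A d.
Proof.
move=> gd M; apply: pdle_proj_dim_le.
have [e [h [h' [hK Kh]]]] := coord_inverse M.
elim/ltn_ind: e M h h' hK Kh => e IH M h h' hK Kh.
have [z|nz] := classic (zero_module M); first exact/pdle_projective/zero_projective.
have [i [f sf]] := simple_quotient nz.
have simple_pd : pdle d (intv_mod (klen_ge1 i)).
  have [|d0 d0d e0] := gd i (i + 1)%N.
    by rewrite /syz_end; have := klen_ge1 i; lia.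
  by apply: intv_pdle; exists d0.
apply: horseshoe (ker_ses sf) _ simple_pd.
have [e' [g [g' [gK Kg]]]] := coord_inverse (ker_mod f).
pose inc : {linear ker_mod f -> M} := (val : ker f -> M).
apply: (IH e' _ _ g g' gK Kg).
apply: (@proper_dim (ker_mod f) M inc e' e g g' h h' gK Kh).
  exact: val_inj.
move=> sinc; have [x ex] := sf (intv_gen (klen_ge1 i)).
have [y ey] := sinc x; have := congr1 (fun w => co w 0) ex.
have -> : f x = 0 by apply/eqP; rewrite -ey; exact: (valP y).
by rewrite co0 co_mk /= => /esym/eqP; rewrite oner_eq0.
Qed.

(** * Injective interval modules and holes *)

Lemma intv_gen_neq0 i L (Li : (L <= klen i)%N) : (0 < L)%N -> intv_gen Li <> 0.
Proof.
move=> L0 /(congr1 (fun w => co w 0)); rewrite co0 co_mk L0.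
by move/eqP; rewrite oner_eq0.
Qed.

Definition intv_last i L (Li : (L <= klen i)%N) : intv Li := iter L.-1 opT (intv_gen Li).

Section Last.
Variables (i L : nat) (Li : (L <= klen i)%N) (L0 : (0 < L)%N).

Lemma co_last t : co (intv_last Li) t = (t == L.-1)%:R.
Proof.
rewrite co_iter_opT co_mk; have [tL|Lt] := ltnP t L; last first.
  by rewrite andbF; have /negPf -> : t != L.-1 by lia.
rewrite andbT; case: (leqP L.-1 t) => h; last by have /negPf -> : t != L.-1 by lia.
have -> : t = L.-1 by lia.
by rewrite subnn L0 !eqxx.
Qed.

Lemma last_neq0 : intv_last Li <> 0.
Proof.
by move=> /(congr1 (fun w => co w L.-1))/eqP; rewrite co0 co_last eqxx oner_eq0.
Qed.

Lemma opT_last : opT (intv_last Li) = 0.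
Proof. by rewrite -iterS prednK // iter_opT_intv. Qed.

Lemma opE_last : opE (i + L.-1) (intv_last Li) = intv_last Li.
Proof. by rewrite -iter_opTE opE_gen. Qed.

Lemma socle_intv (v : intv Li) : opT v = 0 ->
  v = (co v L.-1 *: (intv_last Li : restr (intv Li)) : restr (intv Li)).
Proof.
move=> Tv; apply: co_inj => t tL; rewrite coZ co_last.
have [->|ne] := eqVneq t L.-1; first by rewrite mulr1.
have := congr1 (fun w => co w t.+1) Tv; rewrite co_opT co0 mulr0 /= => h.
by move: h; have -> : (t.+1 < L)%N by lia.
Qed.
End Last.

Lemma socle_exists (M : lmodType A^c) (P : M -> Prop) (x : M) : x <> 0 -> P x ->
  (forall y, P y -> P (opT y)) -> exists y, [/\ y <> 0, P y & opT y = 0].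
Proof.
move=> x0 Px PT; have [l nil] := opT_nilpotent M.
have := nil x; elim: l {nil} x x0 Px => [|l IH] x x0 Px; first by move=> /= e.
rewrite iterSr; have [Tx _|Tx e] := classic (opT x = 0); first by exists x.
by apply: (IH (opT x)) => //; apply: PT.
Qed.

Lemma restr_scale_eq0 (M : lmodType A^c) (k : K) (x : M) :
  (k *: (x : restr M) : restr M) = 0 -> x <> 0 -> k = 0.
Proof.
by move=> /eqP; rewrite scaler_eq0 => /orP[/eqP|/eqP].
Qed.

(** The socle of an interval is a line, whereas a product of two nonzero modules has two independent
    socle elements. *)
Lemma intv_indecomposable i L (Li : (L <= klen i)%N) :
  (0 < L)%N -> indecomposable (intv_mod Li).
Proof.
move=> L0; split; first by move=> z; apply: (intv_gen_neq0 L0 (z (intv_gen Li))).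
move=> U V /isomorphicP[f [g [fK gK]]]; apply: NNPP => /not_or_and[nU nV].
have soc (W : fgModule A) : ~ zero_module W -> exists y : W, y <> 0 /\ opT y = 0.
  move=> nW; have [x nx] := not_all_ex_not _ _ nW.
  by have [y [y0 _ Ty]] := @socle_exists W (fun _ => True) x nx I (fun _ _ => I); exists y.
have [u [u0 Tu]] := soc U nU; have [v [v0 Tv]] := soc V nV.
have Ta : opT (g (u, 0)) = 0.
  rewrite -linear_opT -(linear0 g); congr (g _).
  by apply: injective_projections; rewrite /= ?scaler0.
have Tb : opT (g (0, v)) = 0.
  rewrite -linear_opT -(linear0 g); congr (g _).
  by apply: injective_projections; rewrite /= ?scaler0.
have := socle_intv L0 Ta; set al := co _ _ => ea.
have := socle_intv L0 Tb; set be := co _ _ => eb.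
have e : (be *: (g (u, 0) : restr (intv Li)) : restr (intv Li)) =
    al *: (g (0, v) : restr (intv Li)).
  by rewrite [in LHS]ea [in RHS]eb !scalerA mulrC.
have : (be *: ((u, 0) : restr (U * V)%type) : restr _) = al *: ((0, v) : restr (U * V)%type).
  apply: (can_inj gK); rewrite [LHS](linearZ_LR (mk_linear (restr_linear g))).
  by rewrite [RHS](linearZ_LR (mk_linear (restr_linear g))).
move=> /(congr1 fst) /=; rewrite scaler0 => /restr_scale_eq0/(_ u0) be0.
move: eb; rewrite be0 scale0r => /(congr1 f); rewrite gK linear0.
by case=> /v0.
Qed.

(* A map to the interval is determined by its last coordinate, which is a linear
   functional on the vertex of the socle; conversely such a functional yields a
   map as soon as paths of length [L] vanish at the vertex before [i.+1]. *)
Lemma intv_injective i L (Li : (L <= klen i.+1)%N) : (klen i <= L)%N ->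
  injective_module (intv_mod Li).
Proof.
move=> iL U V j f ij.
have L0 : (0 < L)%N by apply: leq_trans iL; apply: klen_ge1.
have lin0 : linear (fun u : restr U => co (f u) L.-1 : K^o).
  move=> k u v; rewrite -[RHS]/(k * co (f u) L.-1 + co (f v) L.-1) -coZ -coD.
  by congr (co _ _); apply: (restr_linear f).
have [dU [hU [hU' [UK KU]]]] := coord_inverse U.
have [dV [hV [hV' [VK KV]]]] := coord_inverse V.
have [lam lamP] := functional_extension UK KU KV ij (mk_linear lin0).
pose m t := (L.-1 - t)%N.
pose H (v : V) : intv Li := mkintv Li (fun t => lam (opE (i + L) (iter (m t) opT v))).
have Elin t : linear (fun v : restr V => lam (opE (i + L) (iter (m t) opT v))).
  move=> k u v; rewrite (@iter_opT_linear V (m t)) (@opE_linear V (i + L)).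
  by rewrite linearP.
have linH : linear H.
  apply: module_linear => [k u v|v|k v]; apply: co_inj => t tL.
  - by rewrite coD coZ !co_mk tL; apply: Elin.
  - rewrite co_opT !co_mk tL andbT -iterSr; case: t tL => [|t] tL /=.
      have -> : opT (iter (m 0) opT v) = iter L opT v by rewrite /m subn0 -iterS prednK.
      by rewrite -iter_opTE iter_opT_eq0 // linear0.
    by rewrite (ltnW tL); have -> : m t = (m t.+1).+1 by rewrite /m; lia.
  - rewrite co_opE !co_mk tL.
    have eL : (i + L = i.+1 + t + m t)%N by rewrite /m; lia.
    rewrite eL -!iter_opTE opEE eq_sym; case: eqP => [e|_] //.
    by rewrite -[LHS]/(lam (mk_linear (@iter_opT_linear V _) _)) !linear0.
exists (mk_linear linH) => u; apply: co_inj => t tL.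
change (co (H (j u)) t = co (f u) t); rewrite co_mk tL.
rewrite -linear_iter_opT -linear_opE; apply: etrans (lamP _) _.
change (co (f (opE (i + L) (iter (m t) opT u))) L.-1 = co (f u) t).
rewrite linear_opE linear_iter_opT co_opE co_iter_opT.
have -> : vx (i + L) == vx (i.+1 + L.-1) by rewrite addSnnS prednK.
have -> : (m t <= L.-1 < L)%N by rewrite /m; lia.
by congr co; rewrite /m; lia.
Qed.

(** [i] is the last point with [syz_end i < j], so this is the longest interval ending at [j], the
    injective hull of its socle; the bound on [j] makes such a natural number exist. *)
Lemma injective_interval j : (syz_end 0 < j)%N ->
  exists i L, [/\ (L <= klen i.+1)%N, (0 < L)%N, (klen i <= L)%N & (i.+1 + L = j)%N].
Proof.
move=> j0; have ex : exists i, (j <= syz_end i)%N.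
  by exists j; rewrite /syz_end leq_addr.
case: (ex_minnP ex) => -[|i] hi min; first by rewrite leqNgt j0 in hi.
have ij : (i.+1 <= j.-1)%N by apply: min; rewrite /syz_end; have := klen_ge1 j.-1; lia.
have lt : (syz_end i < j)%N by rewrite ltnNge; apply/negP => /min; rewrite ltnn.
exists i, (j - i.+1)%N; rewrite /syz_end in hi lt *; split; lia.
Qed.

Lemma intv_isom i i' L (Li : (L <= klen i)%N) (Li' : (L <= klen i')%N) :
  vx i = vx i' -> isom (intv Li) (intv Li').
Proof.
have main k k' (Lk : (L <= klen k)%N) (Lk' : (L <= klen k')%N) : vx k = vx k' ->
    exists h : {linear intv Lk -> intv Lk'}, h (intv_gen Lk) = intv_gen Lk'.
  move=> e; have [||h hE] := @hom_from_intv k L Lk (intv Lk') (intv_gen Lk').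
  - by rewrite (opE_vx _ e) opE_gen.
  - exact: iter_opT_intv.
  exists h; rewrite hE [RHS](intv_expand (intv_gen Lk')); apply: eq_bigr => t _.
  by rewrite !co_mk.
move=> e; have [h hg] := main _ _ Li Li' e; have [h' hg'] := main _ _ Li' Li (esym e).
have inv k (Lk : (L <= klen k)%N) (g : {linear intv Lk -> intv Lk}) v :
    g (intv_gen Lk) = intv_gen Lk -> g v = v.
  by move=> eg; rewrite hom_intvE eg -intv_expand.
exists h, h'; split=> v.
  by rewrite -[LHS]/((h' \o h) v) inv //= hg hg'.
by rewrite -[LHS]/((h \o h') v) inv //= hg' hg.
Qed.

Lemma linear_inj_socle i L (Li : (L <= klen i)%N) (M : lmodType A^c)
    (g : {linear intv Li -> M}) : (0 < L)%N -> g (intv_last Li) <> 0 -> injective g.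
Proof.
move=> L0 gl; apply: raddf_inj => x gx; apply: NNPP => x0.
have [y [y0 gy Ty]] := @socle_exists _ (fun y => g y = 0) x x0 gx
  (fun y gy => etrans (linear_opT g y) (etrans (congr1 opT gy) (scaler0 _ _))).
have := socle_intv L0 Ty; move: (co y _) => al ey; apply: y0; rewrite ey.
have := gy; rewrite ey [LHS](linearZ_LR (mk_linear (restr_linear g))).
by move=> /restr_scale_eq0/(_ gl) ->; rewrite scale0r.
Qed.

(** A simple submodule of [M] also embeds in an injective interval as its socle. Injectivity of [M]
    extends the inclusion to that interval, injectivity of the interval splits it off, and
    indecomposability leaves no complement. *)
Lemma injective_classify (M : fgModule A) : indecomposable M -> injective_module M ->
  exists i L (Li : (L <= klen i.+1)%N),
    [/\ (0 < L)%N, (klen i <= L)%N & isom (intv_mod Li) M].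
Proof.
move=> [nz ind] inj; have [x0 nx0] := not_all_ex_not _ _ nz.
have [x1 [nx1 _ Tx1]] := @socle_exists M (fun _ => True) x0 nx0 I (fun _ _ => I).
have [v nx] : exists v, opE v x1 <> 0.
  apply: NNPP => h0; apply: nx1; rewrite -(sum_opE x1) big1 // => v _.
  by apply: NNPP => e; apply: h0; exists v.
pose x : M := opE v x1.
have Tx : opT x = 0 by rewrite opTE Tx1 /opE scaler0.
pose j := (v + (syz_end 0).+1 * n.+1)%N.
have [|i [L [Li L0 iL eL]]] := @injective_interval j.+1.
  rewrite ltnS /j; apply: leq_trans (leq_addl _ _).
  by apply: leq_trans (leqnSn _) _; apply: leq_pmulr.
exists i, L, Li; split=> //.
have ev : vx (i.+1 + L.-1) = vx v.
  have -> : (i.+1 + L.-1 = j)%N by lia.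
  by apply: vx_eqm; rewrite /j addnC modnMDl.
have [||f fE] := @hom_from_intv v 1 (klen_ge1 v) M x; first exact: opEid.
  exact: Tx.
have [||s sE] := @hom_from_intv v 1 (klen_ge1 v) (intv Li) (intv_last Li).
- by rewrite -(opE_vx _ ev) opE_last.
- exact: opT_last.
have gen_last : intv_last (klen_ge1 v) = intv_gen (klen_ge1 v) by [].
have on_gen (N : lmodType A^c) (y : N) (h : {linear intv (klen_ge1 v) -> N}) :
    (forall w, h w = \sum_(t < 1) co w t *: (iter t opT y : restr N)) ->
    h (intv_gen (klen_ge1 v)) = y.
  by move=> ->; rewrite big_ord1 co_mk scale1r.
have sinj : injective s.
  by apply: linear_inj_socle => //; rewrite gen_last (on_gen _ _ _ sE); apply: last_neq0.
have [g gE] := inj (intv_mod (klen_ge1 v)) (intv_mod Li) s f sinj.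
have ginj : injective g.
  apply: linear_inj_socle => //; rewrite -(on_gen _ _ _ sE).
  by have := gE (intv_gen (klen_ge1 v)); rewrite (on_gen _ _ _ fE) => ->.
have [r rE] := @intv_injective i L Li iL (intv_mod Li) M g idfun ginj.
have [|//|z0] := ind (intv_mod Li) (ker_mod r).
  apply/isomorphicP.
  pose inc : {linear ker_mod r -> M} := (val : ker r -> M).
  pose F : {linear (intv_mod Li * ker_mod r)%type -> M} :=
    (g \o fst_mod _ _) \+ (inc \o snd_mod _ _).
  have r0 (y : ker r) : r (val y) = 0 by apply/eqP; exact: (valP y).
  have FE a b : F (a, b) = g a + val b by [].
  have [||G [FG GF]] := @linear_inverse _ _ _ F; last by exists G, F.
    apply: raddf_inj => -[a b]; change (g a + val b = 0 -> (a, b) = 0) => e.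
    have a0 : a = 0 by have := congr1 r e; rewrite linearD r0 addr0 rE linear0.
    by move: e; rewrite a0 linear0 add0r => b0; congr pair; apply: val_inj.
  move=> y; have hy : y - g (r y) \in kerpred r by rewrite inE linearB rE subrr.
  exists (r y, exist _ (y - g (r y)) hy).
  by change (g (r y) + (y - g (r y)) = y); rewrite addrC subrK.
  by move=> z; case: (last_neq0 L0 (z (intv_last Li))).
exists g, r; split=> // y.
have hy : y - g (r y) \in kerpred r by rewrite inE linearB rE subrr.
by have /(congr1 val)/subr0_eq := z0 (exist _ (y - g (r y)) hy).
Qed.

Definition is_hole y := forall i, ~ (syz_end i = y %[mod n.+1]).

Lemma syz_end_addMn i t : syz_end (i + t * n.+1) = (syz_end i + t * n.+1)%N.
Proof. by rewrite /syz_end (cyc_addMn _ _ (klen_per adm)); lia. Qed.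

Lemma syz_end_mono : {homo syz_end : i j / (i <= j)%N}.
Proof. exact: klen_mono. Qed.

Lemma is_hole_eqm y z : y = z %[mod n.+1] -> is_hole y -> is_hole z.
Proof. by move=> e h i; rewrite -e; apply: h. Qed.

(** The end lies strictly between [syz_end i] and [syz_end i.+1], consecutive values of a monotone
    map commuting with shifts by [n.+1]. *)
Lemma gap_hole i L : (klen i <= L < klen i.+1)%N -> is_hole (i.+1 + L).
Proof.
move=> gap k e.
have key q t : (syz_end q <> i.+1 + L + t * n.+1)%N.
  move=> eq; have [qi|iq] := leqP q (i + t * n.+1).
    by have := syz_end_mono qi; rewrite syz_end_addMn eq /syz_end; lia.
  have : (i.+1 + t * n.+1 <= q)%N by rewrite addSn.
  by move=> /syz_end_mono; rewrite syz_end_addMn eq /syz_end; lia.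
have [t [et|et]] := eqm_split _ _ e; first exact: key et.
by apply: (key (k + t * n.+1)%N 0%N); rewrite syz_end_addMn -et mul0n addn0.
Qed.

Lemma hole_gap i L : (L <= klen i.+1)%N -> is_hole (i.+1 + L) -> (L < klen i.+1)%N.
Proof.
move=> Li h; rewrite ltn_neqAle Li andbT; apply/eqP => e.
by apply: (h i.+1); rewrite e.
Qed.

Lemma inj_nonproj_intv i L (Li : (L <= klen i.+1)%N) :
  (0 < L)%N -> (klen i <= L)%N -> (L < klen i.+1)%N -> inj_nonproj (intv_mod Li).
Proof.
move=> L0 iL Lk; split; [exact: intv_indecomposable | exact: intv_injective |].
by move=> /(intv_projectiveP L0) e; rewrite e ltnn in Lk.
Qed.

(** The socle sits at the vertex just before the end, and an isomorphism preserves that vertex. *)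
Lemma isom_end i L i' L' (Li : (L <= klen i)%N) (Li' : (L' <= klen i')%N) :
  (0 < L)%N -> (0 < L')%N -> isom (intv Li) (intv Li') ->
  (i + L)%N = (i' + L')%N %[mod n.+1].
Proof.
move=> L0 L0' [f [g [fK gK]]].
have Tf : opT (f (intv_last Li)) = 0 by rewrite -linear_opT opT_last // linear0.
have := socle_intv L0' Tf; set be := co _ _ => ef.
have f0 : f (intv_last Li) <> 0.
  by move=> e; apply: (last_neq0 L0 (Li := Li)); apply: (can_inj fK); rewrite e linear0.
have : opE (i + L.-1) (f (intv_last Li)) = f (intv_last Li).
  by rewrite -linear_opE opE_last.
have El : f (intv_last Li) = opE (i' + L'.-1) (f (intv_last Li)).
  rewrite ef; pose E := mk_linear (@opE_linear (intv Li') (i' + L'.-1)).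
  apply: etrans _ (esym (linearZ_LR E _ _)).
  by congr (_ *: _); rewrite [RHS]opE_last.
rewrite El opEE; case: eqP => [/(congr1 val)/= e _|_ e]; last first.
  by case: f0; rewrite El -e.
have -> : (i + L = i + L.-1 + 1)%N by lia.
have -> : (i' + L' = i' + L'.-1 + 1)%N by lia.
by rewrite -modnDml e modnDml.
Qed.

Lemma hole_interval y : is_hole y -> exists i L (Li : (L <= klen i.+1)%N),
  [/\ (0 < L)%N, (klen i <= L < klen i.+1)%N & (i.+1 + L)%N = y %[mod n.+1]].
Proof.
move=> hy; pose j := (y + (syz_end 0).+1 * n.+1)%N.
have ej : j = y %[mod n.+1] by rewrite modnDMr.
have [|i [L [Li L0 iL eL]]] := @injective_interval j.
  by apply: leq_trans (leq_addl _ _); apply: leq_pmulr.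
exists i, L, Li; split=> //; last by rewrite eL.
by rewrite iL hole_gap // eL; apply: is_hole_eqm (esym ej) hy.
Qed.

Lemma isom_trans (U V W : lmodType A^c) : isom U V -> isom V W -> isom U W.
Proof.
move=> [f [g [fK gK]]] [f' [g' [fK' gK']]]; exists (f' \o f), (g \o g').
by split=> x /=; rewrite ?fK' ?fK ?gK ?gK'.
Qed.

Lemma same_end_isom i L i' L' (Li : (L <= klen i.+1)%N) (Li' : (L' <= klen i'.+1)%N) :
  (klen i <= L < klen i.+1)%N -> (klen i' <= L' < klen i'.+1)%N ->
  (i.+1 + L)%N = (i'.+1 + L')%N %[mod n.+1] -> isom (intv Li) (intv Li').
Proof.
have main k M k' M' t : (klen k <= M < klen k.+1)%N -> (klen k' <= M' < klen k'.+1)%N ->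
    (k.+1 + M = k'.+1 + M' + t * n.+1)%N -> k = (k' + t * n.+1)%N.
  move=> gap gap' e; apply/eqP; rewrite eqn_leq; apply/andP; split; rewrite leqNgt; apply/negP.
    by rewrite -addSn => /syz_end_mono; rewrite syz_end_addMn /syz_end; lia.
  by move=> /syz_end_mono; rewrite syz_end_addMn /syz_end; lia.
move=> gap gap' /eqm_split[t [e|e]].
  have ek := main _ _ _ _ _ gap gap' e; have eL : L = L' by lia.
  case: _ / eL Li' {gap'} e => Li' _; apply: intv_isom.
  by apply: vx_eqm; rewrite ek -addSn modnDMr.
have ek := main _ _ _ _ _ gap' gap e; have eL : L = L' by lia.
case: _ / eL Li' {gap'} e => Li' _; apply: intv_isom.
by apply: vx_eqm; rewrite ek -addSn modnDMr.
Qed.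

Lemma inj_nonproj_classify (M : fgModule A) : inj_nonproj M ->
  exists i L (Li : (L <= klen i.+1)%N),
    [/\ (0 < L)%N, (klen i <= L < klen i.+1)%N & isom (intv_mod Li) M].
Proof.
move=> [ind inj npr]; have [i [L [Li [L0 iL iso]]]] := injective_classify ind inj.
exists i, L, Li; split=> //; rewrite iL ltn_neqAle Li andbT; apply/eqP => e.
by apply: npr; apply: isom_projective iso (intv_projective e).
Qed.

(** Sending an interval to its end matches the injective non-projective indecomposables with the
    holes modulo [n.+1]. *)
Lemma unique_inj_nonprojP : unique_inj_nonproj A <->
  exists b, is_hole b /\ forall y, is_hole y -> y = b %[mod n.+1].
Proof.
split=> [[M hM uM]|[b [hb ub]]].
  have [i [L [Li [L0 gap iso]]]] := inj_nonproj_classify hM.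
  exists (i.+1 + L)%N; split=> [|y hy]; first exact: gap_hole.
  have [i' [L' [Li' [L0' gap' e]]]] := hole_interval hy.
  have /andP[iL' Lk'] := gap'.
  have /isomorphicP iso' := uM _ (inj_nonproj_intv Li' L0' iL' Lk').
  rewrite -e; apply: (isom_end (Li := Li') (Li' := Li)) => //.
  exact: isom_trans iso' (isom_sym iso).
have [i [L [Li [L0 gap e]]]] := hole_interval hb; have /andP[iL Lk] := gap.
exists (intv_mod Li); first exact: inj_nonproj_intv.
move=> M' /inj_nonproj_classify[i' [L' [Li' [L0' gap' iso']]]]; apply/isomorphicP.
apply: isom_trans (isom_sym iso') _; apply: same_end_isom => //.
by rewrite e; apply: ub; apply: gap_hole.
Qed.

End Operators.

(** * Construction from a Kupisch series *)

(** The surviving paths starting at [i] form a basis. *)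
Lemma dim_vertex (K : fieldType) (n : nat) (A : falgType K)
    (phi : {linear cyclePath K n.+1 -> A}) (adm : admissible_presentation phi) (i : 'I_n.+1) :
  \dim (<[phi (cpVertex K i)]> * {:A})%VS = klen adm i.
Proof.
have e0 : cpVertex K i = path_of K n i 0 by rewrite path0 vx_val.
pose X := [tuple phi (path_of K n i l) | l < klen adm i].
have XE (l : 'I_(klen adm i)) : X`_l = phi (path_of K n i l).
  by rewrite -tnth_nth tnth_mktuple.
have sumE (k : 'I_(klen adm i) -> K) :
    \sum_(l < klen adm i) k l *: X`_l = phi (\sum_(l < klen adm i) k l *: path_of K n i l).
  by rewrite linear_sum; apply: eq_bigr => l _; rewrite linearZ XE.
have coefE (k : 'I_(klen adm i) -> K) (l : 'I_(klen adm i)) v :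
    ((\sum_(l < klen adm i) k l *: path_of K n i l) v)`_l = if v == i then k l else 0.
  rewrite cp_sumE coef_sum (bigD1 l) // big1 => [|l' ll'].
    by rewrite [LHS]addr0 cpZE coefZ path_ofE vx_val eqxx andbT; case: eqP; rewrite ?mulr1 ?mulr0.
  have /negPf e : (l : nat) != l' by rewrite eq_sym val_eqE.
  by rewrite cpZE coefZ path_ofE e andbF mulr0.
have freeX : free X.
  apply/freeP => k; rewrite sumE => /(phi_eq0 adm) h l.
  by have := h i l (ltn_ord l); rewrite vx_val coefE eqxx.
have -> : (<[phi (cpVertex K i)]> * {:A} = <<X>>)%VS.
  apply/eqP; rewrite eqEsubv; apply/andP; split; last first.
    apply/span_subvP => x /tnthP[l ->]; rewrite tnth_mktuple.
    have -> : phi (path_of K n i l) = phi (cpVertex K i) * phi (path_of K n i l).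
      rewrite -(phiM adm) e0; congr (phi _).
      by have := @path_mul K n i 0 l; rewrite addn0 add0n => ->.
    by apply: memv_mul; rewrite ?memv_line ?memvf.
  apply/prodvP => x b /vlineP[k ->] _; rewrite -scalerAl; apply: memvZ.
  rewrite -(lift_phiK adm b) -(phiM adm) e0; set f := lift_phi adm b.
  have -> : phi (path_of K n i 0 * f) =
      \sum_(l < klen adm i) (f i)`_l *: X`_l.
    rewrite sumE; apply/subr0_eq; rewrite -linearB; apply/(phi_eq0 adm) => j l lj.
    have -> : (path_of K n i 0 * f - \sum_(l0 < klen adm i) (f i)`_l0 *: path_of K n i l0) =
      (path_of K n i 0 * f + (-1) *: \sum_(l0 < klen adm i) (f i)`_l0 *: path_of K n i l0).
      by rewrite scaleN1r.
    rewrite cpDE coefD cpZE coefZ mulN1r path_mul_coef leq0n andbT addn0 subn0 vx_val.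
    have [ji|ji] := eqVneq (inZp j) i; last first.
      rewrite cp_sumE coef_sum big1 ?subrr // => l' _.
      by rewrite cpZE coefZ path_ofE vx_val (negPf ji) mulr0.
    have lk : (l < klen adm i)%N by rewrite -ji klen_modn.
    by rewrite (coefE _ (Ordinal lk)) ji eqxx subrr.
  by apply: memv_suml => l _; apply: memvZ; apply: memv_span; apply: mem_nth; rewrite size_tuple.
by move: freeX; rewrite /free size_tuple => /eqP.
Qed.

Section Concrete.
Variables (K : fieldType) (n : nat) (c : nat -> nat).
Hypotheses (c_per : forall i, c (i + n.+1)%N = c i) (c_ge2 : forall i, (1 < c i)%N)
  (c_step : forall i, (c i <= (c i.+1).+1)%N).
Local Notation cp := (cyclePath K n.+1).
Local Notation vx := (@inZp n).

(* The vacuous [let] makes the type remember the hypotheses on [c], which the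
   ring axioms need. *)
Definition nak : Type :=
  let _ := (c_per, c_ge2, c_step) in {ffun {v : 'I_n.+1 & 'I_(c v)} -> K^o}.
HB.instance Definition _ := Vector.copy nak {ffun {v : 'I_n.+1 & 'I_(c v)} -> K^o}.

Definition path_index (v : 'I_n.+1) (l : 'I_(c v)) : {v : 'I_n.+1 & 'I_(c v)} :=
  Tagged (fun v : 'I_n.+1 => 'I_(c v)) l.

Definition trunc (f : cp) : nak := 
  [ffun x : {v : 'I_n.+1 & 'I_(c v)} => (f (tag x))`_(tagged x) : K^o].

Definition untrunc (g : nak) : cp :=
  CyclePath [ffun v : 'I_n.+1 => \poly_(l < c v)
    ((if (insub l : option 'I_(c v)) is Some s then g (path_index s) else 0) : K)].

Lemma truncP (f g : cp) : (forall (v : 'I_n.+1) l, (l < c v)%N -> (f v)`_l = (g v)`_l) ->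
  trunc f = trunc g.
Proof. by move=> h; apply/ffunP => -[v l]; rewrite !ffunE /=; apply: h. Qed.

Lemma truncE (f g : cp) : trunc f = trunc g ->
  forall (v : 'I_n.+1) l, (l < c v)%N -> (f v)`_l = (g v)`_l.
Proof.
move=> /ffunP h v l lv.
by have := h (path_index (Ordinal lv)); rewrite !ffunE.
Qed.

Lemma untruncK : cancel untrunc trunc.
Proof.
move=> g; apply/ffunP => -[v l]; rewrite !ffunE /= coef_poly ltn_ord.
by rewrite valK.
Qed.

Lemma trunc_linear : linear trunc.
Proof.
move=> a f g; apply/ffunP => x; rewrite [LHS]ffunE cpDE cpZE coefD coefZ.
by rewrite !ffunE.
Qed.

Lemma c_mono i j : (i <= j)%N -> (i + c i <= j + c j)%N.
Proof. by move=> ij; apply: (step_mono c c_step i j ij). Qed.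

Lemma c_vx i : c (vx i) = c i.
Proof.
by rewrite [in RHS](divn_eq i n.+1) addnC (cyc_addMn _ _ c_per).
Qed.

(** Coefficients in range of a product involve only coefficients in range: [l <= k < c v] gives
    [k - l < c (v + l)], because [c] drops by at most one per step. *)
Lemma truncM (f f' g g' : cp) : trunc f = trunc f' -> trunc g = trunc g' ->
  trunc (f * g) = trunc (f' * g').
Proof.
move=> /truncE ef /truncE eg; apply: truncP => v k kv.
rewrite !coef_cpMul; apply: eq_bigr => l _; have lk : (l <= k)%N by rewrite -ltnS.
rewrite ef ?(leq_ltn_trans lk) // iter_ordS_ord; congr (_ * _); apply: eg.
by rewrite c_vx; have := c_mono (leq_addr l v); lia.
Qed.

Definition nak_mul (x y : nak) : nak := trunc (untrunc x * untrunc y).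

Lemma trunc_mul (f g : cp) : trunc (f * g) = nak_mul (trunc f) (trunc g).
Proof. by apply: truncM; rewrite untruncK. Qed.

Fact nak_mulA : associative nak_mul.
Proof.
move=> x y z; rewrite -(untruncK x) -(untruncK y) -(untruncK z).
by rewrite -!trunc_mul mulrA.
Qed.
Fact nak_mul1x : left_id (trunc 1) nak_mul.
Proof. by move=> x; rewrite -(untruncK x) -trunc_mul mul1r. Qed.
Fact nak_mulx1 : right_id (trunc 1) nak_mul.
Proof. by move=> x; rewrite -(untruncK x) -trunc_mul mulr1. Qed.
Lemma truncD (f g : cp) : trunc (f + g) = trunc f + trunc g.
Proof. exact: (linearD (mk_linear trunc_linear)). Qed.
Lemma truncZ a (f : cp) : trunc (a *: f) = a *: trunc f.
Proof. exact: (linearZ_LR (mk_linear trunc_linear)). Qed.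
Fact nak_mulDl : left_distributive nak_mul +%R.
Proof.
move=> x y z; rewrite -(untruncK x) -(untruncK y) -(untruncK z).
by rewrite -truncD -!trunc_mul mulrDl truncD.
Qed.
Fact nak_mulDr : right_distributive nak_mul +%R.
Proof.
move=> x y z; rewrite -(untruncK x) -(untruncK y) -(untruncK z).
by rewrite -truncD -!trunc_mul mulrDr truncD.
Qed.
Fact nak_one_neq0 : trunc 1 != 0.
Proof.
apply/eqP => /ffunP/(_ (path_index (Ordinal (ltnW (c_ge2 (ord0 : 'I_n.+1)))))).
by rewrite !ffunE coef1 => /eqP; rewrite oner_eq0.
Qed.

HB.instance Definition _ := GRing.Zmodule_isNzRing.Build nak
  nak_mulA nak_mul1x nak_mulx1 nak_mulDl nak_mulDr nak_one_neq0.

Fact nak_scaleAl (a : K) (x y : nak) : a *: (x * y) = a *: x * y.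
Proof.
rewrite -(untruncK x) -(untruncK y) -[LHS]/(a *: nak_mul _ _) -[RHS]/(nak_mul _ _).
rewrite -trunc_mul -truncZ -[in RHS]truncZ -[RHS]trunc_mul.
by congr trunc; apply: cpScaleAl.
Qed.
Fact nak_scaleAr (a : K) (x y : nak) : a *: (x * y) = x * (a *: y).
Proof.
rewrite -(untruncK x) -(untruncK y) -[LHS]/(a *: nak_mul _ _) -[RHS]/(nak_mul _ _).
rewrite -trunc_mul -truncZ -[in RHS]truncZ -[RHS]trunc_mul.
by congr trunc; apply: cpScaleAr.
Qed.
HB.instance Definition _ := GRing.Lmodule_isLalgebra.Build K nak nak_scaleAl.
HB.instance Definition _ := GRing.Lalgebra_isAlgebra.Build K nak nak_scaleAr.
HB.instance Definition _ := Algebra_isFalgebra.Build K nak.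

Lemma trunc_admissible :
  admissible_presentation (mk_linear trunc_linear : {linear cp -> (nak : falgType K)}).
Proof.
split.
- by split=> [//|f g]; apply: trunc_mul.
- by move=> a; exists (untrunc a); apply: untruncK.
- move=> f f0 v l l2.
  have := @truncE f 0 (etrans f0 (esym (linear0 (mk_linear trunc_linear)))) v l.
  by rewrite ffunE coef0; apply; apply: leq_trans (c_ge2 v).
exists (maxn 2 (\max_(v < n.+1) c v)); first exact: leq_maxl.
move=> f hf; rewrite -(linear0 (mk_linear trunc_linear)); apply: truncP => v l lv.
rewrite ffunE coef0; apply: hf; apply: leq_trans lv _.
by apply: leq_trans (leq_maxr _ _); apply: (leq_bigmax v).
Qed.

Lemma klen_trunc i : klen trunc_admissible i = c i.
Proof.
have h l : (klen trunc_admissible i <= l)%N = (c i <= l)%N.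
  rewrite -phi_path; apply/eqP/idP => [e|il].
    rewrite leqNgt; apply/negP => li.
    have e0 := etrans e (esym (linear0 (mk_linear trunc_linear))).
    have := @truncE (path_of K n i l) 0 e0 (vx i) l.
    by rewrite c_vx path_ofE !eqxx ffunE coef0 => /(_ li)/eqP; rewrite oner_eq0.
  rewrite -(linear0 (mk_linear trunc_linear)); apply: truncP => v k kv.
  rewrite path_ofE [in RHS]ffunE coef0; case: eqP => [e|] //=; case: eqP => [e'|] //.
  by move: kv; rewrite e c_vx e' ltnNge il.
by apply/eqP; rewrite eqn_leq h leqnn -h leqnn.
Qed.

End Concrete.

Lemma cnakayama_exists (K : fieldType) (n : nat) (c : nat -> nat) :
  (forall i, c (i + n.+1)%N = c i) -> (forall i, (1 < c i)%N) ->
  (forall i, (c i <= (c i.+1).+1)%N) ->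
  exists (A : falgType K) (phi : {linear cyclePath K n.+1 -> A})
    (adm : admissible_presentation phi), forall i, klen adm i = c i.
Proof.
move=> per ge2 step; exists (nak K per ge2 step), (mk_linear (trunc_linear per ge2 step)).
exists (trunc_admissible K per ge2 step); exact: klen_trunc.
Qed.

(** * Classification *)

(** Each equation is the division of [N] by [p], with remainder [p - v] or [p - u]. *)
Lemma quotient_unique (N p b v c u : nat) : (0 < v <= p)%N -> (0 < u <= p)%N ->
  (N + v = p * b.+1)%N -> (N + u = p * c.+1)%N -> b = c /\ v = u.
Proof.
have quo d x : (0 < x <= p)%N -> (N + x = p * d.+1)%N -> d = (N %/ p)%N.
  move=> xp e; have -> : (N = d * p + (p - x))%N by rewrite mulnS mulnC in e; lia.
  by rewrite divnMDl ?divn_small ?addn0 //; lia.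
move=> vp up ev eu; have ebc : b = c by rewrite (quo _ _ vp ev) (quo _ _ up eu).
by split=> //; rewrite ebc in ev; lia.
Qed.

Lemma left_form_unique (n p a s w a' s' w' : nat) :
  left_form n a s p w -> left_form n a' s' p w' -> a' = a /\ s' = s.
Proof.
move=> [wp -> e] [wp' -> e'].
by have [-> ->] := quotient_unique wp wp' e e'.
Qed.

Lemma right_form_unique (n p a s w a' s' w' : nat) : (0 < n)%N ->
  right_form n a s p w -> right_form n a' s' p w' -> a' = a /\ s' = s.
Proof.
move=> n0 [wp -> e] [wp' -> e'].
by have [||-> ->] := @quotient_unique n.-1 p a w a' w' wp wp'; try lia.
Qed.

Lemma left_formula (n m p a w s : nat) : (1 < n)%N -> (n + 1 = m + 2 * p)%N ->
  left_form n a s p w ->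
  a = ((2 * n) %/ (n - m + 1))%N /\
  s%:R = a%:R / 2 * ((a%:R - 1) * n%:R - (a%:R + 1) * m%:R + a%:R - 1) + 1 :> rat.
Proof.
move=> n1 em [/andP[w0 wp] es en].
have -> : (n - m + 1 = 2 * p)%N by lia.
rewrite divnMl //; have p0 : (0 < p)%N by lia.
split.
  have -> : (n = a * p + (p - w))%N by nia.
  by rewrite divnMDl // divn_small ?addn0 //; lia.
(* Writing [w = v + 1] removes the truncated predecessor before the passage to [rat]. *)
have [v ev] : exists v, w = v.+1 by exists w.-1; lia.
have nR : n%:R = p%:R * (a%:R + 1) - (v%:R + 1) :> rat.
  by rewrite -!(natrD _ _ 1) -natrM; apply/(canRL (addrK _)); rewrite -natrD; congr _%:R; lia.
have mR : m%:R = n%:R + 1 - 2 * p%:R :> rat.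
  by rewrite -(natrD _ _ 1) -natrM; apply/(canRL (addrK _)); rewrite -natrD; congr _%:R; lia.
by rewrite es ev /= natrD natrM mR nR; field.
Qed.

Lemma right_formula (n m p a w s : nat) : (1 < n)%N -> (n = m + 2 * p)%N ->
  right_form n a s p w ->
  a = ((2 * (n - 1)) %/ (n - m))%N /\
  s%:R = a%:R / 2 * ((a%:R - 1) * n%:R - (a%:R + 1) * m%:R + 2) :> rat.
Proof.
move=> n1 em [/andP[w0 wp] es en].
have -> : (n - m = 2 * p)%N by lia.
rewrite divnMl //; have p0 : (0 < p)%N by lia.
split.
  have -> : (n - 1 = a * p + (p - w))%N by nia.
  by rewrite divnMDl // divn_small ?addn0 //; lia.
have nR : n%:R = p%:R * (a%:R + 1) + 1 - w%:R :> rat.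
  rewrite -!(natrD _ _ 1) -natrM -(natrD _ _ 1); apply/(canRL (addrK _)).
  by rewrite -natrD; congr _%:R; lia.
have mR : m%:R = n%:R - 2 * p%:R :> rat.
  by rewrite -natrM; apply/(canRL (addrK _)); rewrite -natrD; congr _%:R; lia.
by rewrite es natrM mR nR; field.
Qed.

Lemma d1_parameters (n m : nat) : (1 < n)%N -> (1 <= m <= n - 1)%N ->
  exists a s : nat,
  [/\ (odd (n - m) ->
         a = ((2 * n) %/ (n - m + 1))%N /\
         s%:R = a%:R / 2 *
                ((a%:R - 1) * n%:R - (a%:R + 1) * m%:R + a%:R - 1) + 1 :> rat),
      (~~ odd (n - m) ->
         a = ((2 * (n - 1)) %/ (n - m))%N /\
         s%:R = a%:R / 2 *
                ((a%:R - 1) * n%:R - (a%:R + 1) * m%:R + 2) :> rat),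
      (1 < a)%N /\ (0 < s < n)%N,
      gdeq (d1f n a s) (n + m - 1) &
      forall a' s', (1 < a')%N -> (0 < s')%N -> (s' < n)%N ->
        gdeq (d1f n a' s') (n + m - 1) -> a' = a /\ s' = s].
Proof.
move=> n1 /andP[m1 mn].
have [o|o] := boolP (odd (n - m)).
  pose p := (n - m + 1)./2; have ep : (2 * p = n - m + 1)%N.
    by rewrite mul2n halfK addn1 /= o subn0.
  have p0 : (0 < p)%N by lia.
  pose a := (n %/ p)%N; have en := divn_eq n p; rewrite -/a in en.
  have rp := ltn_pmod n p0; set r := (n %% p)%N in en rp.
  (* Chosen so that [n + w = p * a.+1] with [0 < w <= p]. *)
  pose w := (p - r)%N; pose s := (w.-1 * a + 1)%N.
  have a2 : (2 <= a)%N by rewrite leq_divRL //; lia.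
  have form : left_form n a s p w by split; [lia | by [] | nia].
  have s0 : (0 < s)%N by rewrite /s addn1.
  have sn : (s < n)%N.
    have h : (w.-1 * a.+1 <= p.-1 * a.+1)%N by rewrite leq_mul2r; lia.
    by have := h; rewrite /s; nia.
  exists a, s; split=> //.
  - by move=> _; apply: (left_formula n1 _ form); lia.
  - by split=> //; rewrite s0.
  - by apply: (left_gdeq n a s n1 a2 s0 sn p w) => //; lia.
  move=> a' s' a2' s0' sn' /(d1_classify n a' s' n1 a2' s0' sn').
  (* The other form would give [n + m - 1] the wrong parity. *)
  move=> [p' [w' [[f' e]|[_ e]]]]; last by lia.
  have pp : p' = p by lia.
  by rewrite pp in f'; apply: left_form_unique form f'.
pose p := (n - m)./2; have ep : (2 * p = n - m)%N.
  by rewrite mul2n halfK (negPf o) subn0.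
have p0 : (0 < p)%N by lia.
pose a := ((n - 1) %/ p)%N; have en := divn_eq (n - 1) p; rewrite -/a in en.
have rp := ltn_pmod (n - 1) p0; set r := ((n - 1) %% p)%N in en rp.
pose w := (p - r)%N; pose s := (w * a)%N.
have a2 : (2 <= a)%N by rewrite leq_divRL //; lia.
have form : right_form n a s p w by split; [lia | by [] | nia].
have s0 : (0 < s)%N by rewrite muln_gt0; lia.
have sn : (s < n)%N.
  have h : (w * a <= p * a)%N by rewrite leq_mul2r; lia.
  by have := h; rewrite /s; lia.
exists a, s; split=> //.
- by move=> _; apply: (right_formula n1 _ form); lia.
- by split=> //; rewrite s0.
- by apply: (right_gdeq n a s n1 a2 s0 sn p w) => //; lia.
move=> a' s' a2' s0' sn' /(d1_classify n a' s' n1 a2' s0' sn').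
move=> [p' [w' [[_ e]|[f' e]]]]; first by lia.
have pp : p' = p by lia.
by rewrite pp in f'; apply: right_form_unique form f'; lia.
Qed.

Lemma syz_ext f g : f =1 g -> forall i j t, syz f i j t = syz g i j t.
Proof. by move=> fg i j t; elim: t i j => [|t IH] i j //=; rewrite IH fg. Qed.

Lemma gdeq_ext f g d : f =1 g -> gdeq f d -> gdeq g d.
Proof.
have main u v e : u =1 v -> gdle u e -> gdle v e.
  move=> uv h i j ij; have [|d0 d0e eq0] := h i j; first by rewrite uv.
  by exists d0 => //; rewrite -!(syz_ext uv).
move=> fg [h min]; split; first exact: main fg h.
by move=> d' h'; apply/min/(main _ _ _ _ h') => x; rewrite fg.
Qed.

Section Assembly.
Variables (K : fieldType) (n : nat).
Local Notation cp := (cyclePath K n.+1).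

Lemma gl_dim_eqP (A : falgType K) (phi : {linear cp -> A})
    (adm : admissible_presentation phi) d : gl_dim_eq A d <-> gdeq (syz_end adm) d.
Proof.
split=> -[h min]; split.
- exact: gl_dim_le_gdle h.
- by move=> d' /(gdle_gl_dim_le (adm := adm))/min.
- exact: gdle_gl_dim_le h.
- by move=> d' /(gl_dim_le_gdle (adm := adm))/min.
Qed.

Lemma d1_unique_hole a s : (0 < n)%N -> (1 < a)%N -> (0 < s < n.+1)%N ->
  (forall i, ~ (d1f n.+1 a s i = s + a %[mod n.+1])%N) /\
  forall y, (forall i, ~ (d1f n.+1 a s i = y %[mod n.+1])%N) -> (y = s + a %[mod n.+1])%N.
Proof.
move=> n0 a1 /andP[s0 sn]; split=> [i|y hy]; first exact: f_hole.
pose z := ((y + a * n) %% n.+1)%N.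
have zy : (z + a = y %[mod n.+1])%N.
  by rewrite modnDml -addnA -mulnSr modnDMr.
have zn : (z < n.+1)%N by apply: ltn_pmod.
have [zs|sz|<-] := ltngtP z s; last by rewrite zy.
  by case: (hy z); rewrite /d1f (modn_small zn) leqNgt zs addn0.
have zn' : (z.-1 < n.+1)%N by lia.
case: (hy z.-1); rewrite -zy /d1f (modn_small zn').
have -> : (s <= z.-1)%N by lia.
by congr (_ %% _)%N; lia.
Qed.

Lemma D1_normal_form (A : falgType K) (d : nat) : (0 < n)%N ->
  D1_CNakayama n.+1 A -> gl_dim_eq A d ->
  exists (phi : {linear cp -> A}) (adm : admissible_presentation phi) a s,
    [/\ (1 < a)%N, (0 < s < n.+1)%N, gdeq (d1f n.+1 a s) d &
        forall i, klen adm i = (a + (s <= i %% n.+1))%N].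
Proof.
move=> n0 [[phi adm] uniq] gd.
have [b [hb ub]] := (unique_inj_nonprojP adm).1 uniq.
have kgt i : (i < i + klen adm i)%N by have := klen_ge2 adm i; lia.
have [r [a [s [sn kE]]]] := @one_hole_shape n.+1 (klen adm) b n0 (klen_per adm)
  (klen_step adm) kgt hb ub.
(* [r * n] is congruent to [- r] modulo [n.+1], so this rotation brings the first short entry to
   vertex 0. *)
have [psi [adm' kE']] := rotate_presentation adm (r * n).
have kl i : klen adm' i = (a + (s <= i %% n.+1))%N.
  rewrite -kE -kE' -[LHS](cyc_addMn _ _ (klen_per adm') _ r).
  by congr (klen _ _); rewrite mulnS; lia.
exists psi, adm', a, s; split=> //.
  have := klen_ge2 adm' 0; rewrite kl mod0n; case/andP: sn => s0 _.
  have -> : (s <= 0)%N = false by lia.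
  by rewrite addn0.
apply: gdeq_ext (_ : syz_end adm' =1 _) _; last exact/gl_dim_eqP.
by move=> i; rewrite /syz_end kl /d1f addnA.
Qed.

Lemma d1_kupisch (A : falgType K) (phi : {linear cp -> A})
    (adm : admissible_presentation phi) a s : (s < n.+1)%N ->
  (forall i, klen adm i = (a + (s <= i %% n.+1))%N) -> is_N n.+1 a s A.
Proof.
move=> sn kl; split; first by rewrite size_cat !size_nseq; lia.
exists phi => // i; rewrite (dim_vertex adm) kl nth_cat size_nseq !nth_nseq.
rewrite modn_small ?ltn_ord //; case: ltnP => si; first by rewrite addn0.
have -> : (i - s < n.+1 - s)%N by have := ltn_ord i; lia.
by rewrite addn1.
Qed.

Lemma kupisch_klen (A : falgType K) a s : (s < n.+1)%N -> is_N n.+1 a s A ->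
  exists (phi : {linear cp -> A}) (adm : admissible_presentation phi),
    forall i, klen adm i = (a + (s <= i %% n.+1))%N.
Proof.
move=> sn [_ [phi adm dimE]]; exists phi, adm => i.
have iN : (i %% n.+1 < n.+1)%N by apply: ltn_pmod.
rewrite -(klen_modn adm); have := dimE (Ordinal iN).
rewrite (dim_vertex adm) /= => ->.
rewrite nth_cat size_nseq !nth_nseq; case: ltnP => si; first by rewrite addn0.
have -> : (i %% n.+1 - s < n.+1 - s)%N by lia.
by rewrite addn1.
Qed.

Lemma D1_exists a s d : (0 < n)%N -> (1 < a)%N -> (0 < s < n.+1)%N ->
  gdeq (d1f n.+1 a s) d ->
  exists A : falgType K, [/\ D1_CNakayama n.+1 A, gl_dim_eq A d & is_N n.+1 a s A].
Proof.
move=> n0 a1 sn gd; have [hole only] := d1_unique_hole n0 a1 sn.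
have [|||A [phi [adm kl]]] := @cnakayama_exists K n (fun i => a + (s <= i %% n.+1))%N _ _ _.
- by move=> i; rewrite modnDr.
- by move=> i; lia.
- by move=> i; case/andP: sn => s0 sn; rewrite modnS; case: ifP; lia.
have eE i : syz_end adm i = d1f n.+1 a s i by rewrite /syz_end kl /d1f addnA.
exists A; split.
- split; first by exists phi.
  apply/(unique_inj_nonprojP adm); exists (s + a)%N; split=> [i|y hy].
    by rewrite eE; apply: hole.
  by apply: only => i; rewrite -eE; apply: hy.
- by apply/(gl_dim_eqP adm)/(gdeq_ext _ gd) => i; rewrite eE.
- by apply: (d1_kupisch (adm := adm)) => //; case/andP: sn.
Qed.

End Assembly.

Theorem proposition3p12 (K : fieldType) (n m : nat) :
  (2 <= n)%N -> (1 <= m <= n - 1)%N ->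
  exists a s : nat,
  [/\ (odd (n - m) ->
         a = ((2 * n) %/ (n - m + 1))%N /\
         s%:R = a%:R / 2 *
                ((a%:R - 1) * n%:R - (a%:R + 1) * m%:R + a%:R - 1) + 1 :> rat),
      (~~ odd (n - m) ->
         a = ((2 * (n - 1)) %/ (n - m))%N /\
         s%:R = a%:R / 2 *
                ((a%:R - 1) * n%:R - (a%:R + 1) * m%:R + 2) :> rat),
      (2 <= a)%N /\ (1 <= s <= n - 1)%N,
      (exists Z : falgType K, is_Z n m Z) /\
      (exists N : falgType K, is_N n a s N) &
      forall Z N : falgType K,
        is_Z n m Z -> is_N n a s N -> isomorphic_algebras Z N].
Proof.
move=> n2 mn; have [a [s [fo fe [a2 sn] gd uniq]]] := d1_parameters n2 mn.
case: n n2 mn fo fe sn gd uniq => // n n2 mn fo fe sn gd uniq.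
exists a, s; split=> //; first by split=> //; lia.
  by have [A [D1 gA NA]] := D1_exists K n2 a2 sn gd; split; exists A.
move=> Z N [D1 gZ] isN.
have [phi [adm [a' [s' [a2' sn' gd' kl]]]]] := D1_normal_form n2 D1 gZ.
have /andP[s0 sn1] := sn; have /andP[s0' sn1'] := sn'.
have [ea es] := uniq _ _ a2' s0' sn1' gd'; subst a' s'.
have [psi [adm' kl']] := kupisch_klen sn1 isN.
by apply: (presentation_iso (admA := adm) (admB := adm')) => i; rewrite kl kl'.
Qed.
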